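(* Let $d\geqslant 1$ be an integer with $d\not\equiv 1 \pmod 4$. Then there exist constants $C,c>0$ (depending only on $d$) such that, for every $0<r<1/4$, for every positive integer $N$, for every even integer $M$ with \[ M\geqslant C\,N^{1+\frac{1}{2d}}\,r^{-1}, \] and for every finite sequence $\mathcal P_N=\{p_n\}_{n=1}^N$ in $\mathbb T^d$, \[ \left(\frac{1}{(\operatorname{card}\mathbb J_M)^{d}}\sum_{k=1,2}\ \sum_{j_1,\ldots,j_d\in\mathbb J_M}\left|\mathscr D\left(\Big(\frac{j_1}{M},\ldots,\frac{j_d}{M}\Big)+B_{kr},\mathcal P_N\right)\right|^2\right)^{\frac12}\geqslant c\,r^{\frac d2}N^{\frac12-\frac1{2d}} . \]
   Context: $\mathbb T^d=\mathbb R^d/\mathbb Z^d$. For $0<\rho<1/2$, $B_\rho=\{x\in\mathbb R^d:|x|<\rho\}+\mathbb Z^d$ is the (periodized) ball of radius $\rho$ and center $0$ in the torus, and $|B_\rho|$ is its Lebesgue measure in the torus, i.e. the Lebesgue measure of $\{x\in\mathbb R^d:|x|<\rho\}$. For $x\in\mathbb T^d$ and a finite sequence $\mathcal P_N=\{p_n\}_{n=1}^N$ in $\mathbb T^d$, \[ \mathscr D(x+B_\rho,\mathcal P_N)=\sum_{n=1}^N\chi_{x+B_\rho}(p_n)-N|B_\rho| . \] For an even integer $M$, $\mathbb J_M=\{j\in\mathbb Z:-M/2\leqslant j<M/2\}$, so $\operatorname{card}\mathbb J_M=M$. *)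

(* Defs.v *)
From HB Require Import structures.
From mathcomp Require Import all_boot all_order all_algebra.
From mathcomp Require Import generic_quotient ring_quotient.
From mathcomp Require Import all_classical all_reals all_analysis.
Set Implicit Arguments.
Unset Strict Implicit.
Unset Printing Implicit Defensive.
Import Order.TTheory GRing.Theory Num.Theory.
Local Open Scope classical_set_scope.
Local Open Scope ring_scope.

(* Lebesgue measure on R^n as the n-fold product of [lebesgue_measure], first
   on tuples (which carry the product sigma-algebra), then on row vectors. *)
Fixpoint lebesgue_tuple (R : realType) (n : nat) :
    set (n.-tuple (measurableTypeR R)) -> \bar R :=
  match n with
  | 0 => fun A => \d_([tuple] : 0.-tuple (measurableTypeR R)) A
  | m.+1 => pushforward (@lebesgue_measure R \x @lebesgue_tuple R m)%E
              (fun x => [tuple of x.1 :: x.2])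
  end.

Definition lebesgue_rV (R : realType) (d : nat) (A : set 'rV[R]_d) : \bar R :=
  lebesgue_tuple [set t : d.-tuple (measurableTypeR R) | A (\row_i tnth t i)].

(* The norm [`|x|] that the library puts on row vectors is the sup norm. *)
Definition enorm (R : realType) (d : nat) (x : 'rV[R]_d) : R :=
  Num.sqrt (\sum_i x ord0 i ^+ 2).

Definition eball (R : realType) (d : nat) (rho : R) : set 'rV[R]_d :=
  [set x | enorm x < rho].
Arguments eball {R} d rho _.

Definition Zlattice (R : realType) (d : nat) (x : 'rV[R]_d) : bool :=
  x \is a mxOver Num.int.

Fact Zlattice_closed (R : realType) (d : nat) : zmod_closed (@Zlattice R d).
Proof.
split=> [|x y]; rewrite -!topredE /= /Zlattice; first exact/mxOver0/rpred0.
by move=> /mxOverP hx /mxOverP hy; apply/mxOverP => i j; rewrite !mxE rpredB.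
Qed.

HB.instance Definition _ (R : realType) (d : nat) :=
  GRing.isZmodClosed.Build 'rV[R]_d (@Zlattice R d) (@Zlattice_closed R d).

Definition Zlattice_zmod (R : realType) (d : nat) : zmodClosed 'rV[R]_d :=
  GRing.ZmodClosed.clone 'rV[R]_d (@Zlattice R d) _.

Definition torus (R : realType) (d : nat) : zmodType :=
  Quotient.quot (Zlattice_zmod R d).

Definition to_torus (R : realType) (d : nat) (x : 'rV[R]_d) : torus R d :=
  \pi_(Quotient.quot (Zlattice_zmod R d))%qT x.

Definition tball (R : realType) (d : nat) (rho : R) : set (torus R d) :=
  (@to_torus R d) @` eball d rho.
Arguments tball {R} d rho _.

Definition ball_discrepancy (R : realType) (d N : nat) (x : torus R d) (rho : R)
    (p : 'I_N -> torus R d) : R :=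
  \sum_(n < N) \1_[set x + y | y in tball d rho] (p n)
    - N%:R * fine (lebesgue_rV (eball d rho)).

Definition JJ (M : int) : set int :=
  [set j | - (M%:Q / 2) <= j%:Q < M%:Q / 2].

Definition JJpow (d : nat) (M : int) : set 'rV[int]_d :=
  [set j | forall i, JJ M (j ord0 i)].
Arguments JJpow d M _ : clear implicits.

Definition grid_pt (R : realType) (d : nat) (M : int) (j : 'rV[int]_d) :
    torus R d :=
  to_torus (\row_i ((j ord0 i)%:~R / M%:~R)).

(* Main.v *)
Require Import Defs.
From mathcomp Require Import all_boot all_order all_algebra.
From mathcomp Require Import finmap generic_quotient ring_quotient.
From mathcomp Require Import ring lra zify.
From mathcomp Require Import all_classical all_reals all_analysis.
Set Implicit Arguments.
Unset Strict Implicit.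
Unset Printing Implicit Defensive.
Import Order.TTheory GRing.Theory Num.Theory.
Import numFieldNormedType.Exports.
Local Open Scope classical_set_scope.
Local Open Scope ring_scope.

(* Summing over the grid of centres j / M is a discrete Fourier transform in
   the centre. The coefficient of the discrepancy of radius rho at a frequency
   h with |h| < M is, up to a boundary error O(N L^(d-1)) with L = M rho, the
   product of the exponential sum of the points at h and of the sum of
   cos(2 pi h.x / M) over the lattice points |x| < L. Slicing the ball and
   inducting on d, the latter is L^d times a Bessel integral at 2 pi rho |h|,
   up to an error O(L^d |h| / M). The squares of these integrals for rho = r
   and rho = 2r add up to at least a constant times (r |h|)^-(d+1): their
   phases cos(x - (d+1)pi/4) and cos(2x - (d+1)pi/4) can vanish together only
   if d = 1 mod 4. Cassels' argument bounds from below the exponential sums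
   over the differences h = k - l of frequencies in a box of side
   X ~ N^(1/d) / r; the pairs with |k - l| = O(1/r), where the asymptotics
   are not available, are negligible, and Bessel's inequality for each fixed l
   returns to the mean square over the grid. The lower bound on M makes the
   boundary errors smaller than the main term. *)

(** The points are arbitrary, whereas the grid is invariant only under translations by multiples of
    1/M. Each point p is therefore moved to the grid point floor(M p)/M, and this move costs the
    boundary layer, of bounded width around the sphere of radius L = M rho. Put nu = N^(1/d). The
    frequencies reach size nu/r. After division by L^(2d), and up to constants, a pair of
    frequencies contributes on average N nu^-(d+1) = 1/nu to the main term and N^2/L^2 to the
    boundary error. The condition L^2 >= C N^2 nu is exactly M r >= C N^(1+1/(2d)). The phases are
    tracked algebraically. The integrals [bes n], for n of either parity, are stable under slicing,
    and a two-step recurrence acts on the pair of leading coefficients. For odd n one entry of the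
    pair is always zero and n mod 4 decides which one; for even n both entries stay nonzero once
    they are so at n = 0, and rough numerical bounds at x = pi settle that case. *)

Section Derivatives.
Context {R : realType}.
Implicit Types (f g : R -> R) (x a b c : R).

(* An alias of [is_derive], which is a class, so that its derivative can be
   left for unification to compute instead of being filled by instances. *)
Definition is_der x f a : Prop := is_derive x 1 f a.

Definition deriv f f' := forall x, is_der x f (f' x).

Lemma der_ext f g x a b :
  f =1 g -> a = b -> is_der x f a -> is_der x g b.
Proof. by move=> /funext -> ->. Qed.

(** The conjunction lets unification compute [a] before the equality with [b] has to be proved. *)
Lemma der_val f x a b :
  is_der x f a /\ a = b -> is_der x f b.
Proof. by move=> [fa <-]. Qed.

Lemma der_cstl c x : is_der x (fun=> c) 0.
Proof. exact: is_derive_cst. Qed.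

Lemma der_idl x : is_der x (fun y : R => y) 1.
Proof. exact: is_derive_id. Qed.

Lemma der_add f g x a b : is_der x f a -> is_der x g b ->
  is_der x (fun y => f y + g y) (a + b).
Proof. by move=> fa gb; apply: is_deriveD. Qed.

Lemma der_opp f x a : is_der x f a ->
  is_der x (fun y => - f y) (- a).
Proof. by move=> fa; apply: is_deriveN. Qed.

Lemma der_mul f g x a b : is_der x f a -> is_der x g b ->
  is_der x (fun y => f y * g y) (a * g x + f x * b).
Proof.
move=> fa gb; apply: (@der_ext (f * g) _ _ (f x *: b + g x *: a)) => //.
  by rewrite /GRing.scale/= addrC mulrC.
exact: is_deriveM.
Qed.

Lemma der_exp f n x a : is_der x f a ->
  is_der x (fun y => f y ^+ n) (n%:R * f x ^+ n.-1 * a).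
Proof.
case: n => [|n] fa; first by rewrite !mul0r; apply: der_cstl.
apply: (@der_ext (f ^+ n.+1) _ _ ((n.+1%:R * f x ^+ n) *: a)) => //.
  by move=> y; elim: n => [|n IH] /=; rewrite ?expr1// exprS [RHS]exprS -IH.
exact: is_deriveX.
Qed.

Lemma der_compl f g x a b : is_der x g b -> is_der (g x) f a ->
  is_der x (fun y => f (g y)) (a * b).
Proof. by move=> gb fa; apply: is_derive1_comp. Qed.

Lemma der_cosl f x a : is_der x f a ->
  is_der x (fun y => cos (f y)) (- sin (f x) * a).
Proof. by move=> fa; exact: der_compl fa (is_derive_cos _). Qed.

Lemma der_sinl f x a : is_der x f a ->
  is_der x (fun y => sin (f y)) (cos (f x) * a).
Proof. by move=> fa; exact: der_compl fa (is_derive_sin _). Qed.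

Lemma der_inv f x a : f x != 0 -> is_der x f a ->
  is_der x (fun y => (f y)^-1) (- (f x) ^- 2 * a).
Proof.
move=> fx0 fa.
by have := is_deriveV fx0 fa; rewrite /GRing.scale /=.
Qed.

Lemma der_expRl f x a : is_der x f a ->
  is_der x (fun y => expR (f y)) (expR (f x) * a).
Proof. by move=> fa; exact: der_compl fa (is_derive_expR _). Qed.

Lemma deriv_cont f f' : deriv f f' -> continuous f.
Proof.
by move=> ff' x; apply/differentiable_continuous/derivable1_diffP; case: (ff' x).
Qed.

Lemma nondecr_derive f f' a b : a <= b ->
  (forall x, a <= x <= b -> is_der x f (f' x)) ->
  (forall x, a <= x <= b -> 0 <= f' x) -> f a <= f b.
Proof.
move=> ab ff' f'0.
have cf : {within `[a, b], continuous f}.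
  apply: continuous_in_subspaceT => x; rewrite inE/= in_itv/= => xab.
  have [fx _] := ff' _ xab.
  exact/differentiable_continuous/derivable1_diffP.
have df x : x \in `]a, b[ -> is_der x f (f' x).
  by rewrite in_itv/= => /andP[ax xb]; apply: ff'; rewrite !ltW.
have [y] := MVT_segment ab df cf; rewrite in_itv/= => yab fE.
by rewrite -subr_ge0 fE mulr_ge0 ?subr_ge0//; exact: f'0.
Qed.

(** Both [g - f] and [g + f] are nondecreasing. Many error bounds below come from exhibiting a
    comparison function [g]. *)
Lemma lipschitz_derive f f' g g' a b : a <= b ->
  (forall x, a <= x <= b -> is_der x f (f' x)) ->
  (forall x, a <= x <= b -> is_der x g (g' x)) ->
  (forall x, a <= x <= b -> `|f' x| <= g' x) -> `|f b - f a| <= g b - g a.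
Proof.
move=> ab ff' gg' fg.
have h1 := @nondecr_derive (fun x => g x + - f x) (fun x => g' x + - f' x) a b ab.
have h2 := @nondecr_derive (fun x => g x + f x) (fun x => g' x + f' x) a b ab.
have {}h1 : g a + - f a <= g b + - f b.
  apply: h1 => x xab; first by apply: der_add; [exact: gg'|exact/der_opp/ff'].
  by have := fg _ xab; rewrite ler_norml => /andP[]; lra.
have {}h2 : g a + f a <= g b + f b.
  apply: h2 => x xab; first by apply: der_add; [exact: gg'|exact/ff'].
  by have := fg _ xab; rewrite ler_norml => /andP[]; lra.
by rewrite ler_norml; apply/andP; split; lra.
Qed.

Lemma lipschitz_cst f f' K : deriv f f' -> (forall x, `|f' x| <= K) ->
  forall x y, `|f x - f y| <= K * `|x - y|.
Proof.
move=> ff' f'K x y; wlog yx : x y / y <= x.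
  move=> hw; case: (leP y x) => [|/ltW]; first exact: hw.
  by move=> /hw; rewrite distrC [ `|y - x|]distrC.
rewrite (ger0_norm (_ : 0 <= x - y)) ?subr_ge0// mulrBr.
apply: (@lipschitz_derive f f' (fun x => K * x) (fun=> K)) => // z _.
by apply: der_ext (der_mul (der_cstl K z) (der_idl z)) => //; ring.
Qed.

Lemma derivable_cont f : (forall x, exists a, is_der x f a) -> continuous f.
Proof.
move=> ff' x; have [a [fa _]] := ff' x.
exact/differentiable_continuous/derivable1_diffP.
Qed.

Lemma continuous_mul f g : continuous f -> continuous g ->
  continuous (fun x => f x * g x).
Proof. by move=> cf cg x; apply: cvgM; [exact: cf|exact: cg]. Qed.

Lemma continuous_compl f g : continuous f -> continuous g ->
  continuous (fun x => f (g x)).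
Proof. by move=> cf cg x; apply: continuous_comp; [exact: cg|exact: cf]. Qed.

End Derivatives.

Ltac isd := repeat first
  [ eassumption | apply: der_cstl | apply: der_idl | apply: der_cosl | apply: der_sinl
  | apply: der_exp | apply: der_opp | apply: der_add | apply: der_mul ].

Ltac conts := apply: derivable_cont => ?; eexists; isd.

(** * Integrals over [0, pi/2] *)

Section QuarterIntegral.
Context {R : realType}.
Implicit Types (f g F : R -> R) (c : R).

Definition qint f : R := \int[lebesgue_measure]_(t in `[0, pi / 2]) f t.

Let pi2 : 0 < pi / 2 :> R. Proof. by rewrite divr_gt0 ?pi_gt0. Qed.

Lemma qint_integrable f : continuous f ->
  lebesgue_measure.-integrable `[0, pi / 2] (EFin \o f).
Proof.
move=> cf; apply: continuous_compact_integrable; first exact: segment_compact.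
exact: continuous_subspaceT.
Qed.

Lemma qintB f g : continuous f -> continuous g ->
  qint (fun t => f t - g t) = qint f - qint g.
Proof. by move=> cf cg; apply: RintegralB => //; apply: qint_integrable. Qed.

Lemma qintZ c f : continuous f -> qint (fun t => c * f t) = c * qint f.
Proof. by move=> cf; apply: RintegralZl => //; apply: qint_integrable. Qed.

Lemma qint_cst c : qint (fun=> c) = c * (pi / 2).
Proof.
rewrite /qint Rintegral_cst//= lebesgue_measure_itv/= lte_fin pi2.
by rewrite sube0.
Qed.

Lemma qint_eq f g : (forall t, f t = g t) -> qint f = qint g.
Proof. by move=> /funext ->. Qed.

Lemma qint_le f g : continuous f -> continuous g ->
  (forall t, 0 <= t <= pi / 2 -> f t <= g t) -> qint f <= qint g.
Proof.
move=> cf cg fg; apply: le_Rintegral => //; exact: qint_integrable.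
Qed.

Lemma qint_abs_le f g : continuous f -> continuous g ->
  (forall t, 0 <= t <= pi / 2 -> `|f t| <= g t) -> `|qint f| <= qint g.
Proof.
move=> cf cg fg.
have cN : continuous (fun t => -1 * g t).
  by move=> t; apply: cvgM; [exact: cvg_cst|exact: cg].
rewrite ler_norml -[- qint g]mulN1r -qintZ//.
by apply/andP; split; apply: qint_le => // t /fg;
  rewrite ler_norml ?mulN1r => /andP[].
Qed.

Lemma qint_abs_cst f c : continuous f ->
  (forall t, 0 <= t <= pi / 2 -> `|f t| <= c) -> `|qint f| <= c * (pi / 2).
Proof. by move=> cf fc; rewrite -qint_cst; apply: qint_abs_le => //; exact: cst_continuous. Qed.

Lemma qint_FTC_itv F f : (forall x, 0 <= x <= pi / 2 -> is_der x F (f x)) ->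
  continuous f -> qint f = F (pi / 2) - F 0.
Proof.
move=> Ff cf; rewrite /qint /Rintegral (@continuous_FTC2 _ f F 0 (pi / 2) pi2)//.
- exact: continuous_subspaceT.
- have cF x : 0 <= x <= pi / 2 -> F y @[y --> x] --> F x.
    by move=> /Ff[dF _]; exact/differentiable_continuous/derivable1_diffP.
  split.
  + by move=> x; rewrite in_itv/= => /andP[x0 x1]; case: (Ff x _); rewrite ?ltW.
  + by apply: cvg_at_right_filter; apply: cF; rewrite lexx ltW.
  + by apply: cvg_at_left_filter; apply: cF; rewrite lexx ltW.
- move=> x; rewrite in_itv/= => /andP[x0 x1].
  have dF : is_der x F (f x) by apply: Ff; rewrite !ltW.
  by rewrite derive1E; exact: (@derive_val _ _ _ _ _ _ _ dF).
Qed.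

Lemma qint_FTC F f : deriv F f -> continuous f -> qint f = F (pi / 2) - F 0.
Proof. by move=> Ff; apply: qint_FTC_itv => x _; exact: Ff. Qed.

Lemma primitive_exists f : continuous f ->
  exists F : R -> R, forall x, 0 <= x <= pi / 2 -> is_der x F (f x).
Proof.
(* Starting at -1, and working inside [-1, 3], makes 0 and pi/2 interior points, so that the
   derivative is two-sided there as well. *)
move=> cf; exists (fun x => \int[lebesgue_measure]_(t in `[-1, x]) f t).
move=> x /andP[x0 x1].
have x3 : x < 3 by apply: le_lt_trans x1 _; apply: lt_trans (pihalf_lt2 R) _; lra.
have fi : lebesgue_measure.-integrable `[-1, 3] (EFin \o f).
  apply: continuous_compact_integrable; first exact: segment_compact.
  exact: continuous_subspaceT.
have x10 : -1 < x by lra.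
have [d1 d2] := continuous_FTC1_closed x3 fi x10 (cf x).
by rewrite -d2 derive1E; apply: DeriveDef.
Qed.

Lemma qint_derive (K K' : R -> R -> R) c :
  (forall x, continuous (K x)) ->
  (forall x t : R, is_der x (K ^~ t) (K' x t)) ->
  (forall x t, 0 <= t <= pi / 2 -> `|K' x t| <= c) ->
  deriv (fun x => qint (K x)) (fun x => qint (K' x)).
Proof.
move=> cK dK bK x.
have dE z t : partial1of2 K z t = K' z t.
  by rewrite partial1of2E; exact: (@derive_val _ _ _ _ _ _ _ (dK z t)).
have c0 : 0 <= c by apply: le_trans (normr_ge0 _) (bK x 0 _); rewrite lexx ltW.
have : h^-1 *: (qint (K (h + x)) - qint (K x)) @[h --> 0^'] -->
    \int[lebesgue_measure]_(y in `[0, pi / 2]) partial1of2 K x y.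
  apply: (@cvg_differentiation_under_integral R _ _ lebesgue_measure K
    `[0, pi / 2] _ x (x - 1) (x + 1) _ _ _ (cst c)) => //.
  - by rewrite /= in_itv/= ltrBlDr ltrDl ltr01.
  - by move=> z _; apply: qint_integrable.
  - by move=> z t _ _; case: (dK z t).
  - by apply: qint_integrable; exact: cst_continuous.
  - by move=> z t _; rewrite /= in_itv/= dE => /bK.
rewrite (_ : Rintegral _ _ _ = qint (K' x)); last first.
  by apply: eq_Rintegral => t _; rewrite dE.
move=> h; have d : derivable (fun x => qint (K x)) x 1.
  apply/cvg_ex; exists (qint (K' x)) => /=.
  by under eq_fun do rewrite scaler1.
apply: DeriveDef => //; rewrite /derive.
by under eq_fun do rewrite scaler1; exact/cvg_lim.
Qed.

End QuarterIntegral.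

(** * Bessel integrals *)

Section Bessel.
Context {R : realType}.
Implicit Types (x a b t : R) (n : nat).

(* By Poisson's integral, bes n x is a constant multiple of
   x^(-n/2) J_(n/2)(x), and besd n is minus its derivative. *)
Definition bes n x : R := qint (fun t => cos (x * cos t) * sin t ^+ n).

Definition besd n x : R := qint (fun t => cos t * sin (x * cos t) * sin t ^+ n).

Lemma norm_sinX_le1 n t : `|sin t ^+ n| <= 1.
Proof. by rewrite normrX exprn_ile1 ?sin_max. Qed.

Lemma norm_mul_le1 a b : `|a| <= 1 -> `|b| <= 1 -> `|a * b| <= 1.
Proof. by move=> a1 b1; rewrite normrM mulr_ile1. Qed.

Lemma bes_cont n x : continuous (fun t => cos (x * cos t) * sin t ^+ n : R).
Proof. by conts. Qed.

Lemma besd_cont n x : continuous (fun t => cos t * sin (x * cos t) * sin t ^+ n : R).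
Proof. by conts. Qed.

Lemma bes_le n x : `|bes n x| <= pi / 2.
Proof.
rewrite -[leRHS]mul1r; apply: qint_abs_cst; first exact: bes_cont.
by move=> t _; rewrite norm_mul_le1 ?cos_max ?norm_sinX_le1.
Qed.

Lemma besd_le n x : `|besd n x| <= pi / 2.
Proof.
rewrite -[leRHS]mul1r; apply: qint_abs_cst; first exact: besd_cont.
by move=> t _; rewrite !norm_mul_le1 ?cos_max ?sin_max ?norm_sinX_le1.
Qed.

Lemma bes_deriv n : deriv (bes n) (fun x => - besd n x).
Proof.
move=> x; have := @qint_derive R (fun x t => cos (x * cos t) * sin t ^+ n)
  (fun x t => -1 * (cos t * sin (x * cos t) * sin t ^+ n)) 1.
move=> /(_ (@bes_cont n)) h; apply: der_ext (h _ _ x) => //.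
- by rewrite qintZ ?mulN1r//; exact: besd_cont.
- by move=> z t; apply: der_val; split; [isd|rewrite /=; ring].
- move=> z t _; rewrite mulN1r normrN.
  by rewrite !norm_mul_le1 ?cos_max ?sin_max ?norm_sinX_le1.
Qed.

Lemma besd_deriv n : deriv (besd n) (fun x => bes n x - bes n.+2 x).
Proof.
move=> x; have := @qint_derive R (fun x t => cos t * sin (x * cos t) * sin t ^+ n)
  (fun x t => cos t * (cos t * cos (x * cos t) * sin t ^+ n)) 1.
move=> /(_ (@besd_cont n)) h; apply: der_ext (h _ _ x) => //.
- rewrite -qintB; [|exact: bes_cont..].
  apply: qint_eq => t; rewrite mulrA mulrA -expr2 cos2sin2 !exprS; ring.
- by move=> z t; apply: der_val; split; [isd|rewrite /=; ring].
- by move=> z t _; rewrite !norm_mul_le1 ?cos_max ?sin_max ?norm_sinX_le1.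
Qed.

(** The difference of the two sides is the integral of the derivative of sin(x cos t) sin(t)^(n+1),
    which vanishes at 0 and at pi/2. In classical terms, (x^-v J_v)' = - x^-v J_(v+1). *)
Lemma besd_rec n x : n.+1%:R * besd n x = x * bes n.+2 x.
Proof.
apply/eqP; rewrite -subr_eq0; apply/eqP.
rewrite -!qintZ; [|exact: bes_cont|exact: besd_cont].
rewrite -qintB; [|by conts..].
rewrite (@qint_FTC R (fun t => sin (x * cos t) * sin t ^+ n.+1)).
- by rewrite cos_pihalf mulr0 sin0 expr0n/= !(mul0r, mulr0) subrr.
- move=> t; apply: der_val; split; first isd.
  by rewrite /= !exprS; ring.
- by conts.
Qed.

Lemma bes0_gt0 n : 0 < bes n 0.
Proof.
rewrite /bes.
have s0 t : 0 <= t <= pi / 2 -> 0 <= sin t :> R.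
  by move=> /andP[t0 t1]; apply: sin_ge0_pi; rewrite t0 (le_trans t1)// ler_pdivrMr// ler_peMr ?pi_ge0// ler1n.
have : qint (fun t : R => n.+1%:R^-1 * (n.+1%:R * sin t ^+ n * cos t)) <= bes n 0.
  apply: qint_le; [by conts|exact: bes_cont|move=> t t0].
  rewrite mul0r cos0 mul1r -mulrA mulKf ?pnatr_eq0// ler_piMr ?cos_le1//.
  by rewrite exprn_ge0 ?s0.
apply: lt_le_trans.
rewrite qintZ; last by conts.
rewrite (@qint_FTC R (fun t => sin t ^+ n.+1));
  [|by move=> t; apply: der_val; split; [isd|rewrite /=; ring]|by conts].
by rewrite sin_pihalf sin0 expr1n expr0n/= subr0 mulr1 invr_gt0 ltr0n.
Qed.

Lemma besN n x : bes n (- x) = bes n x.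
Proof. by apply: qint_eq => t; rewrite mulNr cosN. Qed.

(** Rotation invariance: the left-hand side does not depend on [phi]. By [besd_rec], the derivative
    of the integrand in the angle is the t-derivative of a function vanishing at both ends, so its
    integral is zero; at [phi] = 0 the inner factor is the constant [bes n 0]. *)
Lemma bes_sphere n l phi :
  qint (fun t => cos (l * cos phi * cos t) * bes n (l * sin phi * sin t) * sin t ^+ n.+1) =
  bes n 0 * bes n.+1 l.
Proof.
pose K p t := cos (l * cos p * cos t) * bes n (l * sin p * sin t) * sin t ^+ n.+1.
pose K' p t := (- sin (l * cos p * cos t) * (l * - sin p * cos t) * bes n (l * sin p * sin t)
   + cos (l * cos p * cos t) * (- besd n (l * sin p * sin t) * (l * cos p * sin t))) * sin t ^+ n.+1.
have derb t f a : is_der t f a -> is_der t (fun t => bes n (f t)) (- besd n (f t) * a).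
  by move=> fa; apply: der_compl => //; exact: bes_deriv.
have derd t f a : is_der t f a -> is_der t (fun t => besd n (f t))
    ((bes n (f t) - bes n.+2 (f t)) * a).
  by move=> fa; apply: der_compl => //; exact: besd_deriv.
have cK p : continuous (K p).
  by apply: derivable_cont => t; eexists; rewrite /K; repeat (isd; try apply: derb).
have dK (x t : R) : is_der x (K ^~ t) (K' x t).
  by apply: der_val; split; [repeat (isd; try apply: derb)|rewrite /K' /=; ring].
have bK p t : 0 <= t <= pi / 2 -> `|K' p t| <= `|l| * (pi / 2) + `|l| * (pi / 2).
  move=> _; rewrite /K' normrM; apply: le_trans (ler_wpM2l (normr_ge0 _) (norm_sinX_le1 _ _)) _.
  rewrite mulr1; apply: le_trans (ler_normD _ _) _; apply: lerD.
    rewrite [X in `|X|](_ : _ =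
      l * (sin (l * cos p * cos t) * sin p * cos t) * bes n (l * sin p * sin t)); last by ring.
    rewrite normrM; apply: ler_pM => //; last exact: bes_le.
    by rewrite normrM ler_piMr// !norm_mul_le1 ?cos_max ?sin_max.
  rewrite [X in `|X|](_ : _ =
      l * (cos (l * cos p * cos t) * cos p * sin t) * - besd n (l * sin p * sin t)); last by ring.
  rewrite normrM normrN; apply: ler_pM => //; last exact: besd_le.
  by rewrite normrM ler_piMr// !norm_mul_le1 ?cos_max ?sin_max.
have K'0 p : qint (K' p) = 0.
  rewrite (@qint_FTC R (fun t => sin (l * cos p * cos t) * besd n (l * sin p * sin t) * sin t ^+ n.+1)).
  - by rewrite cos_pihalf mulr0 !sin0 expr0n/= !(mul0r, mulr0) subrr.
  - move=> t; apply: der_val; split; first (repeat (isd; try apply: derd)).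
    have := besd_rec n (l * sin p * sin t).
    set B2 := bes n.+2 _; set B := bes n _; set D := besd n _ => e.
    apply/eqP; rewrite -subr_eq0; apply/eqP.
    rewrite [LHS](_ : _ = sin (l * cos p * cos t) * cos t * sin t ^+ n *
       (n.+1%:R * D - l * sin p * sin t * B2)).
      by rewrite e subrr mulr0.
    by rewrite /K' -/D -/B /= exprS; ring.
  - apply: derivable_cont => t; eexists; rewrite /K'.
    repeat (isd; try apply: derd; try apply: derb).
have dH : forall x : R, is_der x (fun p => qint (K p)) 0.
  by move=> x; rewrite -(K'0 x); apply: qint_derive cK dK bK x.
have -> : qint (K phi) = qint (K 0) := is_derive_0_is_cst _ _ dH.
rewrite -qintZ; last exact: bes_cont.
by apply: qint_eq => t; rewrite /K cos0 sin0 mulr1 mulr0 mul0r; ring.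
Qed.

(** Polar coordinates a = l cos phi, b = l sin phi reduce this to [bes_sphere]. This is what makes
    the induction on the dimension close up: adding one coordinate to a slice turns [bes n] into
    [bes n.+1]. *)
Lemma bes_rot n a b :
  qint (fun t => cos (a * cos t) * bes n (b * sin t) * sin t ^+ n.+1) =
  bes n 0 * bes n.+1 (Num.sqrt (a ^+ 2 + b ^+ 2)).
Proof.
wlog b0 : b / 0 <= b.
  move=> hw; case: (leP 0 b) => [|/ltW b0]; first exact: hw.
  have := hw (- b); rewrite sqrrN => <-; last by rewrite oppr_ge0.
  by apply: qint_eq => t; rewrite mulNr besN.
set l := Num.sqrt _.
have l2 : l ^+ 2 = a ^+ 2 + b ^+ 2 by rewrite sqr_sqrtr// addr_ge0 ?sqr_ge0.
have [l0|l0] := eqVneq l 0.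
  have : a ^+ 2 + b ^+ 2 = 0 by rewrite -l2 l0 expr0n.
  move/eqP; rewrite paddr_eq0 ?sqr_ge0// !sqrf_eq0 => /andP[/eqP a0 /eqP b00].
  by have := bes_sphere n l 0; rewrite l0 a0 b00 !mul0r.
have lp : 0 < l by rewrite lt_def l0 sqrtr_ge0.
have al : -1 <= a / l <= 1.
  rewrite -ler_norml normf_div (gtr0_norm lp) ler_pdivrMr// mul1r.
  by rewrite -sqrtr_sqr ler_sqrt ?addr_ge0 ?lerDl ?sqr_ge0.
have lb : l * Num.sqrt (1 - (a / l) ^+ 2) = b.
  apply/eqP; rewrite -(@eqrXn2 _ 2) ?mulr_ge0 ?sqrtr_ge0//.
  rewrite exprMn [X in _ * X]sqr_sqrtr.
    apply/eqP; rewrite expr_div_n mulrBr mulr1 mulrC.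
    by rewrite divfK ?expf_neq0// l2; ring.
  by rewrite subr_ge0 -real_normK ?num_real// expr_le1// ler_norml.
have la : l * (a / l) = a by rewrite mulrC divfK.
have al' : a / l \in `[-1, 1] by rewrite in_itv.
by rewrite -(bes_sphere n l (acos (a / l))) (acosK al') (sin_acos al) lb la.
Qed.

End Bessel.

(** * Asymptotics at infinity, and their passage from n to n + 2 *)

Section BesselAsymptotics.
Context {R : realType}.
Implicit Types (x a b t al be : R) (n : nat).

(** The power of [Num.sqrt x] cancels the decay x^-((n+1)/2). Both functions are included because
    the recurrence produces [bes n.+2] from [besd n]; the main term of [besd] is minus the
    derivative of that of [bes]. *)
Definition bes_asym n al be := exists2 C : R, 0 <= C & forall x, pi <= x ->
  `|Num.sqrt x ^+ n.+1 * bes n x - (al * cos x + be * sin x)| <= C / x /\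
  `|Num.sqrt x ^+ n.+1 * besd n x - (al * sin x - be * cos x)| <= C / x.

Lemma is_der_unique x (f : R -> R) a b : is_der x f a -> is_der x f b -> a = b.
Proof.
by move=> fa fb; rewrite -(@derive_val _ _ _ _ _ _ _ fa) (@derive_val _ _ _ _ _ _ _ fb).
Qed.

Lemma der_bes n x (f : R -> R) a : is_der x f a ->
  is_der x (fun y => bes n (f y)) (- besd n (f x) * a).
Proof. by move=> fa; apply: der_compl fa (bes_deriv _ _). Qed.

Lemma der_besd n x (f : R -> R) a : is_der x f a ->
  is_der x (fun y => besd n (f y)) ((bes n (f x) - bes n.+2 (f x)) * a).
Proof. by move=> fa; apply: der_compl fa (besd_deriv _ _). Qed.

(** The identity [besd_rec] is differentiated in x. *)
Lemma besd_rec2 n x :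
  x * besd n.+2 x = n.+2%:R * bes n.+2 x - n.+1%:R * bes n x.
Proof.
have d1 : is_der x (fun x => x * bes n.+2 x) (bes n.+2 x - x * besd n.+2 x).
  apply: der_val; split.
    by apply: der_mul; [exact: der_idl|exact: der_bes (der_idl _)].
  by rewrite /=; ring.
have d2 : is_der x (fun x => n.+1%:R * besd n x) (n.+1%:R * (bes n x - bes n.+2 x)).
  apply: der_val; split.
    by apply: der_mul; [exact: der_cstl|exact: der_besd (der_idl _)].
  by rewrite /=; ring.
have e : (fun x => n.+1%:R * besd n x) = (fun x => x * bes n.+2 x).
  by apply/funext => y; exact: besd_rec.
rewrite e in d2; have := is_der_unique d1 d2.
rewrite -[n.+2]addn1 natrD => h; lra.
Qed.

Lemma mul_cos_sin_le a b x : `|a * cos x + b * sin x| <= `|a| + `|b|.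
Proof.
by apply: le_trans (ler_normD _ _) _; rewrite !normrM lerD// ler_piMr ?cos_max ?sin_max.
Qed.

(** By [besd_rec], the normalised [bes n.+2] is [n.+1] times the normalised [besd n]. In [besd_rec2]
    the term in [bes n.+2] is smaller by a factor 1/x after normalisation and joins the error, which
    leaves [- n.+1] times [bes n]. *)
Lemma bes_asym_step n al be : bes_asym n al be ->
  bes_asym n.+2 (n.+1%:R * - be) (n.+1%:R * al).
Proof.
move=> [C C0 h].
exists (n.+1%:R * C + n.+2%:R * (n.+1%:R * (C + (`|al| + `|be|)))).
  by apply: addr_ge0; do !(apply: mulr_ge0 => //); do !apply: addr_ge0.
move=> x xpi; have [h1 h2] := h _ xpi.
have x2 : 2 <= x := le_trans (pi_ge2 R) xpi.
have x0 : 0 < x by lra.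
have s2 : Num.sqrt x ^+ n.+3 = x * Num.sqrt x ^+ n.+1.
  by rewrite -addn2 exprD sqr_sqrtr ?(ltW x0)// mulrC.
have [S SE] : exists S : R, S = Num.sqrt x ^+ n.+1 by eexists.
rewrite -SE in h1 h2 s2.
have e1 : x * S * bes n.+2 x = n.+1%:R * (S * besd n x).
  by rewrite mulrAC -besd_rec; ring.
have b2 : `|S * besd n x| <= C + (`|al| + `|be|).
  have := ler_normD (S * besd n x - (al * sin x - be * cos x)) (al * sin x - be * cos x).
  rewrite subrK => /le_trans; apply; apply: lerD.
    by apply: le_trans h2 _; rewrite ler_pdivrMr// ler_peMr//; lra.
  by rewrite addrC -mulNr (le_trans (mul_cos_sin_le _ _ _))// normrN addrC.
have C2 : 0 <= n.+2%:R * (n.+1%:R * (C + (`|al| + `|be|))) by do !(apply: mulr_ge0 => //); do !apply: addr_ge0.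
split; rewrite {}s2.
  rewrite e1 [X in `|X|](_ : _ = n.+1%:R * (S * besd n x - (al * sin x - be * cos x))); last by ring.
  rewrite normrM ger0_norm// mulrDl ler_wpDr//; first by rewrite divr_ge0// ltW.
  by rewrite -mulrA ler_wpM2l.
rewrite (_ : x * S * besd n.+2 x = S * (x * besd n.+2 x)); last by rewrite mulrAC mulrC.
rewrite besd_rec2; move: (bes n.+2 x) (bes n x) e1 h1 => B2 B1 e1 h1.
rewrite [X in `|X|](_ : _ = n.+2%:R * (S * B2) - n.+1%:R * (S * B1 - (al * cos x + be * sin x))); last by ring.
rewrite [X in `|X|]addrC; apply: le_trans (ler_normD _ _) _; rewrite normrN [leRHS]mulrDl; apply: lerD.
  by rewrite normrM ger0_norm// -mulrA ler_wpM2l.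
rewrite normrM ger0_norm// -mulrA ler_wpM2l// ler_pdivlMr//.
have -> : `|S * B2| * x = `|x * S * B2|.
  by rewrite !normrM (ger0_norm (ltW x0)); ring.
by rewrite e1 normrM ger0_norm// ler_wpM2l.
Qed.

Lemma bes1E x : x * bes 1 x = sin x.
Proof.
rewrite -qintZ; last exact: bes_cont.
rewrite (@qint_FTC R (fun t => - sin (x * cos t))).
- by rewrite cos_pihalf mulr0 sin0 cos0 mulr1; ring.
- by move=> t; apply: der_val; split; [isd|rewrite /=; ring].
- by conts.
Qed.

Lemma besd1E x : x * besd 1 x = bes 1 x - cos x.
Proof.
have d1 : is_der x (fun x => x * bes 1 x) (bes 1 x - x * besd 1 x).
  apply: der_val; split.
    by apply: der_mul; [exact: der_idl|exact: der_bes (der_idl _)].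
  by rewrite /=; ring.
have e : (fun x => x * bes 1 x) = @sin R by apply/funext => y; exact: bes1E.
rewrite e in d1; have := is_der_unique d1 (is_derive_sin x); lra.
Qed.

Lemma bes_asym1 : bes_asym 1 0 1.
Proof.
exists 1 => // x xpi; have x0 : 0 < x by exact: lt_le_trans (pi_gt0 R) _.
rewrite sqr_sqrtr ?(ltW x0)// bes1E besd1E; split.
  by rewrite [X in `|X|](_ : _ = 0) ?normr0 ?divr_ge0 ?(ltW x0)//; ring.
rewrite [X in `|X|](_ : _ = bes 1 x); last by ring.
by rewrite ler_pdivlMr// -[X in _ * X](gtr0_norm x0) -normrM mulrC bes1E sin_max.
Qed.

(** The function f x - K / x is nondecreasing and f x + K / x is nonincreasing, and the first always
    stays below the second. The supremum of the first therefore separates them, and it is the limit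
    [l]. *)
Lemma limit_at_infinity (f f' : R -> R) K x0 : 0 < x0 -> 0 <= K ->
  (forall x, x0 <= x -> is_der x f (f' x)) ->
  (forall x, x0 <= x -> `|f' x| <= K / x ^+ 2) ->
  exists l, forall x, x0 <= x -> `|f x - l| <= K / x.
Proof.
move=> x00 K0 ff' bf'.
have lip x y : x0 <= x -> x <= y -> `|f y - f x| <= K / x - K / y.
  move=> x0x xy.
  rewrite [leRHS](_ : _ = (K * - y^-1) - (K * - x^-1)); last by ring.
  apply: (@lipschitz_derive _ f f' (fun x => K * - x^-1) (fun x => K / x ^+ 2)) => //.
  - by move=> z /andP[xz _]; apply: ff'; exact: le_trans xz.
  - move=> z /andP[xz _]; have z0 : 0 < z by rewrite (lt_le_trans x00)// (le_trans x0x).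
    apply: der_val; split.
      by apply: der_mul (der_cstl _ _) (der_opp (der_inv _ (der_idl _))); rewrite gt_eqF.
    by rewrite /=; ring.
  - by move=> z /andP[xz _]; apply: bf'; exact: le_trans xz.
pose A := [set f x - K / x | x in [set x | x0 <= x]].
have ub x y : x0 <= x -> x0 <= y -> f y - K / y <= f x + K / x.
  move=> hx hy.
  have Kx : 0 <= K / x by rewrite divr_ge0// (le_trans (ltW x00)).
  have Ky : 0 <= K / y by rewrite divr_ge0// (le_trans (ltW x00)).
  case: (leP x y) => [xy|/ltW yx].
    by have := lip _ _ hx xy; rewrite ler_norml => /andP[]; lra.
  by have := lip _ _ hy yx; rewrite ler_norml => /andP[]; lra.
have supA : has_sup A.
  split; first by exists (f x0 - K / x0), x0 => //=.
  by exists (f x0 + K / x0) => _ [y hy <-]; exact: ub.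
exists (sup A) => x hx; rewrite ler_distlC; apply/andP; split.
  by apply: ub_le_sup; [exact: supA.2|exists x].
by apply: ge_sup; [exact: supA.1|move=> _ [y hy <-]; exact: ub].
Qed.

End BesselAsymptotics.

(** * The case n = 0, through a differential equation *)

Section BesselBase.
Context {R : realType}.
Implicit Types (x a b t al be : R) (n : nat).

Lemma der_sqrt x : 0 < x -> is_der x Num.sqrt (2 * Num.sqrt x)^-1.
Proof. by move=> x0; exact: is_derive1_sqrt. Qed.

(** Concavity of the sine on [0, pi], for the chord issued from 0. *)
Lemma sin_chord (c y : R) : 0 <= c <= 1 -> 0 <= y <= pi -> c * sin y <= sin (c * y).
Proof.
move=> /andP[c0 c1] /andP[y0 ypi]; rewrite -subr_ge0.
rewrite [leLHS](_ : 0 = sin (c * 0) - c * sin 0); last by rewrite mulr0 sin0; ring.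
apply: (@nondecr_derive _ (fun y => sin (c * y) - c * sin y)
    (fun y => c * (cos (c * y) - cos y)) 0 y) => // z /andP[z0 zy].
  by apply: der_val; split; [isd|rewrite /=; ring].
have zpi : z <= pi := le_trans zy ypi.
have cz : c * z <= z by rewrite ler_piMl.
rewrite mulr_ge0// subr_ge0.
rewrite leNgt ltr_cos -?leNgt ?in_itv/= ?z0 ?zpi ?mulr_ge0 ?(le_trans cz)//.
Qed.

Lemma sin_pi4_sqr : sin (pi / 4) ^+ 2 = 1 / 2 :> R.
Proof.
have := @cos_mulr2n R (pi / 4); rewrite (_ : pi / 4 *+ 2 = pi / 2); last by rewrite -mulr_natr; field.
by rewrite cos_pihalf cos2sin2 -mulr_natr => ?; lra.
Qed.

(** The polynomial agrees with the cosine at c = 0 and c = 1, and for c = cos t it becomes 2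
    sin(t)^4 - 1, which has an explicit primitive. With s = sin(pi c / 4), the cosine is 1 - 8 s^2
    (1 - s^2), and [sin_chord] places s^2 between c^2 / 2 and 1/2. *)
Lemma cos_pi_le (c : R) : 0 <= c <= 1 -> cos (pi * c) <= 2 * (1 - c ^+ 2) ^+ 2 - 1.
Proof.
move=> /andP[c0 c1]; have pi0 := @pi_gt0 R.
have [s sE] : exists s, s = sin (c * (pi / 4)) by eexists.
have -> : cos (pi * c) = 1 - 8 * s ^+ 2 * (1 - s ^+ 2).
  rewrite (_ : pi * c = (c * (pi / 4)) *+ 2 *+ 2); last by rewrite !mulr2n; field.
  by rewrite !cos_mulr2n cos2sin2 -sE !mulr2n; ring.
have s1 : c ^+ 2 / 2 <= s ^+ 2.
  have h : c * sin (pi / 4) <= s.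
    rewrite sE; apply: sin_chord; first by rewrite c0 c1.
    by apply/andP; split; lra.
  have h0 : 0 <= sin (pi / 4) :> R by apply: sin_ge0_pi; apply/andP; split; lra.
  have := @ler_pM _ _ _ _ _ (mulr_ge0 c0 h0) (mulr_ge0 c0 h0) h h.
  by rewrite -!expr2 exprMn sin_pi4_sqr; lra.
have s2 : s ^+ 2 <= 1 / 2.
  have pc : 0 <= pi * c <= pi by rewrite mulr_ge0 ?(ltW pi0)//= ler_piMr// ltW.
  case/andP: pc => pc0 pc1.
  have h0 : 0 <= s by rewrite sE; apply: sin_ge0_pi; apply/andP; split; lra.
  have h : s <= sin (pi / 4).
    rewrite sE leNgt ltr_sin -?leNgt ?in_itv/=; try (apply/andP; split); lra.
  have := @ler_pM _ _ _ _ _ h0 h0 h h.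
  by rewrite -!expr2 sin_pi4_sqr; lra.
have c2 : 0 <= c ^+ 2 <= 1 by rewrite sqr_ge0 expr_le1.
move: c2 s1 s2; move: (s ^+ 2) (c ^+ 2) => S q /andP[q0 q1] s1 s2.
rewrite -subr_ge0 [leRHS](_ : _ = 8 * ((S - q / 2) * (1 - S - q / 2))); last by field.
by rewrite mulr_ge0// mulr_ge0// subr_ge0; lra.
Qed.

Lemma bes0_pi_le : bes 0 pi <= - (pi / 8) :> R.
Proof.
have -> : - (pi / 8) = qint (fun t : R => 2 * (sin t ^+ 2) ^+ 2 - 1).
  rewrite (@qint_FTC R (fun t => - (1 / 4) * t + - (3 / 4) * (sin t * cos t)
     + - (1 / 2) * (sin t ^+ 3 * cos t))).
  - by rewrite cos_pihalf cos0 sin0 expr0n/= !(mulr0, mul0r, addr0); lra.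
  - move=> t; apply: der_val; split; [isd|].
    rewrite /= [X in X = _](_ : _ = - (1 / 4) - (3 / 4) * (cos t ^+ 2 - sin t ^+ 2)
      - (1 / 2) * (3 * sin t ^+ 2 * cos t ^+ 2 - sin t ^+ 4)); last by ring.
    by rewrite cos2sin2; field.
  - by conts.
apply: qint_le; [exact: bes_cont|by conts|move=> t t0].
rewrite expr0 mulr1 sin2cos2; apply: cos_pi_le; rewrite cos_le1 andbT.
apply: cos_ge0_pihalf; case/andP: t0 => t0 ->; rewrite andbT.
by apply: le_trans t0; rewrite oppr_le0 divr_ge0 ?pi_ge0.
Qed.

Lemma besd0_pi_ge0 : 0 <= besd 0 pi :> R.
Proof.
have -> : 0 = qint (fun=> 0 : R) by rewrite qint_cst mul0r.
apply: qint_le; [exact: cst_continuous|exact: besd_cont|move=> t /andP[t0 t1]].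
have c0 : 0 <= cos t.
  apply: cos_ge0_pihalf; rewrite t1 andbT.
  by apply: le_trans t0; rewrite oppr_le0 divr_ge0 ?pi_ge0.
rewrite expr0 mulr1 mulr_ge0// sin_ge0_pi// mulr_ge0 ?pi_ge0//= ler_piMr ?pi_ge0//.
Qed.

(* The normalised function sqrt x * bes 0 x solves u'' = - (1 + 1 / (4 x^2)) u. *)
Let u x := Num.sqrt x * bes 0 x.
Let u1 x := bes 0 x / (2 * Num.sqrt x) - Num.sqrt x * besd 0 x.

Lemma der_u x : 0 < x -> is_der x u (u1 x).
Proof.
move=> x0; apply: der_val; split.
  exact: der_mul (der_sqrt x0) (bes_deriv 0 x).
by rewrite /u1; field; rewrite gt_eqF ?sqrtr_gt0.
Qed.

Lemma der_u1 x : 0 < x -> is_der x u1 (- (1 + 1 / (4 * x ^+ 2)) * u x).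
Proof.
move=> x0; apply: der_val; split.
  apply: der_add; [apply: der_mul|apply: der_opp; apply: der_mul].
  - exact: bes_deriv.
  - apply: der_inv; first by rewrite mulf_neq0 ?gt_eqF ?sqrtr_gt0.
    exact: der_mul (der_cstl _ _) (der_sqrt x0).
  - exact: der_sqrt.
  - exact: besd_deriv.
have e := besd_rec 0 x; rewrite mul1r in e.
have s0 : Num.sqrt x != 0 by rewrite gt_eqF ?sqrtr_gt0.
have s2 : x = Num.sqrt x ^+ 2 by rewrite sqr_sqrtr ?ltW.
rewrite /u; move: e; move: (bes 0 x) (bes 2 x) (besd 0 x) => B B2 D.
move: s2; move: (Num.sqrt x) s0 => s s0 -> ->; field.
by rewrite s0.
Qed.

(** The energy u^2 + u'^2, weighted by exp(1 / (4 x)), is nonincreasing: its derivative is minus the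
    weight times (u + u')^2 / (4 x^2). The value of [U] is recorded because the nonvanishing of [al]
    and [be] depends on it. *)
Lemma u_bound : exists2 U : R, 0 <= U &
  U ^+ 2 = (u pi ^+ 2 + u1 pi ^+ 2) * expR (1 / (4 * pi)) /\
  forall x, pi <= x -> `|u x| <= U.
Proof.
pose E x := (u x ^+ 2 + u1 x ^+ 2) * expR (1 / 4 * x^-1).
have E0 x : 0 <= E x by rewrite mulr_ge0 ?expR_ge0// addr_ge0 ?sqr_ge0.
exists (Num.sqrt (E pi)); first exact: sqrtr_ge0.
split; first by rewrite sqr_sqrtr// /E mul1r -invfM mul1r.
move=> x xpi; rewrite -sqrtr_sqr ler_sqrt//.
have EE : E x <= E pi.
  rewrite -lerN2; apply: (@nondecr_derive _ (fun x => - E x)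
    (fun x => expR (1 / 4 * x^-1) * (1 / 4 * (u x + u1 x) ^+ 2 / x ^+ 2)) _ _ xpi) => z /andP[zpi _].
    have z0 : 0 < z := lt_le_trans (@pi_gt0 R) zpi.
    apply: der_val; split.
      apply: der_opp; apply: der_mul.
        by apply: der_add; apply: der_exp; [exact: der_u|exact: der_u1].
      apply: der_expRl; apply: der_mul; first exact: der_cstl.
      by apply: der_inv (der_idl _); rewrite gt_eqF.
    by rewrite /= !expr1; move: (expR _) (u z) (u1 z) => e v w; field; rewrite gt_eqF.
  by rewrite mulr_ge0 ?expR_ge0// mulr_ge0 ?invr_ge0 ?sqr_ge0// mulr_ge0 ?sqr_ge0//; lra.
apply: le_trans EE; rewrite /E.
apply: le_trans (_ : u x ^+ 2 * 1 <= _); first by rewrite mulr1.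
apply: ler_pM; rewrite ?sqr_ge0 ?lerDl ?sqr_ge0//.
have x0 := lt_le_trans (@pi_gt0 R) xpi.
by rewrite -expR0 ler_expR !mulr_ge0 ?invr_ge0 ?(ltW x0).
Qed.

Lemma bes_asym0 : exists al be : R, [/\ al != 0, be != 0 & bes_asym 0 al be].
Proof.
have [U U0 [UE bU]] := u_bound.
have pi0 := @pi_gt0 R; have pi2 := @pi_ge2 R.
(* Variation of constants: [A] and [B] would be constant if u'' = - u. The perturbation gives them
   derivatives of order x^-2, hence limits [al] and [be]. *)
pose A x := u x * cos x - u1 x * sin x.
pose B x := u x * sin x + u1 x * cos x.
have dA x : pi <= x -> is_der x A (u x * sin x / (4 * x ^+ 2)).
  move=> xpi; have x0 : 0 < x := lt_le_trans pi0 xpi.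
  apply: der_val; split.
    by apply: der_add; [|apply: der_opp]; apply: der_mul;
     [exact: der_u|exact: is_derive_cos|exact: der_u1|exact: is_derive_sin].
  by field; rewrite gt_eqF.
have dB x : pi <= x -> is_der x B (- (u x * cos x) / (4 * x ^+ 2)).
  move=> xpi; have x0 : 0 < x := lt_le_trans pi0 xpi.
  apply: der_val; split.
    by apply: der_add; apply: der_mul;
     [exact: der_u|exact: is_derive_sin|exact: der_u1|exact: is_derive_cos].
  by field; rewrite gt_eqF.
have bd x w : pi <= x -> `|w| <= 1 -> `|u x * w / (4 * x ^+ 2)| <= (U / 4) / x ^+ 2.
  move=> xpi w1; have x0 : 0 < x := lt_le_trans pi0 xpi.
  rewrite normrM normfV (ger0_norm (_ : 0 <= 4 * x ^+ 2)) ?mulr_ge0 ?(ltW x0)//.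
  rewrite invfM mulrA ler_wpM2r ?invr_ge0 ?exprn_ge0 ?(ltW x0)//.
  rewrite ler_wpM2r ?invr_ge0//.
  by rewrite normrM -[U]mulr1 ler_pM// bU.
have U4 : 0 <= U / 4 by rewrite divr_ge0.
have [al hal] := limit_at_infinity pi0 U4 dA (fun x hx => bd x _ hx (sin_max x)).
have [be hbe] : exists l, forall x, pi <= x -> `|B x - l| <= U / 4 / x.
  apply: limit_at_infinity pi0 U4 dB _ => x hx.
  by rewrite mulNr normrN bd// cos_max.
exists al, be.
have V : bes 0 pi <= - (pi / 8) :> R := bes0_pi_le.
have W : 0 <= besd 0 pi :> R := besd0_pi_ge0.
have W2 : besd 0 pi <= pi / 2 :> R by apply: le_trans (ler_norm _) (besd_le _ _).
(* e stands for 1 / (4 pi), v and w for the values of bes 0 and besd 0 at pi *)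
have [s [s0 sE]] : exists s : R, 0 < s /\ s = Num.sqrt pi by exists (Num.sqrt pi); rewrite sqrtr_gt0.
have [e eE] : exists e : R, e = 1 / (4 * pi) by eexists.
have e0 : 0 < e by rewrite eE divr_gt0 ?mulr_gt0.
have e8 : e <= 1 / 8.
  by rewrite eE ler_pdivrMr ?mulr_gt0//; lra.
have uE : u pi = s * bes 0 pi by rewrite /u -sE.
have u1E : u1 pi = s * (2 * e * bes 0 pi - besd 0 pi).
  rewrite /u1 -sE eE (_ : pi = s ^+ 2); last by rewrite sE sqr_sqrtr// ltW.
  by field; rewrite gt_eqF.
have expe : expR e <= 8 / 7.
  have := expR_ge1Dx (- e); rewrite expRN => h.
  have h7 : 7 / 8 <= (expR e)^-1 by apply: le_trans h; lra.
  by rewrite -[expR e]invrK (_ : 8 / 7 = (7 / 8)^-1 :> R) ?lef_pV2 ?posrE ?invr_gt0 ?expR_gt0//; lra.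
have UE2 : U ^+ 2 <= (u pi ^+ 2 + u1 pi ^+ 2) * (8 / 7).
  by rewrite UE -eE ler_wpM2l// addr_ge0 ?sqr_ge0.
have key l : `|l| <= U / 4 / pi -> l ^+ 2 <= e ^+ 2 * ((u pi ^+ 2 + u1 pi ^+ 2) * (8 / 7)).
  move=> hl; rewrite -real_normK ?num_real//.
  have {}hl : `|l| <= e * U by rewrite (_ : e * U = U / 4 / pi)// eE invfM; ring.
  apply: le_trans (_ : (e * U) ^+ 2 <= _); first by rewrite lerXn2r ?nnegrE ?mulr_ge0 ?(ltW e0).
  by rewrite exprMn ler_wpM2l// sqr_ge0.
have Api : A pi = - u pi by rewrite /A cospi sinpi; ring.
have Bpi : B pi = - u1 pi by rewrite /B cospi sinpi; ring.
have v0 : bes 0 pi < 0 :> R by apply: le_lt_trans V _; lra.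
have un0 : u pi != 0 by rewrite uE mulf_neq0 ?(gt_eqF s0) ?(lt_eqF v0).
have u20 : 0 < u pi ^+ 2 by rewrite lt_def sqr_ge0 sqrf_eq0 un0.
(* The two terms of [u1 pi] have the same sign, since [bes 0 pi] < 0 <= [besd 0 pi]. *)
have r1 : 4 * e ^+ 2 * u pi ^+ 2 <= u1 pi ^+ 2.
  rewrite uE u1E !exprMn mulrCA ler_wpM2l ?sqr_ge0//.
  rewrite -subr_ge0 [leRHS](_ : _ = besd 0 pi * (besd 0 pi - 4 * e * bes 0 pi)); last by ring.
  by rewrite mulr_ge0// subr_ge0 (le_trans _ W)// mulr_ge0_le0 ?mulr_ge0 ?ltW.
(* As [besd 0 pi] <= pi/2 <= -4 [bes 0 pi] and 2 e <= 1/4, the ratio of [u1 pi] to [u pi] is at most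
   17/4 in absolute value, and (17/4)^2 < 20. *)
have r2 : u1 pi ^+ 2 <= 20 * u pi ^+ 2.
  rewrite uE u1E !exprMn [leRHS]mulrCA ler_wpM2l ?sqr_ge0//.
  move: (bes 0 pi) (besd 0 pi) V W W2 v0 => v w V W W2 v0.
  have h1 : e * - v <= 1 / 8 * - v by rewrite ler_wpM2r// oppr_ge0 ltW.
  have h2 : 0 <= e * - v by rewrite mulr_ge0 ?oppr_ge0 ?ltW.
  rewrite -sqrrN opprB -mulrA.
  apply: le_trans (_ : (- (17 / 4) * v) ^+ 2 <= _).
    by rewrite lerXn2r ?nnegrE//; lra.
  by rewrite exprMn ler_wpM2r ?sqr_ge0//; lra.
have q1 : e ^+ 2 <= 1 / 64.
  apply: le_trans (_ : (1 / 8) ^+ 2 <= _); last lra.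
  by rewrite lerXn2r ?nnegrE// ltW.
have u12 : 0 < u1 pi ^+ 2 by apply: lt_le_trans r1; do 2 apply: mulr_gt0 => //; exact: exprn_gt0.
(* If al = 0, then [key] at A pi = - u pi bounds u(pi)^2 by (1 + 20)/64 times 8/7, that is 3/8, of
   itself. If be = 0, it bounds u1(pi)^2 by (1/4 + 1/64) times 8/7, that is 17/56, of itself. *)
split.
- apply/negP => /eqP al0; have := key _ (hal _ (lexx _)).
  rewrite al0 subr0 Api sqrrN; move: (u pi ^+ 2) (u1 pi ^+ 2) r1 r2 u20 => a b r1 r2 a0.
  move: (e ^+ 2) q1 (sqr_ge0 e) => q q1 q0.
  have h1 : q * a <= 1 / 64 * a by rewrite ler_wpM2r// ltW.
  have h2 : q * b <= q * (20 * a) by rewrite ler_wpM2l.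
  by rewrite mulrA mulrDr => h3; lra.
- apply/negP => /eqP be0; have := key _ (hbe _ (lexx _)).
  rewrite be0 subr0 Bpi sqrrN; move: (u pi ^+ 2) (u1 pi ^+ 2) r1 r2 u12 => a b r1 r2 b0.
  move: r1; move: (e ^+ 2) q1 (sqr_ge0 e) => q q1 q0 r1.
  have h1 : q * b <= 1 / 64 * b by rewrite ler_wpM2r// ltW.
  by rewrite mulrA mulrDr => h3; lra.
exists (U + U / 2); first by rewrite addr_ge0 ?divr_ge0.
move=> x xpi; have x0 : 0 < x := lt_le_trans pi0 xpi.
have cs := cos2Dsin2 x.
have e1 : u x = A x * cos x + B x * sin x by rewrite /A /B -[LHS]mulr1 -cs; ring.
have e2 : u1 x = B x * cos x - A x * sin x by rewrite /A /B -[LHS]mulr1 -cs; ring.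
have hA := hal _ xpi; have hB := hbe _ xpi.
have comb y z c : `|c| <= 1 -> `|y - z| <= U / 4 / x -> `|(y - z) * c| <= U / 4 / x.
  move=> c1 yz; rewrite normrM -[leRHS]mulr1 ler_pM//.
have Ux : 0 <= U / x by rewrite divr_ge0// ltW.
have UU : (U + U / 2) / x = 3 / 2 * (U / x) by field; rewrite gt_eqF.
have q : U / 4 / x = U / x / 4 by ring.
split.
  rewrite expr1 -/(u x) e1.
  rewrite [X in `|X|](_ : _ = (A x - al) * cos x + (B x - be) * sin x); last by ring.
  apply: le_trans (ler_normD _ _) _.
  apply: le_trans (lerD (comb _ _ _ (cos_max x) hA) (comb _ _ _ (sin_max x) hB)) _.
  by rewrite q UU; lra.
rewrite expr1 (_ : Num.sqrt x * besd 0 x = u x / (2 * x) - u1 x); last first.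
  rewrite /u /u1 [X in X^-1](_ : _ = 2 * Num.sqrt x ^+ 2); last by rewrite sqr_sqrtr ?ltW.
  by field; rewrite gt_eqF ?sqrtr_gt0.
rewrite e2 [X in `|X|](_ : _ = u x / (2 * x) + ((A x - al) * sin x - (B x - be) * cos x)); last by ring.
have h1 : `|u x / (2 * x)| <= U / 2 / x.
  rewrite normrM normfV (gtr0_norm (_ : 0 < 2 * x)) ?mulr_gt0// invfM mulrA.
  by rewrite !ler_wpM2r ?invr_ge0 ?(ltW x0)// bU.
apply: le_trans (ler_normD _ _) _.
have h2 := ler_normB ((A x - al) * sin x) ((B x - be) * cos x).
have hA' := comb _ _ _ (sin_max x) hA; have hB' := comb _ _ _ (cos_max x) hB.
have q2 : U / 2 / x = U / x / 2 by ring.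
by rewrite q in hA' hB'; rewrite UU q2 in h1 *; lra.
Qed.

End BesselBase.

(** * Simultaneous lower bound at x and 2x *)

Section BesselLower.
Context {R : realType}.
Implicit Types (x a b t al be : R) (n d : nat).

(* Each step n -> n.+2 rotates (al, be) by a quarter turn, so that starting from
   (0, 1) at n = 1 the odd n with al = 0 are those congruent to 1 mod 4. *)
Lemma bes_asym_neq0 d : (2 <= d)%N -> (d %% 4 != 1)%N ->
  exists al be : R, al != 0 /\ bes_asym d al be.
Proof.
have even k : exists al be : R, [/\ al != 0, be != 0 & bes_asym k.*2 al be].
  elim: k => [|k [al [be [al0 be0 h]]]]; first exact: bes_asym0.
  exists (k.*2.+1%:R * - be), (k.*2.+1%:R * al).
  by split; [rewrite mulf_neq0 ?oppr_eq0 ?pnatr_eq0..|exact: bes_asym_step].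
have odd1 k : exists al be : R, be != 0 /\ bes_asym (4 * k).+1 al be.
  elim: k => [|k [al [be [be0 h]]]].
    by exists 0, 1; rewrite oner_eq0; split => //; exact: bes_asym1.
  have := bes_asym_step (bes_asym_step h); rewrite (_ : (4 * k).+1.+4 = (4 * k.+1).+1); last by lia.
  by move=> h2; eexists; eexists; split; [|exact: h2]; rewrite !mulf_neq0 ?oppr_eq0 ?pnatr_eq0.
move=> d2 d4; have [od|ed] := boolP (odd d); last first.
  have [al [be [al0 _ h]]] := even d./2.
  by exists al, be; split=> //; rewrite even_halfK in h.
have [al [be [be0 h]]] := odd1 (d %/ 4)%N.
have := bes_asym_step h.
rewrite (_ : (4 * (d %/ 4)).+3 = d); last by lia.
by move=> h2; eexists; eexists; split; [|exact: h2]; rewrite mulf_neq0 ?oppr_eq0 ?pnatr_eq0.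
Qed.

(* With L x := al cos x + be sin x, the identity al = 2 cos x L x - L (2 x)
   shows that L x and L (2 x) cannot both be small. *)
Lemma bes_lower d : (2 <= d)%N -> (d %% 4 != 1)%N ->
  exists c K : R, [/\ 0 < c, 0 < K & forall x, K <= x ->
    c <= x ^+ d.+1 * (bes d x ^+ 2 + bes d (2 * x) ^+ 2)].
Proof.
move=> d2 d4; have [al [be [al0 [C C0 h]]]] := bes_asym_neq0 d2 d4.
have nal : 0 < `|al| by rewrite normr_gt0.
(* Beyond [6 * C / |al|] the total error 3 C / x is at most |al| / 2. Then al^2 / 4 <= 8 a^2 + 2
   b^2, and the normalisation at 2x contributes the factor 2^(d+1) to b^2. *)
exists (al ^+ 2 / 2 ^+ (d.+1 + 5)), (pi + 6 * C / `|al|).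
have pi0 := @pi_gt0 R.
have K0 : 0 <= 6 * C / `|al| by rewrite divr_ge0 ?mulr_ge0 ?(ltW nal).
split; first by apply: divr_gt0; [rewrite exprn_even_gt0|rewrite exprn_gt0].
  by rewrite ltr_wpDr.
move=> x Kx; have xpi : pi <= x by lra.
have x0 : 0 < x by lra.
have [h1 _] := h _ xpi.
have [h2 _] : _ /\ _ := h (2 * x) ltac:(lra).
have Cx : 3 * C / x <= `|al| / 2.
  have : 6 * C / `|al| <= x by lra.
  rewrite ler_pdivrMr// => hx; rewrite ler_pdivrMr//; lra.
move: h1 h2; set a := _ * bes d x; set b := _ * bes d (2 * x) => h1 h2.
have {}h2 : `|b - (al * cos (2 * x) + be * sin (2 * x))| <= C / x.
  by apply: le_trans h2 _; rewrite ler_wpM2l// lef_pV2 ?posrE//; lra.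
have key : al = 2 * cos x * (al * cos x + be * sin x) - (al * cos (2 * x) + be * sin (2 * x)).
  have -> : 2 * x = x *+ 2 by rewrite mulr_natl.
  rewrite sin_mulr2n cos_mulr2n !mulr2n; ring.
have b1 : `|al| <= 2 * `|a| + `|b| + 3 * C / x.
  rewrite [X in `|X| <= _]key.
  rewrite [X in `|X| <= _](_ : _ = 2 * cos x * a - b - 2 * cos x * (a - (al * cos x + be * sin x))
    + (b - (al * cos (2 * x) + be * sin (2 * x)))); last by ring.
  have c2 y : `|2 * cos x * y| <= 2 * `|y|.
    by rewrite !normrM ger0_norm// -mulrA ler_wpM2l// ler_piMl// cos_max.
  have n1 := ler_normD (2 * cos x * a - b - 2 * cos x * (a - (al * cos x + be * sin x)))
     (b - (al * cos (2 * x) + be * sin (2 * x))).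
  have n2 := ler_normB (2 * cos x * a - b) (2 * cos x * (a - (al * cos x + be * sin x))).
  have n3 := ler_normB (2 * cos x * a) b.
  have m1 := c2 a; have m2 := c2 (a - (al * cos x + be * sin x)).
  have -> : 3 * C / x = 3 * (C / x) by rewrite mulrA.
  lra.
have b2 : al ^+ 2 / 4 <= 8 * a ^+ 2 + 2 * b ^+ 2.
  have : `|al| / 2 <= 2 * `|a| + `|b| by lra.
  rewrite -[al ^+ 2]real_normK ?num_real// -[a ^+ 2]real_normK ?num_real// -[b ^+ 2]real_normK ?num_real//.
  move: (normr_ge0 al) (normr_ge0 a) (normr_ge0 b) => q0 q1 q2 q3.
  have : (`|al| / 2) ^+ 2 <= (2 * `|a| + `|b|) ^+ 2 by rewrite lerXn2r ?nnegrE//; lra.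
  have := sqr_ge0 (2 * `|a| - `|b|).
  rewrite !expr2; lra.
have a2 : a ^+ 2 = x ^+ d.+1 * bes d x ^+ 2.
  by rewrite /a exprMn exprAC sqr_sqrtr// ltW.
have b2' : b ^+ 2 = 2 ^+ d.+1 * (x ^+ d.+1 * bes d (2 * x) ^+ 2).
  by rewrite /b exprMn exprAC sqr_sqrtr ?mulr_ge0 ?(ltW x0)// exprMn mulrA.
rewrite ler_pdivrMr ?exprn_gt0// exprD.
rewrite a2 b2' in b2.
have p1 : 1 <= 2 ^+ d.+1 :> R by apply: exprn_ege1; lra.
move: (2 ^+ d.+1) p1 b2 => P p1.
have u0 : 0 <= x ^+ d.+1 * bes d x ^+ 2 by rewrite mulr_ge0 ?sqr_ge0// exprn_ge0 ?ltW.
have v0 : 0 <= x ^+ d.+1 * bes d (2 * x) ^+ 2 by rewrite mulr_ge0 ?sqr_ge0// exprn_ge0 ?ltW.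
rewrite mulrDr; move: (x ^+ d.+1 * _) (x ^+ d.+1 * _) u0 v0 => u v u0 v0 b2.
have : v <= P * v by rewrite ler_peMl.
have : 0 <= P * u by rewrite mulr_ge0//; lra.
rewrite mulrDl (_ : u * (P * 2 ^+ 5) = 32 * (P * u)); last by ring.
rewrite (_ : v * (P * 2 ^+ 5) = 32 * (P * v)); last by ring.
lra.
Qed.

End BesselLower.

(** * Lattice points in a ball *)

Section RiemannSum.
Context {R : realType}.
Implicit Types (x y t : R).

Lemma cos_lip x y : `|cos x - cos y| <= `|x - y|.
Proof.
rewrite -[leRHS]mul1r; apply: (@lipschitz_cst _ _ (fun x => - sin x)).
  by move=> z; exact: is_derive_cos.
by move=> z; rewrite normrN sin_max.
Qed.

Variables (G : R -> R) (K0 K1 : R).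
Hypothesis cG : continuous G.
Hypothesis G_le : forall s, 0 <= s <= 1 -> `|G s| <= K0.
Hypothesis G_lip : forall s s', 0 <= s <= 1 -> 0 <= s' <= 1 ->
  `|G s - G s'| <= K1 * `|s - s'|.
Variables (a rho L : R).
Hypothesis rho0 : 0 < rho.
Hypothesis rho1 : rho <= 1.
Hypothesis L1 : 1 <= L.

(** [phi] is the weight of the slice at height x of a ball of radius [rho], and [g] is its pullback,
    with Jacobian, under x = rho cos t. The angle removes the infinite slope of the square root at x
    = rho. *)
Let phi x := cos (a * x) * G (Num.sqrt (rho ^+ 2 - x ^+ 2)).
Let g t := cos (a * (rho * cos t)) * G (rho * sin t) * (rho * sin t).

Let K0_ge0 : 0 <= K0.
Proof. by apply: le_trans (normr_ge0 _) (G_le (s := 0) _); rewrite lexx ler01. Qed.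

Let K1_ge0 : 0 <= K1.
Proof.
have := G_lip (s := 1) (s' := 0); rewrite !lexx ler01 => /(_ isT isT).
by rewrite subr0 normr1 mulr1; apply: le_trans.
Qed.

Let L0 : 0 < L. Proof. exact: lt_le_trans ltr01 L1. Qed.

Let cg : continuous g.
Proof.
apply: continuous_mul; last by conts.
apply: continuous_mul; first by conts.
by apply: continuous_compl => //; conts.
Qed.

Variable F : R -> R.
Hypothesis dF : forall t, 0 <= t <= pi / 2 -> is_der t F (g t).

Let theta x := acos (x / rho).

Let theta_range x : 0 <= x <= rho -> 0 <= theta x <= pi / 2.
Proof.
move=> /andP[x0 x1]; have h : 0 <= x / rho <= 1.
  by rewrite divr_ge0 ?(ltW rho0)//= ler_pdivrMr// mul1r.
case/andP: h => h0 h1; have h2 : -1 <= x / rho <= 1 by rewrite h1 andbT; lra.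
rewrite acos_ge0//= leNgt; apply/negP => /[dup] lt1.
rewrite -(@ltr_cos R) ?in_itv/= ?acos_ge0 ?acos_lepi//; last first.
  by rewrite divr_ge0 ?pi_ge0//= ler_pdivrMr// ler_peMr ?pi_ge0// ler1n.
by rewrite acosK ?in_itv//= cos_pihalf; lra.
Qed.

Let cos_theta x : 0 <= x <= rho -> rho * cos (theta x) = x.
Proof.
move=> /andP[x0 x1]; rewrite acosK ?in_itv/=; first by rewrite mulrC divfK// gt_eqF.
have h0 : 0 <= x / rho by rewrite divr_ge0 ?(ltW rho0).
by rewrite ler_pdivrMr// mul1r x1 andbT; lra.
Qed.

Lemma riemann_cell x y : 0 <= x -> x <= y -> y <= rho -> y - x <= L^-1 ->
  `|(y - x) * phi y - (F (theta x) - F (theta y))| <=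
  (K0 * `|a| / L + K1 * (Num.sqrt (rho ^+ 2 - x ^+ 2) - Num.sqrt (rho ^+ 2 - y ^+ 2)))
   * (y - x).
Proof.
move=> x0 xy yr yx; set w := (K0 * _ / L + _).
have hx : 0 <= x <= rho by rewrite x0 (le_trans xy).
have hy : 0 <= y <= rho by rewrite (le_trans x0).
have tyx : theta y <= theta x.
  rewrite leNgt; apply/negP; rewrite -(@ltr_cos R) ?in_itv/=.
  - by rewrite -(ltr_pM2l rho0) !cos_theta// ltNge xy.
  - by have /andP[-> h] := theta_range hx; apply: le_trans h _; rewrite ler_pdivrMr// ler_peMr ?pi_ge0// ler1n.
  - by have /andP[-> h] := theta_range hy; apply: le_trans h _; rewrite ler_pdivrMr// ler_peMr ?pi_ge0// ler1n.
(* On the cell, [phi] is compared with its value at [y]: the derivative of [H] is (phi (rho cos t) -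
   phi y) rho sin t, and that of - w rho cos t dominates it. *)
pose H t := F t + phi y * (rho * cos t).
have := @lipschitz_derive _ H (fun t => g t - phi y * (rho * sin t))
  (fun t => - w * (rho * cos t)) (fun t => w * (rho * sin t)) _ _ tyx.
rewrite /H !cos_theta// => h.
rewrite [X in `|X|](_ : _ = - (F (theta x) + phi y * x - (F (theta y) + phi y * y))); last by ring.
rewrite normrN; apply: le_trans (h _ _ _) _; last by rewrite le_eqVlt; apply/orP; left; apply/eqP; ring.
- move=> t /andP[t0 t1]; apply: der_val; split.
    apply: der_add; last by isd.
    apply: dF; have /andP[h1 h2] := theta_range hx; have /andP[h3 h4] := theta_range hy.
    by rewrite (le_trans h3)//= (le_trans t1).
  by rewrite /=; ring.
- by move=> t _; apply: der_val; split; [isd|rewrite /=; ring].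
move=> t /andP[t0 t1].
have /andP[h1 h2] := theta_range hx; have /andP[h3 h4] := theta_range hy.
have tpi : t <= pi.
  by apply: le_trans t1 (le_trans h2 _); rewrite ler_pdivrMr// ler_peMr ?pi_ge0// ler1n.
have t00 : 0 <= t := le_trans h3 t0.
have st : 0 <= sin t by apply: sin_ge0_pi; rewrite t00.
rewrite /g -mulrBl normrM (ger0_norm (_ : 0 <= rho * sin t)); last by rewrite mulr_ge0// ltW.
rewrite ler_wpM2r ?mulr_ge0 ?(ltW rho0)//.
have /andP[z1 z2] : x <= rho * cos t <= y.
  rewrite -{1}(cos_theta hx) -{1}(cos_theta hy) !ler_pM2l//.
  have tx_pi : theta x <= pi by apply: le_trans h2 _; rewrite ler_pdivrMr// ler_peMr ?pi_ge0// ler1n.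
  by apply/andP; split; rewrite leNgt ltr_cos -?leNgt ?in_itv/= ?t00 ?tpi ?h1 ?h3 ?tx_pi// (le_trans t0).
have sE : rho * sin t = Num.sqrt (rho ^+ 2 - (rho * cos t) ^+ 2).
  rewrite (_ : rho ^+ 2 - _ = (rho * sin t) ^+ 2); last by rewrite !exprMn sin2cos2; ring.
  by rewrite sqrtr_sqr ger0_norm// mulr_ge0// ltW.
rewrite sE; move: (rho * cos t) z1 z2 => z z1 z2.
have z0 : 0 <= z := le_trans x0 z1.
have y0 : 0 <= y := le_trans z0 z2.
have sq u v : 0 <= u -> u <= v -> v <= rho ->
    Num.sqrt (rho ^+ 2 - v ^+ 2) <= Num.sqrt (rho ^+ 2 - u ^+ 2).
  move=> u0 uv vr; have v0 : 0 <= v := le_trans u0 uv.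
  have uv2 : u ^+ 2 <= v ^+ 2 by rewrite lerXn2r.
  have vr2 : v ^+ 2 <= rho ^+ 2 by rewrite lerXn2r ?nnegrE ?(ltW rho0).
  by rewrite ler_sqrt; lra.
have s01 u : 0 <= u -> u <= rho -> 0 <= Num.sqrt (rho ^+ 2 - u ^+ 2) <= 1.
  move=> u0 ur; rewrite sqrtr_ge0 -[1]sqrtr1 ler_sqrt//.
  have r2 : rho ^+ 2 <= 1 by rewrite expr_le1// ltW.
  by have := sqr_ge0 u; lra.
rewrite /phi; set A := Num.sqrt (rho ^+ 2 - z ^+ 2); set B := Num.sqrt (rho ^+ 2 - y ^+ 2).
rewrite [X in `|X|](_ : _ = (cos (a * z) - cos (a * y)) * G A + cos (a * y) * (G A - G B)); last by ring.
apply: le_trans (ler_normD _ _) _; rewrite !normrM; apply: lerD.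
  rewrite mulrC -mulrA ler_pM ?G_le ?s01 ?(le_trans z2)//.
  apply: le_trans (cos_lip _ _) _; rewrite -mulrBr normrM ler_wpM2l// distrC.
  by rewrite ger0_norm ?subr_ge0//; apply: le_trans yx; rewrite lerB.
apply: le_trans (_ : 1 * (K1 * `|A - B|) <= _).
  by rewrite ler_pM// ?cos_max// G_lip// s01// (le_trans z2).
rewrite mul1r ler_wpM2l// ger0_norm ?subr_ge0 ?sq// lerB// sq// (le_trans z2)//.
Qed.

(** In [riemann_cell] the modulus of continuity is the decrease of the half-chord across the cell,
    which telescopes over cells of equal width. Thus [K1] is paid once in total, although [phi] need
    not be Lipschitz near [rho]. *)
Lemma riemann_steps (q : nat) : q%:R / L <= rho ->
  `|L^-1 * \sum_(1 <= z < q.+1) phi (z%:R / L) - (F (pi / 2) - F (theta (q%:R / L)))|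
  <= (K0 * `|a| * (q%:R / L) + K1 * (rho - Num.sqrt (rho ^+ 2 - (q%:R / L) ^+ 2))) / L.
Proof.
elim: q => [|q IH] qrho.
  rewrite big_geq// mulr0 mul0r /theta mul0r acos0 expr0n/= subr0 sqrtr_sqr.
  by rewrite (gtr0_norm rho0) !subrr !mulr0 addr0 mul0r normr0.
have dq : q.+1%:R / L - q%:R / L = L^-1.
  by rewrite -mulrBl -natrB// subSnn mul1r.
have Lv : 0 < L^-1 by rewrite invr_gt0.
have q0 : 0 <= q%:R / L by rewrite divr_ge0// ltW.
have qq : q%:R / L <= q.+1%:R / L by rewrite -subr_ge0 dq ltW.
have := riemann_cell q0 qq qrho; rewrite dq lexx => /(_ isT) hc.
have {}IH := IH (le_trans qq qrho).
rewrite big_nat_recr//= mulrDr.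
set S := \sum_(_ <= _ < _) _ in IH *.
move: IH hc; set y := q.+1%:R / L; set x := q%:R / L.
set sx := Num.sqrt (_ - x ^+ 2); set sy := Num.sqrt (_ - y ^+ 2) => IH hc.
rewrite [X in `|X|](_ : _ = (L^-1 * S - (F (pi / 2) - F (theta x)))
   + (L^-1 * phi y - (F (theta x) - F (theta y)))); last by ring.
apply: le_trans (ler_normD _ _) _; apply: le_trans (lerD IH hc) _.
rewrite -mulrDl ler_wpM2r ?(ltW Lv)// (_ : y = x + L^-1); last by rewrite -dq addrC subrK.
by rewrite le_eqVlt; apply/orP; left; apply/eqP; ring.
Qed.

(** What remains between q / L and rho is at most one cell and costs [K0 / L]. *)
Lemma riemann_half (q : nat) : q%:R / L <= rho -> rho <= q.+1%:R / L ->
  `|L^-1 * \sum_(1 <= z < q.+1) phi (z%:R / L) - qint g| <= (K0 * `|a| + K1 + K0) / L.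
Proof.
move=> q1 q2; rewrite (qint_FTC_itv dF cg).
have Lv : 0 < L^-1 by rewrite invr_gt0.
have := riemann_steps q1; set S := \sum_(_ <= _ < _) _ => h.
have q0 : 0 <= q%:R / L by rewrite divr_ge0// ltW.
have hq : 0 <= q%:R / L <= rho by rewrite q0.
have /andP[t0 t1] := theta_range hq.
have hF : `|F (theta (q%:R / L)) - F 0| <= K0 / L.
  apply: le_trans (_ : - K0 * (rho * cos (theta (q%:R / L))) - - K0 * (rho * cos 0) <= _).
    apply: (@lipschitz_derive _ F g (fun t => - K0 * (rho * cos t))
      (fun t => K0 * (rho * sin t))) => // t /andP[s0 s1].
    - by apply: dF; rewrite s0 (le_trans s1).
    - by apply: der_val; split; [isd|rewrite /=; ring].
    have tpi : t <= pi.
      by apply: le_trans s1 (le_trans t1 _); rewrite ler_pdivrMr// ler_peMr ?pi_ge0// ler1n.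
    have st : 0 <= sin t by apply: sin_ge0_pi; rewrite s0.
    have rs : 0 <= rho * sin t by rewrite mulr_ge0// ltW.
    rewrite /g normrM (ger0_norm rs) ler_wpM2r// normrM -[leRHS]mul1r ler_pM ?cos_max//.
    apply: G_le; rewrite rs/= mulr_ile1 ?sin_le1//; exact: ltW.
  rewrite cos_theta// cos0 mulr1 -subr_ge0.
  rewrite [leRHS](_ : _ = K0 * (q.+1%:R / L - rho)); last by rewrite -addn1 natrD; ring.
  by rewrite mulr_ge0// subr_ge0.
rewrite [X in `|X|](_ : _ =
    (L^-1 * S - (F (pi / 2) - F (theta (q%:R / L)))) - (F (theta (q%:R / L)) - F 0)); last by ring.
apply: le_trans (ler_normB _ _) _; rewrite [leRHS]mulrDl; apply: lerD => //.
apply: le_trans h _; rewrite ler_wpM2r ?(ltW Lv)//; apply: lerD.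
  by rewrite ler_piMr ?mulr_ge0// (le_trans q1).
by rewrite ler_piMr// lerBlDr (le_trans rho1)// lerDl sqrtr_ge0.
Qed.

End RiemannSum.

Section LatticeSlice.
Context {R : realType}.

(** The range from - m to m - 1 is not symmetric: - m has no partner, and 0 is its own. *)
Lemma sum_centered (m : nat) (H : int -> R) : (0 < m)%N ->
  \sum_(i < m.*2) H (i%:Z - m%:Z) =
  H (- m%:Z) + H 0 + \sum_(1 <= z < m) (H z%:Z + H (- z%:Z)).
Proof.
move=> m0; rewrite -(big_mkord xpredT (fun i => H (i%:Z - m%:Z))) -addnn.
rewrite (@big_cat_nat _ _ _ m)//= ?leq_addr//.
rewrite -{3}[m]add0n big_addn addnK.
rewrite big_ltn// (big_ltn m0) add0n subrr sub0r.
rewrite [\sum_(1 <= i < m) H (i%:Z - _)]big_nat_rev/= big_split/=.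
rewrite (eq_big_nat _ _ (F2 := fun i => H (- i%:Z))); last first.
  by move=> i /andP[i1 im]; congr H; lia.
rewrite [X in _ + (_ + X)](eq_big_nat _ _ (F2 := fun i => H i%:Z)); last first.
  by move=> i /andP[i1 im]; congr H; lia.
ring.
Qed.

(** The summand is even, so the pairs z, - z give twice [riemann_half]; z = 0 accounts for the last
    [K0], and z = - m is excluded by T <= L^2 <= m^2. *)
Lemma lattice_slice (G : R -> R) (K0 K1 a L T : R) (m : nat) :
  continuous G -> (forall s, 0 <= s <= 1 -> `|G s| <= K0) ->
  (forall s s', 0 <= s <= 1 -> 0 <= s' <= 1 -> `|G s - G s'| <= K1 * `|s - s'|) ->
  1 <= L -> L <= m%:R -> T <= L ^+ 2 ->
  `|L^-1 * \sum_(i < m.*2 | (i%:Z - m%:Z)%:~R ^+ 2 < T)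
       cos (a * ((i%:Z - m%:Z)%:~R / L)) * G (Num.sqrt (T - (i%:Z - m%:Z)%:~R ^+ 2) / L)
    - 2 * (Num.sqrt T / L * qint (fun t => cos (a * (Num.sqrt T / L * cos t)) *
             G (Num.sqrt T / L * sin t) * sin t))|
  <= (2 * (K0 * `|a| + K1 + K0) + K0) / L.
Proof.
move=> cG GK0 GK1 L1 Lm TL2.
have L0 : 0 < L := lt_le_trans ltr01 L1.
have K00 : 0 <= K0 by apply: le_trans (normr_ge0 _) (GK0 0 _); rewrite lexx ler01.
have K10 : 0 <= K1.
  have := GK1 1 0; rewrite !lexx ler01 => /(_ isT isT).
  by rewrite subr0 normr1 mulr1; apply: le_trans.
have m0 : (0 < m)%N by rewrite -(ltr_nat R) (lt_le_trans L0).
have [T0|T0] := leP T 0.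
  rewrite big_pred0; last by move=> i; apply/negbTE; rewrite -leNgt (le_trans T0)// sqr_ge0.
  rewrite (ler0_sqrtr T0) !mul0r !mulr0 subrr normr0 divr_ge0 ?(ltW L0)//.
  by rewrite addr_ge0// mulr_ge0// !addr_ge0// mulr_ge0.
pose rho := Num.sqrt T / L; rewrite -/rho.
have rho0 : 0 < rho by rewrite divr_gt0// sqrtr_gt0.
have rho1 : rho <= 1.
  rewrite ler_pdivrMr// mul1r -[leRHS]gtr0_norm// -sqrtr_sqr ler_sqrt// sqr_ge0.
  by [].
have rho2 : rho ^+ 2 = T / L ^+ 2 by rewrite exprMn sqr_sqrtr ?(ltW T0)// exprVn.
pose phi x := cos (a * x) * G (Num.sqrt (rho ^+ 2 - x ^+ 2)).
pose H (z : int) : R := if z%:~R ^+ 2 < T then phi (z%:~R / L) else 0.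
have sqE (z : int) : Num.sqrt (T - z%:~R ^+ 2) / L = Num.sqrt (rho ^+ 2 - (z%:~R / L) ^+ 2).
  rewrite rho2 exprMn exprVn -mulrBl mulrC [X in _ = Num.sqrt X]mulrC sqrtrM ?invr_ge0 ?sqr_ge0//.
  by rewrite -exprVn sqrtr_sqr gtr0_norm ?invr_gt0.
rewrite (eq_bigr (fun i : 'I_m.*2 => phi ((i%:Z - m%:Z)%:~R / L))); last first.
  by move=> i _; rewrite sqE.
rewrite big_mkcond/= (sum_centered H m0).
have HN z : H (- z) = H z.
  by rewrite /H /phi mulrNz sqrrN mulNr sqrrN mulrN cosN.
have Hm : H (- m%:Z) = 0.
  rewrite HN /H ltNge (le_trans TL2)//= -[m%:~R]/(m%:R : R) lerXn2r ?nnegrE//.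
  exact: ltW.
have [n0 hn0] : exists n : nat, Num.sqrt T <= n%:R.
  by exists (Num.bound (Num.sqrt T)); rewrite ltW// archi_boundP// sqrtr_ge0.
have exn : exists n : nat, Num.sqrt T <= n%:R by exists n0.
(* [q] is the largest natural number strictly below the square root of [T], which matches the strict
   condition z^2 < T. *)
case: (ex_minnP exn) => -[|q] hq minq.
  by move: hq; rewrite leNgt sqrtr_gt0 T0.
have q1 : q%:R < Num.sqrt T by rewrite ltNge; apply/negP => /minq; rewrite ltnn.
have sL : Num.sqrt T <= L by rewrite -[leRHS]gtr0_norm// -sqrtr_sqr ler_sqrt// sqr_ge0.
have qm : (q.+1 <= m)%N by rewrite -(ltr_nat R) (lt_le_trans q1)// (le_trans sL).
have sumE : \sum_(1 <= z < m) (H z%:Z + H (- z%:Z)) = 2 * \sum_(1 <= z < q.+1) phi (z%:R / L).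
  rewrite (eq_bigr (fun z : nat => 2 * H z%:Z)); last by move=> z _; rewrite HN; ring.
  rewrite -mulr_sumr (@big_cat_nat _ _ _ q.+1)//= [X in _ + X]big_nat_cond [X in _ + X]big1 ?addr0.
    congr (_ * _); apply: eq_big_nat => z /andP[_ zq]; rewrite /H ifT//.
    rewrite -[T]sqr_sqrtr ?(ltW T0)// -[z%:~R]/(z%:R : R) ltrXn2r// ?nnegrE ?sqrtr_ge0//=.
    by apply: le_lt_trans q1; rewrite ler_nat.
  move=> z /andP[/andP[zq _] _]; rewrite /H ifF//; apply/negbTE; rewrite -leNgt.
  rewrite -[T]sqr_sqrtr ?(ltW T0)// -[z%:~R]/(z%:R : R) lerXn2r ?nnegrE ?sqrtr_ge0//.
  by apply: le_trans hq _; rewrite ler_nat.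
rewrite Hm add0r sumE.
pose g t := cos (a * (rho * cos t)) * G (rho * sin t) * (rho * sin t).
have cg0 : continuous (fun t => cos (a * (rho * cos t)) * G (rho * sin t) * sin t).
  apply: continuous_mul; last by conts.
  by apply: continuous_mul; [conts|apply: continuous_compl => //; conts].
have gE : rho * qint (fun t => cos (a * (rho * cos t)) * G (rho * sin t) * sin t) = qint g.
  by rewrite -qintZ//; apply: qint_eq => t; rewrite /g; ring.
have [F dF] : exists F : R -> R, forall x, 0 <= x <= pi / 2 -> is_der x F (g x).
  apply: primitive_exists; apply: continuous_mul; last by conts.
  by apply: continuous_mul; [conts|apply: continuous_compl => //; conts].
have q1' : q%:R / L <= rho by rewrite ler_wpM2r ?invr_ge0 ?(ltW L0) ?(ltW q1).
have q2' : rho <= q.+1%:R / L by rewrite ler_wpM2r ?invr_ge0 ?(ltW L0).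
have := riemann_half cG GK0 GK1 rho0 rho1 L1 dF q1' q2'.
rewrite gE; set S := \sum_(_ <= _ < _) _; rewrite -/g => h.
rewrite [X in `|X|](_ : _ = L^-1 * H 0 + 2 * (L^-1 * S - qint g)); last by ring.
apply: le_trans (ler_normD _ _) _; rewrite addrC [leRHS]mulrDl; apply: lerD.
  by rewrite normrM ger0_norm// -mulrA ler_wpM2l.
rewrite normrM normfV (gtr0_norm L0) mulrC ler_wpM2r ?invr_ge0 ?(ltW L0)//.
rewrite /H expr0n/= T0 /phi !mul0r mulr0 cos0 mul1r; apply: GK0.
by rewrite expr0n/= subr0 sqrtr_sqr gtr0_norm// rho1 ltW.
Qed.

End LatticeSlice.

Section LatticeSums.
Context {R : realType}.
Implicit Types (d m : nat).

(* 'I_m.*2 enumerates J_M for M = 2m through i |-> i - m. *)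
Definition ctr m (i : 'I_m.*2) : R := (i%:Z - m%:Z)%:~R.

Definition fcons d (J : Type) (j : J) (g : {ffun 'I_d -> J}) : {ffun 'I_d.+1 -> J} :=
  [ffun i => oapp g j (unlift ord0 i)].

Lemma fcons0 d (J : Type) (j : J) (g : {ffun 'I_d -> J}) : fcons j g ord0 = j.
Proof. by rewrite ffunE unlift_none. Qed.

Lemma fconsS d (J : Type) (j : J) (g : {ffun 'I_d -> J}) i :
  fcons j g (lift ord0 i) = g i.
Proof. by rewrite ffunE liftK. Qed.

Lemma sum_fcons (V : nmodType) d (J : finType) (P : pred {ffun 'I_d.+1 -> J})
    (F : {ffun 'I_d.+1 -> J} -> V) :
  \sum_(f | P f) F f = \sum_(j : J) \sum_(g : {ffun 'I_d -> J} | P (fcons j g)) F (fcons j g).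
Proof.
rewrite pair_big_dep/= (reindex (fun p : J * {ffun 'I_d -> J} => fcons p.1 p.2))//=.
exists (fun f => (f ord0, [ffun i => f (lift ord0 i)])) => [[j g] _|f _] /=.
  by rewrite fcons0; congr pair; apply/ffunP => i; rewrite ffunE fconsS.
apply/ffunP => i; rewrite ffunE; case: unliftP => [k ->|->]//=.
by rewrite ffunE.
Qed.

Definition sqn d m (f : {ffun 'I_d -> 'I_m.*2}) : R := \sum_i ctr (f i) ^+ 2.

Definition dotn d m (eta : 'I_d -> R) (f : {ffun 'I_d -> 'I_m.*2}) : R :=
  \sum_i eta i * ctr (f i).

(* The squared radius T is independent of the scale L because the slices of a
   ball have smaller radii. *)
Definition cos_sum d m (eta : 'I_d -> R) (L T : R) : R :=
  L ^- d * \sum_(f : {ffun 'I_d -> 'I_m.*2} | sqn f < T) cos (dotn eta f / L).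

(** The addition formula mixes cosines and sines when a coordinate is split off, so the induction
    carries a smallness bound for this sum too. *)
Definition sin_sum d m (eta : 'I_d -> R) (L T : R) : R :=
  L ^- d * \sum_(f : {ffun 'I_d -> 'I_m.*2} | sqn f < T) sin (dotn eta f / L).

Definition tail d (eta : 'I_d.+1 -> R) (i : 'I_d) := eta (lift ord0 i).

Lemma sqn_fcons d m j (g : {ffun 'I_d -> 'I_m.*2}) :
  sqn (fcons j g) = ctr j ^+ 2 + sqn g.
Proof.
by rewrite /sqn big_ord_recl fcons0; congr (_ + _); apply: eq_bigr => i _; rewrite fconsS.
Qed.

Lemma dotn_fcons d m eta j (g : {ffun 'I_d -> 'I_m.*2}) :
  dotn eta (fcons j g) = eta ord0 * ctr j + dotn (tail eta) g.
Proof.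
by rewrite /dotn big_ord_recl fcons0; congr (_ + _); apply: eq_bigr => i _; rewrite fconsS.
Qed.

Lemma sqn_ge0 d m (f : {ffun 'I_d -> 'I_m.*2}) : 0 <= sqn f.
Proof. by apply: sumr_ge0 => i _; rewrite sqr_ge0. Qed.

Lemma cos_sum_recl d m (eta : 'I_d.+1 -> R) L T : cos_sum m eta L T =
  L^-1 * \sum_(i < m.*2 | ctr i ^+ 2 < T)
    (cos (eta ord0 * (ctr i / L)) * cos_sum m (tail eta) L (T - ctr i ^+ 2)
   - sin (eta ord0 * (ctr i / L)) * sin_sum m (tail eta) L (T - ctr i ^+ 2)).
Proof.
rewrite /cos_sum sum_fcons exprS invfM -mulrA; congr (_ * _).
rewrite mulr_sumr [RHS]big_mkcond/=; apply: eq_bigr => i _.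
case: ifPn => iT; last first.
  rewrite big_pred0 ?mulr0// => g; rewrite sqn_fcons; apply/negbTE.
  by rewrite -leNgt; rewrite -leNgt in iT; apply: le_trans iT _; rewrite lerDl sqn_ge0.
rewrite mulrCA [X in _ - X]mulrCA -mulrBr; congr (_ * _).
rewrite !mulr_sumr -sumrB; apply: eq_big => [g|g _].
  by rewrite sqn_fcons ltrBrDl.
by rewrite dotn_fcons mulrDl cosD mulrA.
Qed.

Lemma sin_sum_recl d m (eta : 'I_d.+1 -> R) L T : sin_sum m eta L T =
  L^-1 * \sum_(i < m.*2 | ctr i ^+ 2 < T)
    (sin (eta ord0 * (ctr i / L)) * cos_sum m (tail eta) L (T - ctr i ^+ 2)
   + cos (eta ord0 * (ctr i / L)) * sin_sum m (tail eta) L (T - ctr i ^+ 2)).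
Proof.
rewrite /sin_sum sum_fcons exprS invfM -mulrA; congr (_ * _).
rewrite mulr_sumr [RHS]big_mkcond/=; apply: eq_bigr => i _.
case: ifPn => iT; last first.
  rewrite big_pred0 ?mulr0// => g; rewrite sqn_fcons; apply/negbTE.
  by rewrite -leNgt; rewrite -leNgt in iT; apply: le_trans iT _; rewrite lerDl sqn_ge0.
rewrite mulrCA [X in _ + X]mulrCA -mulrDr; congr (_ * _).
rewrite !mulr_sumr -big_split/=; apply: eq_big => [g|g _].
  by rewrite sqn_fcons ltrBrDl.
by rewrite dotn_fcons mulrDl sinD mulrA.
Qed.

Lemma slice_sin_eq0 (a L T : R) m (W : R -> R) : 1 <= L -> L <= m%:R -> T <= L ^+ 2 ->
  \sum_(i < m.*2 | ctr i ^+ 2 < T) sin (a * (ctr i / L)) * W (ctr i ^+ 2) = 0.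
Proof.
move=> L1 Lm TL2.
have L0 : 0 < L := lt_le_trans ltr01 L1.
have m0 : (0 < m)%N by rewrite -(ltr_nat R) (lt_le_trans L0).
pose H (z : int) : R := if z%:~R ^+ 2 < T then sin (a * (z%:~R / L)) * W (z%:~R ^+ 2) else 0.
rewrite big_mkcond/= (sum_centered H m0).
have HN z : H (- z) = - H z.
  by rewrite /H mulrNz sqrrN mulNr mulrN sinN mulNr; case: ifP; rewrite ?oppr0.
have -> : H (- m%:Z) = 0.
  rewrite /H ltNge mulrNz sqrrN (le_trans TL2)//= -[m%:~R]/(m%:R : R) lerXn2r ?nnegrE//.
  exact: ltW.
have -> : H 0 = 0 by rewrite /H mul0r mulr0 sin0 mul0r; case: ifP.
by rewrite !add0r big1// => z _; rewrite HN subrr.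
Qed.

(** For G = 1 and a = 0, [lattice_slice] bounds the left-hand side by 2 sqrt(T) / L + 3 / L. *)
Lemma slice_card (L T : R) m : 1 <= L -> L <= m%:R -> T <= L ^+ 2 ->
  L^-1 * \sum_(i < m.*2 | ctr i ^+ 2 < T) 1 <= 5.
Proof.
move=> L1 Lm TL2; have L0 : 0 < L := lt_le_trans ltr01 L1.
have := @lattice_slice R (fun=> 1) 1 0 0 L T m _ _ _ L1 Lm TL2.
move=> /(_ (@cst_continuous _ _ _)) h.
have {}h := h (fun s _ => ltac:(by rewrite normr1)) (fun s s' _ _ => ltac:(by rewrite subrr normr0 mul0r)).
have := h; under eq_bigr do rewrite mul0r cos0 mul1r.
set q := qint _; have qE : q = 1.
  rewrite /q (_ : qint _ = qint (fun t => sin t)); last by apply: qint_eq => t; rewrite mul0r cos0 !mul1r.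
  rewrite (@qint_FTC R (fun t => - cos t)); first by rewrite cos_pihalf cos0; ring.
    by move=> t; apply: der_val; split; [isd|rewrite /=; ring].
  by conts.
rewrite qE mulr1 normr0 mulr0 addr0 add0r mulr1 => {}h.
have r1 : Num.sqrt T / L <= 1.
  by rewrite ler_pdivrMr// mul1r -[leRHS]gtr0_norm// -sqrtr_sqr ler_sqrt// sqr_ge0.
have h3 : (2 + 1) / L <= 3 by rewrite ler_pdivrMr//; lra.
by move: h; rewrite ler_norml => /andP[_]; lra.
Qed.

End LatticeSums.

Section LatticeBessel.
Context {R : realType}.
Implicit Types (d m : nat).

(** On each slice, replacing the sums over the other coordinates by [G] and 0 costs 2 E; by
    [slice_card] there are at most 5 L slices, hence 10 E. What is left is [lattice_slice] for the
    cosine sum, and an odd sum, equal to zero, for the sine sum. *)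
Lemma lattice_step d m (eta : 'I_d.+1 -> R) (L T : R) (G : R -> R) (K0 K1 E : R) :
  1 <= L -> L <= m%:R -> T <= L ^+ 2 ->
  continuous G -> (forall s, 0 <= s <= 1 -> `|G s| <= K0) ->
  (forall s s', 0 <= s <= 1 -> 0 <= s' <= 1 -> `|G s - G s'| <= K1 * `|s - s'|) ->
  0 <= E ->
  (forall T', 0 < T' -> T' <= L ^+ 2 ->
     `|cos_sum m (tail eta) L T' - G (Num.sqrt T' / L)| <= E /\
     `|sin_sum m (tail eta) L T'| <= E) ->
  let a := eta ord0 in let rho := Num.sqrt T / L in
  `|cos_sum m eta L T - 2 * (rho * qint (fun t => cos (a * (rho * cos t)) *
             G (rho * sin t) * sin t))| <= 10 * E + (2 * (K0 * `|a| + K1 + K0) + K0) / L /\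
  `|sin_sum m eta L T| <= 10 * E.
Proof.
move=> L1 Lm TL2 cG GK0 GK1 E0 hE a rho.
have L0 : 0 < L := lt_le_trans ltr01 L1.
have Lv : 0 <= L^-1 by rewrite invr_ge0 ltW.
have card := slice_card L1 Lm TL2.
have hE' (i : 'I_m.*2) : ctr i ^+ 2 < T ->
    `|cos_sum m (tail eta) L (T - ctr i ^+ 2) - G (Num.sqrt (T - ctr i ^+ 2) / L)| <= E /\
    `|sin_sum m (tail eta) L (T - ctr i ^+ 2)| <= E.
  by move=> iT; apply: hE; rewrite ?subr_gt0// lerBlDr (le_trans TL2)// lerDl sqr_ge0.
have bound (u v X Y Z : R) : `|u| <= 1 -> `|v| <= 1 -> `|X - Z| <= E -> `|Y| <= E ->
    `|u * (X - Z) + v * Y| <= 2 * E.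
  move=> u1 v1 XZ YE; apply: le_trans (ler_normD _ _) _; rewrite !normrM.
  have -> : 2 * E = 1 * E + 1 * E by ring.
  by apply: lerD; apply: ler_pM.
have total (F : 'I_m.*2 -> R) : (forall i, ctr i ^+ 2 < T -> `|F i| <= 2 * E) ->
    `|L^-1 * \sum_(i < m.*2 | ctr i ^+ 2 < T) F i| <= 10 * E.
  move=> FE; rewrite normrM ger0_norm//.
  apply: le_trans (_ : L^-1 * \sum_(i < m.*2 | ctr i ^+ 2 < T) (2 * E * 1) <= _).
    rewrite ler_wpM2l//; apply: le_trans (ler_norm_sum _ _ _) _.
    by apply: ler_sum => i /FE; rewrite mulr1.
  rewrite -mulr_sumr mulrCA; apply: le_trans (ler_wpM2l _ card) _; first by rewrite mulr_ge0.
  lra.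
split.
  have hs := @lattice_slice R G K0 K1 a L T m cG GK0 GK1 L1 Lm TL2.
  set Q := 2 * _ in hs *; rewrite cos_sum_recl.
  set S := L^-1 * _ in hs; rewrite [X in `|X - _|](_ : _ = (L^-1 * \sum_(i < m.*2 | ctr i ^+ 2 < T)
     (cos (a * (ctr i / L)) * (cos_sum m (tail eta) L (T - ctr i ^+ 2) - G (Num.sqrt (T - ctr i ^+ 2) / L)) +
      - sin (a * (ctr i / L)) * sin_sum m (tail eta) L (T - ctr i ^+ 2))) + S); last first.
    rewrite /S -mulrDr -big_split/=; congr (_ * _); apply: eq_bigr => i _.
    by rewrite /ctr; ring.
  rewrite -addrA; apply: le_trans (ler_normD _ _) _; apply: lerD => //.
  apply: total => i /hE'[h1 h2]; apply: bound => //; rewrite ?normrN ?cos_max ?sin_max//.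
have s0 := slice_sin_eq0 a (fun x => G (Num.sqrt (T - x) / L)) L1 Lm TL2.
rewrite sin_sum_recl; set S := \sum_(_ | _) _.
have -> : S = \sum_(i < m.*2 | ctr i ^+ 2 < T)
   (sin (a * (ctr i / L)) * (cos_sum m (tail eta) L (T - ctr i ^+ 2) - G (Num.sqrt (T - ctr i ^+ 2) / L)) +
    cos (a * (ctr i / L)) * sin_sum m (tail eta) L (T - ctr i ^+ 2)).
  by rewrite -[S]subr0 -[X in _ - X]s0 -sumrB; apply: eq_bigr => i _; rewrite /a; ring.
apply: total => i /hE'[h1 h2].
by apply: bound => //; rewrite ?cos_max ?sin_max.
Qed.

Definition nrm d (eta : 'I_d -> R) : R := Num.sqrt (\sum_i eta i ^+ 2).

Lemma nrm_recl d (eta : 'I_d.+1 -> R) :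
  nrm eta ^+ 2 = eta ord0 ^+ 2 + nrm (tail eta) ^+ 2.
Proof.
rewrite !sqr_sqrtr ?big_ord_recl//; first by apply: sumr_ge0 => i _; rewrite sqr_ge0.
by rewrite addr_ge0 ?sqr_ge0//; apply: sumr_ge0 => i _; rewrite sqr_ge0.
Qed.

Lemma nrm_ge0 d (eta : 'I_d -> R) : 0 <= nrm eta. Proof. exact: sqrtr_ge0. Qed.

Lemma nrm_tail_le d (eta : 'I_d.+1 -> R) : nrm (tail eta) <= nrm eta.
Proof.
rewrite -(@ler_pXn2r _ 2) ?nnegrE ?nrm_ge0//.
by rewrite nrm_recl lerDr sqr_ge0.
Qed.

Lemma nrm_head_le d (eta : 'I_d.+1 -> R) : `|eta ord0| <= nrm eta.
Proof.
rewrite -(@ler_pXn2r _ 2) ?nnegrE ?nrm_ge0//.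
by rewrite nrm_recl real_normK ?num_real// lerDl sqr_ge0.
Qed.

Lemma bes_lipschitz n (b s s' : R) : 0 <= s <= 1 -> 0 <= s' <= 1 ->
  `|s ^+ n * bes n (b * s) - s' ^+ n * bes n (b * s')| <= (n%:R + `|b|) * (pi / 2) * `|s - s'|.
Proof.
wlog ss : s s' / s' <= s.
  move=> hw; case: (leP s' s) => [|/ltW] h; first exact: hw.
  by move=> h1 h2; rewrite distrC [ `|s - s'|]distrC; apply: hw.
move=> /andP[s0 s1] /andP[s'0 s'1]; rewrite (ger0_norm (_ : 0 <= s - s')) ?subr_ge0// mulrBr.
pose D x : R := n%:R * x ^+ n.-1 * bes n (b * x) + x ^+ n * (- besd n (b * x) * b).
apply: (@lipschitz_derive _ (fun x => x ^+ n * bes n (b * x)) D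
  (fun x => (n%:R + `|b|) * (pi / 2) * x) (fun=> (n%:R + `|b|) * (pi / 2))) => //.
- move=> x _; apply: der_val; split.
    apply: der_mul; first by apply: der_exp; exact: der_idl.
    by apply: der_compl; [apply: der_mul; [exact: der_cstl|exact: der_idl]|exact: bes_deriv].
  by rewrite /D /=; ring.
- by move=> x _; apply: der_val; split; [isd|rewrite /=; ring].
move=> x /andP[x0 x1]; have x01 : 0 <= x <= 1 by rewrite (le_trans s'0)//= (le_trans x1).
have xk k : `|x ^+ k| <= 1.
  by case/andP: x01 => u0 u1; rewrite normrX ger0_norm// exprn_ile1.
rewrite /D; apply: le_trans (ler_normD _ _) _; rewrite mulrDl; apply: lerD.
  rewrite -mulrA normrM ger0_norm// ler_wpM2l// normrM -[leRHS]mul1r ler_pM// ?bes_le//.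
rewrite normrM normrM normrN mulrA [leRHS]mulrC ler_wpM2r// -[leRHS]mul1r ler_pM// ?besd_le//.
Qed.

(** Induction on the dimension by [lattice_step], with [bes_rot] to recognise the integral over the
    slices. The error has to be explicit in [nrm eta], because the frequencies grow with N. *)
Lemma lattice_bes d : exists kap C : R, [/\ 0 < kap, 0 <= C &
  forall m (eta : 'I_d.+1 -> R) (L T : R), 1 <= L -> L <= m%:R -> T <= L ^+ 2 ->
  `|cos_sum m eta L T - kap * ((Num.sqrt T / L) ^+ d.+1 * bes d.+1 (nrm eta * (Num.sqrt T / L)))|
     <= C * (1 + nrm eta) / L /\
  `|sin_sum m eta L T| <= C * (1 + nrm eta) / L].
Proof.
elim: d => [|d [kap [C [kap0 C0 IH]]]].
  exists 2, 3; split=> // m eta L T L1 Lm TL2.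
  have L0 : 0 < L := lt_le_trans ltr01 L1.
  have [| |||h1 h2] := @lattice_step 0 m eta L T (fun=> 1) 1 0 0 L1 Lm TL2 (@cst_continuous _ _ _).
  - by move=> s _; rewrite normr1.
  - by move=> s s' _ _; rewrite subrr normr0 mul0r.
  - by [].
  - move=> T' T'0 _.
    have e (f : {ffun 'I_0 -> 'I_m.*2}) : sqn f < T' by rewrite /sqn big_ord0.
    have d0 (f : {ffun 'I_0 -> 'I_m.*2}) : dotn (tail eta) f / L = 0 by rewrite /dotn big_ord0 mul0r.
    rewrite /cos_sum /sin_sum expr0 invr1 !mul1r.
    rewrite (eq_bigl xpredT)// (eq_bigr (fun=> 1)) => [|f _]; last by rewrite d0 cos0.
    rewrite [X in _ /\ `|X| <= _]big1 => [|f _]; last by rewrite d0 sin0.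
    by rewrite sumr_const card_ffun !card_ord expn0 subrr normr0.
  have n0 : `|eta ord0| = nrm eta.
    by rewrite /nrm big_ord1 sqrtr_sqr.
  rewrite mulr0 add0r in h1; rewrite mulr0 in h2; split; last first.
    apply: le_trans h2 _; rewrite divr_ge0 ?(ltW L0)// mulr_ge0// addr_ge0// nrm_ge0//.
  move: h1; set rho := Num.sqrt T / L => h1.
  rewrite (_ : 2 * (rho ^+ 1 * bes 1 (nrm eta * rho)) =
    2 * (rho * qint (fun t => cos (eta ord0 * (rho * cos t)) * 1 * sin t))).
    apply: le_trans h1 _; rewrite ler_wpM2r ?invr_ge0 ?(ltW L0)// n0.
    have := nrm_ge0 eta; lra.
  rewrite expr1 -n0 (_ : bes 1 _ = bes 1 (eta ord0 * rho)).
    rewrite [qint _](_ : _ = bes 1 (eta ord0 * rho))//.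
    by apply: qint_eq => t; rewrite mulr1 expr1 mulrA.
  by have [h|h] := leP 0 (eta ord0); [rewrite ger0_norm|rewrite ltr0_norm// mulNr besN].
have b0 := bes0_gt0 (R := R) d.+1.
(* In the new [kap], 2 counts the two signs of the slicing coordinate and [bes d.+1 0] comes from
   [bes_rot]. *)
exists (2 * kap * bes d.+1 0), (10 * C + kap * (pi / 2) * (5 + 2 * d.+1%:R) + kap * pi).
have pi0 := @pi_gt0 R; have kp : 0 < kap * (pi / 2) by rewrite !mulr_gt0// divr_gt0.
split.
- by rewrite !mulr_gt0.
- by rewrite !addr_ge0// ?mulr_ge0// ltW.
move=> m eta L T L1 Lm TL2; have L0 : 0 < L := lt_le_trans ltr01 L1.
pose b := nrm (tail eta).
pose G s := kap * (s ^+ d.+1 * bes d.+1 (b * s)).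
pose K0 := kap * (pi / 2); pose K1 := kap * ((d.+1%:R + b) * (pi / 2)).
pose E := C * (1 + b) / L.
have bge0 : 0 <= b := nrm_ge0 _.
have cG : continuous G.
  apply: derivable_cont => x; eexists; apply: der_mul; first exact: der_cstl.
  apply: der_mul; first by apply: der_exp; exact: der_idl.
  by apply: der_compl; [apply: der_mul; [exact: der_cstl|exact: der_idl]|exact: bes_deriv].
have [| |||h1 h2] := @lattice_step d.+1 m eta L T G K0 K1 E L1 Lm TL2 cG.
- move=> s /andP[s0 s1]; rewrite /G /K0 normrM (gtr0_norm kap0) ler_wpM2l ?(ltW kap0)//.
  by rewrite normrM -[leRHS]mul1r ler_pM// ?bes_le// normrX ger0_norm// exprn_ile1.
- move=> s s' hs hs'; rewrite /G /K1 -mulrBr normrM (gtr0_norm kap0) -mulrA ler_wpM2l ?(ltW kap0)//.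
  by apply: le_trans (bes_lipschitz _ _ hs hs') _; rewrite (ger0_norm bge0).
- by rewrite /E divr_ge0 ?(ltW L0)// mulr_ge0// addr_ge0.
- by move=> T' T'0 T'L; exact: IH.
have bn : b <= nrm eta := nrm_tail_le eta.
have an : `|eta ord0| <= nrm eta := nrm_head_le eta.
have n0 := nrm_ge0 eta.
have CL : 10 * E <= 10 * C * (1 + nrm eta) / L.
  rewrite /E !mulrA ler_wpM2r ?invr_ge0 ?(ltW L0)// ler_wpM2l ?mulr_ge0//; lra.
split; last first.
  apply: le_trans h2 (le_trans CL _); rewrite ler_wpM2r ?invr_ge0 ?(ltW L0)//.
  rewrite ler_wpM2r ?addr_ge0// -addrA lerDl addr_ge0 ?mulr_ge0 ?(ltW kap0) ?(ltW pi0)//.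
move: h1; set rho := Num.sqrt T / L => h1.
rewrite (_ : _ * bes d.+1 0 * _ =
    2 * (rho * qint (fun t => cos (eta ord0 * (rho * cos t)) * G (rho * sin t) * sin t))).
  apply: le_trans h1 _; apply: le_trans (lerD CL (lexx _)) _.
  rewrite -mulrDl ler_wpM2r ?invr_ge0 ?(ltW L0)//.
  rewrite /K1 /K0 (_ : kap * ((d.+1%:R + b) * (pi / 2)) = kap * (pi / 2) * (d.+1%:R + b)); last by ring.
  have -> : kap * pi = 2 * (kap * (pi / 2)) by field.
  set k := kap * (pi / 2) in kp *.
  have dn : 0 <= d.+1%:R :> R by [].
  have k1 : k * `|eta ord0| <= k * nrm eta by rewrite ler_wpM2l// ltW.
  have k2 : k * b <= k * nrm eta by rewrite ler_wpM2l// ltW.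
  have k3 : 0 <= k * nrm eta by rewrite mulr_ge0// ltW.
  have k4 : 0 <= k * d.+1%:R * nrm eta by rewrite !mulr_ge0// ltW.
  have k5 : 0 <= k * d.+1%:R by rewrite !mulr_ge0// ltW.
  have := @mulrDr R k d.+1%:R b; move: (d.+1%:R : R) dn k4 k5 => D dn k4 k5 kD.
  by rewrite kD !(mulrDr, mulrDl); lra.
have := @bes_rot R d.+1 (eta ord0 * rho) (b * rho) .
have -> : (eta ord0 * rho) ^+ 2 + (b * rho) ^+ 2 = (nrm eta * rho) ^+ 2.
  by rewrite [RHS]exprMn nrm_recl -/b; ring.
rewrite sqrtr_sqr ger0_norm; last first.
  by rewrite mulr_ge0// divr_ge0 ?sqrtr_ge0 ?(ltW L0).
move=> hr.
transitivity (2 * (rho * (kap * rho ^+ d.+1 * (bes d.+1 0 * bes d.+2 (nrm eta * rho))))).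
  by rewrite exprS; ring.
rewrite -hr -qintZ; last first.
  apply: continuous_mul; last by conts.
  apply: continuous_mul; first by conts.
  apply: continuous_compl; last by conts.
  by apply: deriv_cont; exact: bes_deriv.
congr (2 * (rho * _)); apply: qint_eq => t; clear h1 hr; move: rho => r.
rewrite /G [in RHS]exprMn -!(mulrA _ r) (exprS (sin t) d.+1).
by move: (bes d.+1 _) (cos _) (sin t ^+ d.+1) (r ^+ d.+1) => B c S P; ring.
Qed.

End LatticeBessel.

Section LatticeLower.
Context {R : realType}.
Implicit Types (d m : nat).

Lemma nrmZ d (k : R) (eta : 'I_d -> R) : 0 <= k -> nrm (fun i => k * eta i) = k * nrm eta.
Proof.
move=> k0; rewrite /nrm (eq_bigr (fun i => k ^+ 2 * eta i ^+ 2)); last by move=> i _; rewrite exprMn.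
by rewrite -mulr_sumr sqrtrM ?sqr_ge0// sqrtr_sqr ger0_norm.
Qed.

Lemma sqr_half_le (x y e : R) : `|x - y| <= e -> y ^+ 2 / 2 - e ^+ 2 <= x ^+ 2.
Proof.
move=> xy; have h : (x - y) ^+ 2 <= e ^+ 2.
  rewrite -real_normK ?num_real// lerXn2r ?nnegrE// (le_trans _ xy)//.
have := sqr_ge0 (2 * x - y); rewrite !expr2 in h *; lra.
Qed.

(** The vectors [eta] at scale [L] and [2 * eta] at scale [2 * L] stand for one frequency seen by
    the radii r and 2r; [bes_lower] applies at x = [nrm eta]. *)
Lemma lattice_lower d : (2 <= d)%N -> (d %% 4 != 1)%N ->
  exists c K C : R, [/\ 0 < c, 1 <= K, 0 < C &
  forall m (eta : 'I_d -> R) (L : R), 1 <= L -> 2 * L <= m%:R -> K <= nrm eta ->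
  c / nrm eta ^+ d.+1 - C * (nrm eta / L) ^+ 2 <=
  cos_sum m eta L (L ^+ 2) ^+ 2 +
  cos_sum m (fun i => 2 * eta i) (2 * L) ((2 * L) ^+ 2) ^+ 2].
Proof.
case: d => // d d2 d4; have [kap [C [kap0 C0 H]]] := @lattice_bes R d.
have [c [K [c0 K0 B]]] := @bes_lower R d.+1 d2 d4.
(* [K + 1] ensures [nrm eta] >= 1, so that 1 + nrm eta <= 2 nrm eta and each error is at most 2 C
   nrm eta / L; the two squares add up to 8 C^2, and the 1 keeps the constant positive. *)
exists (c * kap ^+ 2 / 2), (K + 1), (8 * C ^+ 2 + 1); split.
- by rewrite divr_gt0// mulr_gt0// exprn_gt0.
- lra.
- by rewrite ltr_wpDl// mulr_ge0// sqr_ge0.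
move=> m eta L L1 Lm Kn; have L0 : 0 < L := lt_le_trans ltr01 L1.
have n1 : 1 <= nrm eta by lra.
have n0 : 0 < nrm eta by lra.
have sL (l : R) : 0 < l -> Num.sqrt (l ^+ 2) / l = 1.
  by move=> l0; rewrite sqrtr_sqr gtr0_norm// divff// gt_eqF.
have L1' : L <= m%:R by apply: le_trans Lm; lra.
have L2 : 1 <= 2 * L by lra.
have [h1 _] := H m eta L (L ^+ 2) L1 L1' (lexx _).
have [h2 _] := H m (fun i => 2 * eta i) (2 * L) ((2 * L) ^+ 2) L2 Lm (lexx _).
rewrite sL// expr1n mul1r mulr1 in h1.
rewrite sL ?mulr_gt0// expr1n mul1r mulr1 nrmZ// in h2.
set e := 2 * C * (nrm eta / L).
have {}h1 : `|cos_sum m eta L (L ^+ 2) - kap * bes d.+1 (nrm eta)| <= e.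
  apply: le_trans h1 _; rewrite /e mulrA ler_wpM2r ?invr_ge0 ?(ltW L0)//.
  by rewrite [2 * C]mulrC -mulrA ler_wpM2l//; lra.
have {}h2 : `|cos_sum m (fun i => 2 * eta i) (2 * L) ((2 * L) ^+ 2) - kap * bes d.+1 (2 * nrm eta)| <= e.
  apply: le_trans h2 _; rewrite /e invfM (mulrA _ 2^-1) mulrA ler_wpM2r ?invr_ge0 ?(ltW L0)//.
  by rewrite [2 * C]mulrC -!mulrA ler_wpM2l//; lra.
have := lerD (sqr_half_le h1) (sqr_half_le h2).
have kM y : (kap * y) ^+ 2 = kap ^+ 2 * y ^+ 2 by rewrite exprMn.
apply: le_trans; rewrite !kM.
have Kn' : K <= nrm eta by lra.
have := B _ Kn'; set b1 := bes _ _ ^+ 2; set b2 := bes _ _ ^+ 2 => hb.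
have hb' : c / nrm eta ^+ d.+2 <= b1 + b2.
  by rewrite ler_pdivrMr ?exprn_gt0// mulrC.
have : c * kap ^+ 2 / 2 / nrm eta ^+ d.+2 <= (kap ^+ 2 * b1 + kap ^+ 2 * b2) / 2.
  rewrite -mulrDr mulrAC ler_wpM2r// mulrAC mulrC ler_wpM2l// sqr_ge0//.
rewrite (_ : e ^+ 2 = 4 * C ^+ 2 * (nrm eta / L) ^+ 2); last by rewrite /e; ring.
have := sqr_ge0 (nrm eta / L); have := sqr_ge0 C.
set q := (nrm eta / L) ^+ 2; move: (C ^+ 2) => C2 C20 q0.
have : 0 <= C2 * q by rewrite mulr_ge0.
have -> : (8 * C2 + 1) * q = 8 * (C2 * q) + q by ring.
rewrite -!(mulrA 4 C2); lra.
Qed.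

(** At frequency zero the cosine sum counts lattice points, and [V] is the volume of the unit ball
    in dimension [d.+1]. *)
Lemma sqn_count d : exists V C : R, [/\ 0 <= V, 0 <= C &
  forall m (l : R), 1 <= l -> l <= m%:R ->
  `|(\sum_(f : {ffun 'I_d.+1 -> 'I_m.*2} | sqn f < l ^+ 2) 1) - V * l ^+ d.+1| <= C * l ^+ d].
Proof.
have [kap [C [kap0 C0 H]]] := @lattice_bes R d.
exists (kap * bes d.+1 0), C; split=> //; first by rewrite mulr_ge0 ?ltW// bes0_gt0.
move=> m l l1 lm; have l0 : 0 < l := lt_le_trans ltr01 l1.
have [h _] := H m (fun=> 0) l (l ^+ 2) l1 lm (lexx _).
rewrite sqrtr_sqr (gtr0_norm l0) divff ?gt_eqF// expr1n mul1r mulr1 in h.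
rewrite (_ : nrm _ = 0) ?addr0 ?mulr1 in h; last first.
  by rewrite /nrm big1 ?sqrtr0// => i _; rewrite expr0n.
rewrite /cos_sum in h.
rewrite (eq_bigr (fun=> 1)) in h; last first.
  by move=> f _; rewrite /dotn big1 ?mul0r ?cos0// => i _; rewrite mul0r.
have := ler_wpM2l (exprn_ge0 d.+1 (ltW l0)) h.
rewrite -{1}(ger0_norm (exprn_ge0 d.+1 (ltW l0))) -normrM mulrBr mulrA divff ?expf_neq0 ?gt_eqF// mul1r.
rewrite [l ^+ d.+1 * (kap * _)]mulrC => /le_trans; apply.
by rewrite exprSr mulrCA -mulrA divff ?gt_eqF// mulr1.
Qed.

Lemma ctr_widen m m' (mm : (m <= m')%N) (i : 'I_m.*2) :
  exists j : 'I_m'.*2, (j : nat) = (i + (m' - m))%N.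
Proof.
have h : (i + (m' - m) < m'.*2)%N by have := ltn_ord i; lia.
by exists (Ordinal h).
Qed.

Lemma sum_widen d m m' (P : pred R) : (m <= m')%N ->
  \sum_(f : {ffun 'I_d -> 'I_m.*2} | P (sqn f)) 1 <=
  \sum_(f : {ffun 'I_d -> 'I_m'.*2} | P (sqn f)) 1 :> R.
Proof.
move=> mm; rewrite !sumr_const ler_nat.
pose w (i : 'I_m.*2) := projT1 (cid (ctr_widen mm i)).
have wE i : (w i : nat) = (i + (m' - m))%N := projT2 (cid (ctr_widen mm i)).
have wc i : ctr (w i) = ctr i :> R by rewrite /ctr wE; congr (_%:~R); lia.
pose W (f : {ffun 'I_d -> 'I_m.*2}) : {ffun 'I_d -> 'I_m'.*2} := [ffun i => w (f i)].
have Winj : injective W.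
  move=> f g /ffunP fg; apply/ffunP => i; have := fg i; rewrite !ffunE => /(congr1 (@nat_of_ord _)).
  by rewrite !wE => /addIn /val_inj.
rewrite -(fintype.card_image Winj); apply: subset_leq_card; apply/fintype.subsetP => g /fintype.imageP[f Pf ->].
move: Pf; rewrite !unfold_in /= => Pf.
by rewrite (_ : sqn (W f) = sqn f)//; apply: eq_bigr => i _; rewrite ffunE wc.
Qed.

(** Difference of two ball counts: the volumes differ by O(L^d), which is also the size of the error
    in [sqn_count]. *)
Lemma annulus_card d (c : R) : 0 <= c -> exists2 A : R, 0 <= A &
  forall m (L : R), 1 <= L ->
  \sum_(f : {ffun 'I_d.+1 -> 'I_m.*2} | L - c <= Num.sqrt (sqn f) < L + c) 1 <= A * L ^+ d.
Proof.
move=> c0; have [V [C [V0 C0 H]]] := sqn_count d.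
have D0 : 0 <= (1 + c) ^+ d by rewrite exprn_ge0// addr_ge0.
have V1 : 0 <= V * (1 + 2 * c) by rewrite mulr_ge0// addr_ge0// mulr_ge0.
have V2 : 0 <= V * (2 * c * d.+1%:R) by rewrite !mulr_ge0.
exists ((V * (1 + 2 * c) + 2 * C + V * (2 * c * d.+1%:R)) * (1 + c) ^+ d).
  by rewrite mulr_ge0// !addr_ge0// mulr_ge0.
move=> m L L1; have L0 : 0 < L := lt_le_trans ltr01 L1.
(* The outer ball may leave the box of half-side [m]; counting in a larger box only increases the
   number of points and makes [sqn_count] applicable. *)
pose m' := (m + Num.bound (L + c))%N.
have Lm' : L + c <= m'%:R.
  by rewrite natrD ler_wpDl// ltW// archi_boundP// addr_ge0// ltW.
have Ld0 : 0 <= L ^+ d by rewrite exprn_ge0// ltW.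
have Lc1 : 1 <= L + c by lra.
have Lp0 : 0 <= L + c by lra.
have LcL : (L + c) ^+ d <= (1 + c) ^+ d * L ^+ d.
  rewrite -exprMn lerXn2r ?nnegrE ?mulr_ge0 ?addr_ge0 ?(ltW L0)//.
  by rewrite mulrDl mul1r lerD2l ler_peMr.
apply: le_trans (@sum_widen d.+1 m m' (fun s => L - c <= Num.sqrt s < L + c) (leq_addr _ _)) _.
have sq (s l : R) : 0 <= s -> 0 <= l -> (Num.sqrt s < l) = (s < l ^+ 2).
  move=> s0 l0; rewrite -[in RHS](sqr_sqrtr s0) ltr_pXn2r// ?nnegrE ?sqrtr_ge0//.
have up := H m' _ Lc1 Lm'.
set N1 := \sum_(_ | _) _ in up; have {}up : N1 <= V * (L + c) ^+ d.+1 + C * (L + c) ^+ d.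
  by move: up; rewrite ler_norml => /andP[_]; lra.
(* When the inner radius is below 1, L + c < 1 + 2c, and the outer ball alone is small enough. *)
have [Lc|Lc] := leP 1 (L - c); last first.
  apply: le_trans (_ : N1 <= _).
    rewrite /N1 big_mkcond [leRHS]big_mkcond; apply: ler_sum => f _.
    case: ifP => [/andP[_]|_]; last by case: ifP.
    by rewrite sq ?sqn_ge0 ?addr_ge0 ?(ltW L0)// => ->.
  apply: le_trans up _; rewrite exprS mulrA -mulrDl -mulrA.
  apply: ler_pM => //; [by rewrite addr_ge0// mulr_ge0|by rewrite exprn_ge0|].
  apply: le_trans (_ : V * (1 + 2 * c) + C <= _); last lra.
  by rewrite lerD2r ler_wpM2l//; lra.
have Lm'' : L - c <= m'%:R by apply: le_trans Lm'; lra.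
have lo := H m' _ Lc Lm''.
have {lo} : V * (L - c) ^+ d.+1 - C * (L + c) ^+ d <=
    \sum_(f : {ffun 'I_d.+1 -> 'I_m'.*2} | sqn f < (L - c) ^+ 2) 1.
  move: lo; rewrite ler_norml => /andP[h _].
  have : C * (L - c) ^+ d <= C * (L + c) ^+ d.
    by rewrite ler_wpM2l// lerXn2r ?nnegrE//; lra.
  lra.
set N2 := \sum_(_ | _) _ => lo.
have split : \sum_(f : {ffun 'I_d.+1 -> 'I_m'.*2} | L - c <= Num.sqrt (sqn f) < L + c) 1 = N1 - N2 :> R.
  rewrite /N1 /N2 big_mkcond [X in _ = X - _]big_mkcond [X in _ = _ - X]big_mkcond -sumrB.
  apply: eq_bigr => f _; rewrite -!sq ?sqn_ge0 ?(le_trans ler01)// leNgt.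
  have [h1|h1] := ltP (Num.sqrt (sqn f)) (L - c); last by rewrite andTb subr0.
  by rewrite (lt_le_trans h1) /= ?subrr//; lra.
rewrite split -mulrA.
have pw : (L + c) ^+ d.+1 - (L - c) ^+ d.+1 <= 2 * c * d.+1%:R * (L + c) ^+ d.
  rewrite subrXX (_ : L + c - (L - c) = 2 * c); last by ring.
  rewrite -!mulrA ler_wpM2l// ler_wpM2l// mulr_natl -[d.+1 in leRHS]card_ord -sumr_const.
  apply: ler_sum => i _.
  have hi : d = (d - i + i)%N by rewrite subnK// -ltnS.
  rewrite /= [leRHS](_ : _ = (L + c) ^+ (d - i) * (L + c) ^+ i); last by rewrite -exprD -hi.
  by rewrite ler_wpM2l ?exprn_ge0// lerXn2r ?nnegrE//; lra.
have := ler_wpM2l V0 pw; rewrite mulrBr mulrA => pwV.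
apply: le_trans (_ : (2 * C + V * (2 * c * d.+1%:R)) * (L + c) ^+ d <= _).
  by rewrite mulrDl; lra.
rewrite -[leRHS]mulrA; apply: ler_pM => //; [by rewrite addr_ge0// mulr_ge0|by rewrite exprn_ge0|].
by rewrite -addrA lerDr.
Qed.

End LatticeLower.

(** * Discrete Fourier analysis of the discrepancy *)

Section FiniteFourier.
Context {R : realType}.
Implicit Types (d m : nat).

Definition cz m (i : 'I_m.*2) : int := i%:Z - m%:Z.

Definition ip d (h x : 'I_d -> int) : int := \sum_i h i * x i.

Definition ang d m (h x : 'I_d -> int) : R := 2 * pi * ((ip h x)%:~R / (m.*2)%:R).

Lemma cos_addn (x : R) (n : nat) : cos (x + 2 * pi * n%:R) = cos x.
Proof.
elim: n => [|n IH]; first by rewrite mulr0 addr0.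
rewrite (_ : x + 2 * pi * n.+1%:R = x + 2 * pi * n%:R + pi *+ 2) ?cosD2pi//.
by rewrite -[in LHS]natr1 mulr2n; ring.
Qed.

Lemma cos_addz (x : R) (z : int) : cos (x + 2 * pi * z%:~R) = cos x.
Proof.
case: z => n; first exact: cos_addn.
by rewrite NegzE mulrNz mulrN -[LHS](cos_addn _ n.+1) subrK.
Qed.

Lemma cos_lt1 (x : R) : 0 < x < 2 * pi -> cos x < 1.
Proof.
move=> /andP[x0 x1]; rewrite (_ : x = (x / 2) *+ 2) ?cos_mulr2n; last by rewrite mulr2n; field.
have s0 : 0 < sin (x / 2) by apply: sin_gt0_pi; apply/andP; split; lra.
rewrite cos2sin2; have := exprn_gt0 2 s0; rewrite mulr2n; lra.
Qed.

Lemma ipDr d (h x y : 'I_d -> int) : ip h (fun i => x i + y i) = ip h x + ip h y.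
Proof. by rewrite /ip -big_split; apply: eq_bigr => i _; rewrite mulrDr. Qed.

Lemma ipC d (h x : 'I_d -> int) : ip h x = ip x h.
Proof. by apply: eq_bigr => i _; rewrite mulrC. Qed.

Lemma angC d m (h x : 'I_d -> int) : ang m h x = ang m x h.
Proof. by rewrite /ang ipC. Qed.

Lemma angDr d m (h x y : 'I_d -> int) :
  ang m h (fun i => x i + y i) = ang m h x + ang m h y.
Proof. by rewrite /ang ipDr intrD; ring. Qed.

Lemma angNr d m (h x : 'I_d -> int) : ang m h (fun i => - x i) = - ang m h x.
Proof.
rewrite /ang /ip (eq_bigr (fun i => - (h i * x i))); last by move=> i _; rewrite mulrN.
by rewrite sumrN mulrNz mulNr mulrN.
Qed.

Lemma angBr d m (h x y : 'I_d -> int) :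
  ang m h (fun i => x i - y i) = ang m h x - ang m h y.
Proof. by rewrite -angNr -angDr. Qed.

Lemma angBl d m (h k x : 'I_d -> int) :
  ang m (fun i => h i - k i) x = ang m h x - ang m k x.
Proof. by rewrite angC angBr !(angC _ x). Qed.

Definition periodic_vec d m (G : ('I_d -> int) -> R) :=
  forall x t : 'I_d -> int, G (fun i => x i + t i * (m.*2)%:Z) = G x.

Lemma periodic_cos d m (h : 'I_d -> int) phi : (0 < m)%N ->
  periodic_vec m (fun x => cos (ang m h x + phi)).
Proof.
move=> m0 x t; rewrite angDr.
have -> : ang m h (fun i => t i * (m.*2)%:Z) = 2 * pi * (ip h t)%:~R.
  rewrite /ang /ip (eq_bigr (fun i => (h i * t i) * (m.*2)%:Z)); last by move=> i _; rewrite mulrA.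
  by rewrite -mulr_suml intrM mulfK// pnatr_eq0 double_eq0 -lt0n.
by rewrite addrAC cos_addz.
Qed.

Lemma shift_exists m (j : 'I_m.*2) (q : int) :
  exists i : 'I_m.*2, exists t : int, cz i = cz j + q + t * (m.*2)%:Z.
Proof.
have M0 : (0 < m.*2)%N by case: m j => [[]|].
pose z : int := ((j%:Z + q) %% (m.*2)%:Z)%Z.
have M0' : (m.*2)%:Z != 0 by rewrite eqz_nat -lt0n.
have z0 : 0 <= z by exact: modz_ge0.
have zM : z < (m.*2)%:Z by apply: ltz_pmod; rewrite ltz_nat.
have ab : (`|z|%N < m.*2)%N by rewrite -ltz_nat gez0_abs.
exists (Ordinal ab), (- ((j%:Z + q) %/ (m.*2)%:Z)%Z).
rewrite /cz /= gez0_abs// /z; have := divz_eq (j%:Z + q) (m.*2)%:Z; lia.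
Qed.

(** Reduction of the shifted coordinates modulo 2m into the centred range permutes the index set,
    and [G] does not see it. *)
Lemma shift_sum d m (G : ('I_d -> int) -> R) (q : 'I_d -> int) : periodic_vec m G ->
  \sum_(f : {ffun 'I_d -> 'I_m.*2}) G (fun i => cz (f i) + q i) =
  \sum_(f : {ffun 'I_d -> 'I_m.*2}) G (fun i => cz (f i)).
Proof.
move=> pG.
pose s (j : 'I_m.*2) (q : int) := projT1 (cid (shift_exists j q)).
have sE j p : exists t : int, cz (s j p) = cz j + p + t * (m.*2)%:Z.
  exact: projT2 (cid (shift_exists j p)).
pose W (f : {ffun 'I_d -> 'I_m.*2}) : {ffun 'I_d -> 'I_m.*2} := [ffun i => s (f i) (q i)].
have Winj : injective W.
  move=> f g /ffunP fg; apply/ffunP => i; have := fg i; rewrite !ffunE => e.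
  have [t1 h1] := sE (f i) (q i); have [t2 h2] := sE (g i) (q i).
  rewrite e h2 /cz in h1; apply/ord_inj.
  have := ltn_ord (f i); have := ltn_ord (g i); move=> u1 u2.
  have [t ht] : exists t : int, (g i : nat)%:Z - (f i : nat)%:Z = t * (m.*2)%:Z.
    by exists (t1 - t2); rewrite mulrBl; lia.
  have t0 : t = 0 by nia.
  by rewrite t0 mul0r in ht; move/eqP: ht; rewrite subr_eq0 eqz_nat => /eqP ->.
rewrite [RHS](reindex_inj Winj); apply: eq_bigr => f _.
pose t i := projT1 (cid (sE (f i) (q i))).
have tE i : cz (s (f i) (q i)) = cz (f i) + q i + t i * (m.*2)%:Z := projT2 (cid (sE (f i) (q i))).
rewrite -(pG _ t); congr G; apply/funext => i; by rewrite /W ffunE tE.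
Qed.

(** Orthogonality of characters in real form. A unit shift along coordinate i shows that the sum C
    satisfies C(phi) = C(phi + v) = C(phi - v), while C(phi + v) + C(phi - v) = 2 cos(v) C(phi); as
    cos v < 1, C vanishes. The free phase covers sines as well. *)
Lemma cos_sum_eq0 d m (h : 'I_d -> int) phi : (0 < m)%N ->
  (exists i, ~~ ((m.*2)%:Z %| h i)%Z) ->
  \sum_(f : {ffun 'I_d -> 'I_m.*2}) cos (ang m h (fun i => cz (f i)) + phi) = 0.
Proof.
move=> m0 [i hi].
have Mn0 : (m.*2)%:R != 0 :> R by rewrite pnatr_eq0 double_eq0 -lt0n.
pose C phi : R := \sum_(f : {ffun 'I_d -> 'I_m.*2}) cos (ang m h (fun i => cz (f i)) + phi).
rewrite -/(C phi).
pose e (k : 'I_d) : int := (k == i)%:Z.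
pose v := ang m h e.
have vE : v = 2 * pi * ((h i)%:~R / (m.*2)%:R).
  rewrite /v /ang /ip (bigD1 i)//= /e eqxx mulr1 big1 ?addr0// => k /negPf ->.
  by rewrite mulr0.
have Cv p : C p = C (p + v).
  rewrite /C -(shift_sum e (periodic_cos h p m0)); apply: eq_bigr => f _.
  by rewrite angDr -/v; congr cos; ring.
have C2 : C (phi + v) + C (phi - v) = 2 * cos v * C phi.
  rewrite /C -big_split mulr_sumr; apply: eq_bigr => f _ /=.
  rewrite (_ : _ + (phi + v) = (ang m h (fun k => cz (f k)) + phi) + v); last by ring.
  rewrite (_ : _ + (phi - v) = (ang m h (fun k => cz (f k)) + phi) - v); last by ring.
  by rewrite cosB cosD; ring.
have Cm : C (phi - v) = C phi by rewrite Cv subrK.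
rewrite -Cv Cm in C2.
have v1 : cos v < 1.
  pose z := (h i %% (m.*2)%:Z)%Z.
  have M0' : (m.*2)%:Z != 0 by rewrite eqz_nat double_eq0 -lt0n.
  have z0 : 0 < z.
    by rewrite lt_def modz_ge0// andbT; apply: contra hi => /eqP/dvdz_mod0P.
  have zM : z < (m.*2)%:Z by apply: ltz_pmod; rewrite ltz_nat double_gt0.
  have -> : v = 2 * pi * (z%:~R / (m.*2)%:R) + 2 * pi * ((h i %/ (m.*2)%:Z)%Z)%:~R.
    rewrite vE {1}(divz_eq (h i) (m.*2)%:Z) intrD intrM -/z; field.
    exact: Mn0.
  rewrite cos_addz; apply: cos_lt1.
  have pi2 : 0 < 2 * pi :> R by rewrite mulr_gt0 ?pi_gt0.
  rewrite mulr_gt0 ?divr_gt0 ?ltr0z ?ltr0n ?double_gt0//= gtr_pMr//.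
  rewrite ltr_pdivrMr ?ltr0n ?double_gt0// mul1r.
  by rewrite -[(m.*2)%:R]/((m.*2)%:Z%:~R : R) ltr_int.
nra.
Qed.

Lemma nsq_sum (I : finType) (P : pred I) (F t : I -> R) :
  (\sum_(a | P a) F a * cos (t a)) ^+ 2 + (\sum_(a | P a) F a * sin (t a)) ^+ 2 =
  \sum_(a | P a) \sum_(b | P b) F a * F b * cos (t a - t b).
Proof.
rewrite !expr2 !big_distrlr/= -big_split; apply: eq_bigr => a _ /=.
by rewrite -big_split; apply: eq_bigr => b _ /=; rewrite cosB; ring.
Qed.

Definition fz d n (k : {ffun 'I_d -> 'I_n}) : 'I_d -> int := fun i => (k i)%:Z.

Definition inbox d n X (k : {ffun 'I_d -> 'I_n}) := [forall i, (k i < X)%N].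

(** Over all k this is Parseval's identity: after exchanging sums, distinct f and g differ by a
    vector not divisible by 2m, and their cross term vanishes. The translation by [l] is absorbed in
    the phase of [cos_sum_eq0]. *)
Lemma bessel d m (F : {ffun 'I_d -> 'I_m.*2} -> R) (l : 'I_d -> int)
    (P : pred {ffun 'I_d -> 'I_m.*2}) : (0 < m)%N ->
  \sum_(k : {ffun 'I_d -> 'I_m.*2} | P k)
    ((\sum_f F f * cos (ang m (fun i => fz k i - l i) (fun i => cz (f i)))) ^+ 2 +
     (\sum_f F f * sin (ang m (fun i => fz k i - l i) (fun i => cz (f i)))) ^+ 2)
  <= (m.*2)%:R ^+ d * \sum_f F f ^+ 2.
Proof.
move=> m0.
apply: le_trans (_ : \sum_(k : {ffun 'I_d -> 'I_m.*2})
    ((\sum_f F f * cos (ang m (fun i => fz k i - l i) (fun i => cz (f i)))) ^+ 2 +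
     (\sum_f F f * sin (ang m (fun i => fz k i - l i) (fun i => cz (f i)))) ^+ 2) <= _).
  by rewrite big_mkcond ler_sum// => k _; case: ifP => // _; rewrite addr_ge0 ?sqr_ge0.
under eq_bigr do rewrite nsq_sum.
rewrite exchange_big mulr_sumr; apply: ler_sum => f _.
rewrite exchange_big (bigD1 f)//= [X in _ + X]big1 ?addr0.
  under eq_bigr do rewrite subrr cos0 mulr1 -expr2.
  by rewrite sumr_const card_ffun !card_ord -[leLHS]mulr_natl natrX.
move=> g gf.
under eq_bigr do rewrite -angBr.
rewrite -mulr_sumr; apply/eqP; rewrite mulf_eq0; apply/orP; right; apply/eqP.
pose dl (i : 'I_d) : int := cz (f i) - cz (g i).
pose q (i : 'I_d) : int := m%:Z - l i.
rewrite -[RHS](cos_sum_eq0 (h := dl) (ang m dl q) m0).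
  apply: eq_bigr => k _; rewrite -angDr angC; congr (cos (ang m _ _)).
  by apply/funext => i; rewrite /fz /cz /q; ring.
have [i fgi] : exists i, f i != g i.
  apply/existsP; rewrite -negb_forall; apply: contra gf => /forallP h.
  by apply/eqP/ffunP => i; apply/eqP; rewrite eq_sym.
exists i; apply/negP => /dvdzP[t ht]; move/eqP: fgi; apply; apply/ord_inj.
have := ltn_ord (f i); have := ltn_ord (g i); rewrite /dl /cz in ht => u1 u2.
have t0 : t = 0 by nia.
by rewrite t0 mul0r in ht; lia.
Qed.

(* Expanding the squares, the right-hand side is the sum over n and n' of
   |sum_k e(k.(Q n - Q n'))|^2, and the left-hand side is its diagonal part. *)
Lemma cassels d m N (P : pred {ffun 'I_d -> 'I_m.*2}) (Q : 'I_N -> 'I_d -> int) :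
  N%:R * #|P|%:R ^+ 2 <=
  \sum_(k | P k) \sum_(l | P l)
    ((\sum_n cos (ang m (fun i => fz k i - fz l i) (Q n))) ^+ 2 +
     (\sum_n sin (ang m (fun i => fz k i - fz l i) (Q n))) ^+ 2) :> R.
Proof.
have e k l : (\sum_n cos (ang m (fun i => fz k i - fz l i) (Q n))) ^+ 2 +
     (\sum_n sin (ang m (fun i => fz k i - fz l i) (Q n))) ^+ 2 =
   \sum_n \sum_n' cos (ang m (fz k) (fun i => Q n i - Q n' i) - ang m (fz l) (fun i => Q n i - Q n' i)) :> R.
  have := @nsq_sum _ xpredT (fun=> 1) (fun n => ang m (fun i => fz k i - fz l i) (Q n)).
  under eq_bigr do rewrite mul1r.
  under [in X in _ + X]eq_bigr do rewrite mul1r.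
  move=> ->; apply: eq_bigr => n _; apply: eq_bigr => n' _; rewrite !mul1r -angBr.
  by rewrite angBl.
under eq_bigr do under eq_bigr do rewrite e.
under eq_bigr do rewrite exchange_big.
rewrite exchange_big/= mulr_natl -[N in leLHS]card_ord -sumr_const.
apply: ler_sum => n _.
under eq_bigr do rewrite exchange_big.
rewrite exchange_big/= (bigD1 n)//= ler_wpDr//.
  apply: sumr_ge0 => n' _.
  have := @nsq_sum _ P (fun=> 1) (fun k => ang m (fz k) (fun i => Q n i - Q n' i)).
  under [in RHS]eq_bigr do under eq_bigr do rewrite !mul1r.
  by move=> <-; rewrite addr_ge0 ?sqr_ge0.
have z k : ang m (fz k) (fun i => Q n i - Q n i) = 0 :> R by rewrite angBr subrr.
under eq_bigr do under eq_bigr do rewrite !z subrr cos0.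
by rewrite !sumr_const -mulrnA natrM expr2.
Qed.

Lemma card_inbox d n X : (X <= n)%N -> #|@inbox d n X| = (X ^ d)%N.
Proof.
move=> Xn; rewrite (eq_card (B := mem (ffun_on [pred i : 'I_n | (i < X)%N]))).
  rewrite card_ffun_on card_ord; congr (_ ^ _)%N.
  rewrite -sum1_card (eq_bigl (fun i : 'I_n => (i < X)%N))// -(big_ord_widen _ (fun=> 1%N) Xn).
  by rewrite sum1_card card_ord.
by move=> k; rewrite [LHS]unfold_in /=; apply/forallP/ffun_onP.
Qed.

End FiniteFourier.

(** * Fourier coefficients of the discrepancy *)

Section DiscrepancyFourier.
Context {R : realType}.
Implicit Types (d m : nat).

(** Coordinatewise, (u + v)^2 <= (1 + 1/l) u^2 + (1 + l) v^2; the sum is below l^2 + l + (1 + l) d,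
    which fits under the enlarged square. *)
Lemma perturb_sqn d (u dl : 'I_d -> R) (l : R) : 0 < l ->
  (forall i, `|dl i| <= 1) -> \sum_i u i ^+ 2 < l ^+ 2 ->
  \sum_i (u i + dl i) ^+ 2 < (l + (1 + d%:R)) ^+ 2.
Proof.
move=> l0 d1 ul.
apply: le_lt_trans (_ : \sum_i ((1 + l^-1) * u i ^+ 2 + (1 + l)) < _).
  apply: ler_sum => i _.
  have li0 : 0 < l^-1 by rewrite invr_gt0.
  have h : dl i ^+ 2 <= 1.
    by rewrite -real_normK ?num_real// expr_le1.
  have ll : l^-1 * l = 1 by rewrite mulVf// gt_eqF.
  apply: le_trans (_ : (1 + l^-1) * u i ^+ 2 + (1 + l) * dl i ^+ 2 <= _).
    rewrite -subr_ge0 [leRHS](_ : _ = l^-1 * (u i - l * dl i) ^+ 2); first by rewrite mulr_ge0 ?sqr_ge0// ltW.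
    by field; rewrite gt_eqF.
  by rewrite lerD2l ler_piMr// addr_ge0// ltW.
rewrite big_split/= -mulr_sumr sumr_const card_ord -[X in _ + X < _]mulr_natl.
have : (1 + l^-1) * \sum_(i < d) u i ^+ 2 < (1 + l^-1) * l ^+ 2.
  by rewrite ltr_pM2l// addr_gt0// invr_gt0.
rewrite [ltRHS](_ : _ = l ^+ 2 + l); last by field; rewrite gt_eqF.
have := mulr_ge0 (ltW l0) (ler0n R d).
have := ler0n R d; move: (d%:R) (_ * \sum_(_ < _) _) => D S D0 lD Sl.
have D2 := sqr_ge0 D.
rewrite [ltRHS](_ : _ = l ^+ 2 + 2 * l + 2 * (l * D) + 1 + 2 * D + D ^+ 2); last by ring.
by rewrite mulrDr mulr1 [D * l]mulrC; lra.
Qed.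

(** Membership of the point [P] in the periodic ball centred at x / (2m), with the lattice vector
    made explicit so that the Fourier analysis takes place on integer vectors. *)
Definition hits d m (P : 'I_d -> R) (rho : R) (x : 'I_d -> int) : bool :=
  `[< exists z : 'I_d -> int,
       \sum_i (P i - (x i)%:~R / (m.*2)%:R - (z i)%:~R) ^+ 2 < rho ^+ 2 >].

Lemma hits_periodic d m (P : 'I_d -> R) rho x t : (0 < m)%N ->
  hits m P rho (fun i => x i + t i * (m.*2)%:Z) = hits m P rho x.
Proof.
move=> m0; have Mn0 : (m.*2)%:R != 0 :> R by rewrite pnatr_eq0 double_eq0 -lt0n.
apply/asboolP/asboolP => -[z hz].
  exists (fun i => z i + t i); move: hz; congr (_ < _); apply: eq_bigr => i _; congr (_ ^+ 2).
  by rewrite !intrD intrM -[(Posz m.*2)%:~R]/((m.*2)%:R : R); field.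
exists (fun i => z i - t i); move: hz; congr (_ < _); apply: eq_bigr => i _; congr (_ ^+ 2).
by rewrite intrB !intrD intrM -[(Posz m.*2)%:~R]/((m.*2)%:R : R); field.
Qed.

Lemma centered_min m (i : 'I_m.*2) (z : int) :
  (ctr i : R) ^+ 2 <= (ctr i + (m.*2)%:R * z%:~R) ^+ 2.
Proof.
have -> : ctr i + (m.*2)%:R * z%:~R = (cz i + (m.*2)%:Z * z)%:~R :> R by rewrite intrD intrM.
rewrite /ctr -/(cz i) -!rmorphXn ler_int.
have [c1 c2] : - m%:Z <= cz i /\ cz i <= m%:Z by have := ltn_ord i; rewrite /cz; lia.
move: (cz i) c1 c2 => c c1 c2; rewrite -subr_ge0 -muln2 PoszM.
rewrite [leRHS](_ : _ = (4 * m%:Z) * (z * (c + m%:Z * z))); last by ring.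
rewrite mulr_ge0//; have [z0|z0|->] := ltgtP z 0; last by rewrite mul0r.
  rewrite -mulrNN mulr_ge0 ?oppr_ge0 ?(ltW z0)//.
  have : m%:Z * z <= m%:Z * -1 by rewrite ler_wpM2l//; lia.
  lia.
rewrite mulr_ge0 ?(ltW z0)//.
have : m%:Z * 1 <= m%:Z * z by rewrite ler_wpM2l//; lia.
lia.
Qed.

(** With centres counted from [Q], the point sits at its fractional part [dl], and [perturb_sqn]
    compares the ball around [dl] with the one around 0. If the ball is hit through some lattice
    vector z, [centered_min] shows that z = 0 gives a norm at least as small. *)
Lemma hits_annulus d m (P : 'I_d -> R) (rho : R) (f : {ffun 'I_d -> 'I_m.*2}) :
  (0 < m)%N -> 0 < rho ->
  let L := (m.*2)%:R * rho in let Q i := Num.floor ((m.*2)%:R * P i) in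
  hits m P rho (fun i => cz (f i) + Q i) != (sqn f < L ^+ 2) ->
  L - (1 + d%:R) <= Num.sqrt (sqn f) < L + (1 + d%:R).
Proof.
move=> m0 rho0 L Q.
have M0 : 0 < (m.*2)%:R :> R by rewrite ltr0n double_gt0.
have L0 : 0 < L by rewrite mulr_gt0.
have c0 : 0 <= 1 + d%:R :> R by rewrite addr_ge0.
pose dl i := (m.*2)%:R * P i - (Q i)%:~R.
have dl1 i : `|dl i| <= 1.
  have h1 := floor_le ((m.*2)%:R * P i); have h2 := floorD1_gt ((m.*2)%:R * P i).
  rewrite intrD in h2; rewrite ler_norml /dl /Q; apply/andP; split; lra.
have sq (s l : R) : 0 <= s -> 0 <= l -> (Num.sqrt s < l) = (s < l ^+ 2).
  move=> s0 l0; rewrite -[in RHS](sqr_sqrtr s0) ltr_pXn2r// ?nnegrE ?sqrtr_ge0//.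
have zE z i : (m.*2)%:R ^+ 2 * (P i - (cz (f i) + Q i)%:~R / (m.*2)%:R - (z i)%:~R) ^+ 2 =
    (ctr (f i) + (m.*2)%:R * (z i)%:~R - dl i) ^+ 2.
  by rewrite -exprMn -sqrrN; congr (_ ^+ 2); rewrite /dl intrD /ctr /cz; field; rewrite gt_eqF.
have hitsE : hits m P rho (fun i => cz (f i) + Q i) <->
    exists z : 'I_d -> int, \sum_i (ctr (f i) + (m.*2)%:R * (z i)%:~R - dl i) ^+ 2 < L ^+ 2.
  split.
    move=> /asboolP[z hz]; exists z; under eq_bigr do rewrite -zE.
    by rewrite -mulr_sumr /L exprMn ltr_pM2l// exprn_gt0.
  move=> [z hz]; apply/asboolP; exists z; move: hz; under eq_bigr do rewrite -zE.
  by rewrite -mulr_sumr /L exprMn ltr_pM2l// exprn_gt0.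
have [b2|b2] := ltP (sqn f) (L ^+ 2); rewrite ?eqbF_neg ?eqb_id ?negbK => b1.
  have sL : Num.sqrt (sqn f) < L by rewrite sq ?sqn_ge0// ltW.
  rewrite (lt_le_trans sL) ?lerDl// andbT leNgt; apply: contra b1 => h; apply/hitsE; exists (fun=> 0).
  have Lc : 0 < L - (1 + d%:R) := le_lt_trans (sqrtr_ge0 _) h.
  rewrite sq ?sqn_ge0 ?(ltW Lc)// in h.
  have dN i : `|- dl i| <= 1 by rewrite normrN.
  have := perturb_sqn Lc dN h; rewrite subrK.
  by under [in X in _ -> X]eq_bigr do rewrite mulr0 addr0.
have sL : L <= Num.sqrt (sqn f) by rewrite leNgt sq ?sqn_ge0 ?(ltW L0)// -leNgt.
rewrite (le_trans _ sL)/=; last by rewrite lerBlDr lerDl.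
have /hitsE[z hz] : hits m P rho (fun i => cz (f i) + Q i) by [].
have := perturb_sqn L0 dl1 hz.
under eq_bigr do rewrite subrK.
rewrite sq ?sqn_ge0 ?addr_ge0 ?(ltW L0)//.
by apply: le_lt_trans; apply: ler_sum => i _; exact: centered_min.
Qed.

Section Fourier.
Variables (d m N : nat) (P : 'I_N -> 'I_d -> R) (V rho : R).
Hypothesis (m0 : (0 < m)%N) (rho0 : 0 < rho).

Let L := (m.*2)%:R * rho.
Let Q n i : int := Num.floor ((m.*2)%:R * P n i).
Let A : R := \sum_(f : {ffun 'I_d -> 'I_m.*2} |
   L - (1 + d%:R) <= Num.sqrt (sqn f) < L + (1 + d%:R)) 1.

(* V stands for N |B_rho|; its value is irrelevant, since nonzero frequencies do
   not see constants. *)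
Definition disc (f : {ffun 'I_d -> 'I_m.*2}) : R :=
  \sum_(n < N) (hits m (P n) rho (fun i => cz (f i)))%:R - V.

Lemma fourier_approx (h : 'I_d -> int) (g : R -> R) n :
  (forall x, `|g x| <= 1) ->
  `|\sum_(f : {ffun 'I_d -> 'I_m.*2}) (hits m (P n) rho (fun i => cz (f i) + Q n i))%:R *
       g (ang m h (fun i => cz (f i))) -
    \sum_(f : {ffun 'I_d -> 'I_m.*2} | sqn f < L ^+ 2) g (ang m h (fun i => cz (f i)))| <= A.
Proof.
move=> g1; rewrite [X in _ - X]big_mkcond -sumrB /A [leRHS]big_mkcond.
apply: le_trans (ler_norm_sum _ _ _) _; apply: ler_sum => f _.
have := @hits_annulus d m (P n) rho f m0 rho0; rewrite /= -/L -/(Q n).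
case: (hits _ _ _ _); case: ifP => b2 /=.
- by rewrite mul1r subrr normr0; case: ifP.
- by move=> ->//; rewrite mul1r subr0.
- by move=> ->//; rewrite mul0r sub0r normrN.
- by rewrite mul0r subr0 normr0; case: ifP.
Qed.

(** Shifting the centres by [Q n] makes the coefficient, up to 2 N A in its real and in its
    imaginary part, the product of SC + i SS and G + i G'. The squared modulus of the product is at
    least (SC^2 + SS^2) G^2; [sqr_half_le] costs the factor 1/2 and the error 2 (2 N A)^2. *)
Lemma fourier_lower (h : 'I_d -> int) : (exists i, ~~ ((m.*2)%:Z %| h i)%Z) ->
  ((\sum_n cos (ang m h (Q n))) ^+ 2 + (\sum_n sin (ang m h (Q n))) ^+ 2) / 2 *
    (\sum_(f : {ffun 'I_d -> 'I_m.*2} | sqn f < L ^+ 2) cos (ang m h (fun i => cz (f i)))) ^+ 2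
    - 8 * N%:R ^+ 2 * A ^+ 2 <=
  (\sum_f disc f * cos (ang m h (fun i => cz (f i)))) ^+ 2 +
  (\sum_f disc f * sin (ang m h (fun i => cz (f i)))) ^+ 2.
Proof.
move=> hM.
set G := \sum_(f : {ffun 'I_d -> 'I_m.*2} | sqn f < L ^+ 2) cos _.
pose G' : R := \sum_(f : {ffun 'I_d -> 'I_m.*2} | sqn f < L ^+ 2) sin (ang m h (fun i => cz (f i))).
pose U n : R := \sum_(f : {ffun 'I_d -> 'I_m.*2}) (hits m (P n) rho (fun i => cz (f i) + Q n i))%:R *
       cos (ang m h (fun i => cz (f i))).
pose W n : R := \sum_(f : {ffun 'I_d -> 'I_m.*2}) (hits m (P n) rho (fun i => cz (f i) + Q n i))%:R *
       sin (ang m h (fun i => cz (f i))).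
have UG n : `|U n - G| <= A by apply: fourier_approx => x; exact: cos_max.
have WG n : `|W n - G'| <= A by apply: fourier_approx => x; exact: sin_max.
have sinC x : sin x = cos (x + - (pi / 2)) :> R by rewrite cosBpihalf.
(* The phases 0 and - pi/2 give the cosine and the sine coefficient from a single computation. *)
have cE phi : \sum_f disc f * cos (ang m h (fun i => cz (f i)) + phi) =
    \sum_n (cos (ang m h (Q n) + phi) * U n - sin (ang m h (Q n) + phi) * W n).
  rewrite (eq_bigr (fun f : {ffun 'I_d -> 'I_m.*2} => \sum_n (hits m (P n) rho (fun i => cz (f i)))%:R *
      cos (ang m h (fun i => cz (f i)) + phi) - V * cos (ang m h (fun i => cz (f i)) + phi))); last first.
    by move=> f _; rewrite /disc mulrBl mulr_suml.
  rewrite sumrB -[X in _ - X]mulr_sumr cos_sum_eq0// mulr0 subr0 exchange_big/=.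
  apply: eq_bigr => n _.
  have per : periodic_vec m (fun x => (hits m (P n) rho x)%:R * cos (ang m h x + phi)).
    by move=> x t; rewrite hits_periodic// (periodic_cos h phi m0).
  rewrite -(shift_sum (Q n) per) /U /W !mulr_sumr -sumrB; apply: eq_bigr => f _.
  rewrite angDr -addrA [in LHS]cosD.
  move: ((hits _ _ _ _)%:R) (cos _) (sin _) (cos (_ + _)) (sin (_ + _)) => b c s c' s'; ring.
have hc := cE 0; have hs := cE (- (pi / 2)).
have {}hc : \sum_f disc f * cos (ang m h (fun i => cz (f i))) =
    \sum_n (cos (ang m h (Q n)) * U n - sin (ang m h (Q n)) * W n).
  by under eq_bigr do rewrite -[ang _ _ _]addr0; rewrite hc; apply: eq_bigr => n _; rewrite addr0.
have {}hs : \sum_f disc f * sin (ang m h (fun i => cz (f i))) =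
    \sum_n (sin (ang m h (Q n)) * U n + cos (ang m h (Q n)) * W n).
  under eq_bigr do rewrite sinC; rewrite hs; apply: eq_bigr => n _.
  by rewrite -sinC sinBpihalf; ring.
set SC := \sum_n cos _; set SS := \sum_n sin _.
have err (a b : 'I_N -> R) : (forall n, `|a n| <= 1) -> (forall n, `|b n| <= 1) ->
    `|\sum_n (a n * U n + b n * W n) - ((\sum_n a n) * G + (\sum_n b n) * G')| <= 2 * N%:R * A.
  move=> a1 b1; rewrite !mulr_suml -big_split -sumrB.
  apply: le_trans (ler_norm_sum _ _ _) _.
  rewrite (_ : 2 * N%:R * A = \sum_(n < N) (2 * A)); last first.
    by rewrite sumr_const card_ord -mulr_natl; ring.
  apply: ler_sum => n _ /=.
  rewrite (_ : _ - _ = a n * (U n - G) + b n * (W n - G')); last by ring.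
  apply: le_trans (ler_normD _ _) _; rewrite !normrM (_ : 2 * A = 1 * A + 1 * A); last by ring.
  by apply: lerD; apply: ler_pM.
have e1 := err (fun n => cos (ang m h (Q n))) (fun n => - sin (ang m h (Q n)))
  (fun n => cos_max _) (fun n => ltac:(by rewrite normrN sin_max)).
have e2 := err (fun n => sin (ang m h (Q n))) (fun n => cos (ang m h (Q n)))
  (fun n => sin_max _) (fun n => cos_max _).
rewrite sumrN -/SC -/SS in e1; rewrite -/SC -/SS in e2.
rewrite hc hs (eq_bigr (fun n => cos (ang m h (Q n)) * U n + - sin (ang m h (Q n)) * W n)); last first.
  by move=> n _; rewrite mulNr.
have := lerD (sqr_half_le e1) (sqr_half_le e2).
apply: le_trans; rewrite -subr_ge0.
rewrite [leRHS](_ : _ = (SC ^+ 2 + SS ^+ 2) / 2 * G' ^+ 2); last by field.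
by rewrite mulr_ge0 ?sqr_ge0// divr_ge0// addr_ge0 ?sqr_ge0.
Qed.

(** Since L = 2m rho, the phase 2 pi h.x / (2m) is eta.x / L with eta = 2 pi rho h. *)
Lemma ball_sum_cos_sum (h : 'I_d -> int) :
  \sum_(f : {ffun 'I_d -> 'I_m.*2} | sqn f < L ^+ 2) cos (ang m h (fun i => cz (f i))) =
  L ^+ d * cos_sum m (fun i => 2 * pi * rho * (h i)%:~R) L (L ^+ 2).
Proof.
have L0 : 0 < L by rewrite mulr_gt0// ltr0n double_gt0.
rewrite /cos_sum mulrA divff ?mul1r ?expf_neq0 ?gt_eqF//.
apply: eq_bigr => f _; congr cos; rewrite /dotn /ang /ip /L.
have M0 : 0 < (m.*2)%:R :> R by rewrite ltr0n double_gt0.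
rewrite (big_morph (fun z : int => z%:~R : R) (@intrD R) (erefl _)) [RHS]mulr_suml.
rewrite [X in _ * X]mulr_suml mulr_sumr.
by apply: eq_bigr => i _; rewrite intrM /ctr /cz; field; rewrite !gt_eqF.
Qed.

End Fourier.
End DiscrepancyFourier.

(** * Cassels' argument and the balance of the error terms *)

Section CasselsArgument.
Context {R : realType}.
Implicit Types (d m : nat).

Lemma card_window n (l b : nat) : (#|[pred j : 'I_n | (`|j%:Z - l%:Z| <= b)%N]| <= b.*2.+1)%N.
Proof.
rewrite cardE -(size_map val) -(size_iota (l - b) b.*2.+1).
apply: uniq_leq_size; first by rewrite map_inj_uniq ?enum_uniq//; exact: val_inj.
by move=> _ /mapP[j + ->]; rewrite mem_enum inE mem_iota /=; lia.
Qed.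

Lemma card_near d n (l : 'I_d -> nat) (B : R) : 1 <= B ->
  #|[pred k : {ffun 'I_d -> 'I_n} | [forall i, `|(k i)%:R - (l i)%:R| < B]]|%:R <= (3 * B) ^+ d.
Proof.
move=> B1; pose b := Num.truncn B.
have bB : b%:R <= B by rewrite truncn_le// (le_trans ler01).
pose Fm i := [pred j : 'I_n | (`|j%:Z - (l i)%:Z| <= b)%N].
apply: le_trans (_ : #|family Fm|%:R <= _).
  rewrite ler_nat; apply: subset_leq_card; apply/fintype.subsetP => k; rewrite !inE => /forallP hk.
  apply/familyP => i; rewrite inE; have := hk i.
  rewrite -[(k i)%:R]/((k i)%:Z%:~R) -[(l i)%:R]/((l i)%:Z%:~R) -intrB -intr_norm -abszE.
  rewrite -[(_%:~R)]/(_%:R) => h; rewrite /b.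
  by rewrite truncn_ge_nat ?(ltW h)// (le_trans ler01).
rewrite card_family foldrE big_map big_enum/= natr_prod.
rewrite -[d in leRHS]card_ord -prodr_const; apply: ler_prod => i _; rewrite ler0n/=.
apply: le_trans (_ : (b.*2.+1)%:R <= _); first by rewrite ler_nat card_window.
by rewrite -natr1 -muln2 natrM; lra.
Qed.

(** Here E nu bounds the norm of the scaled frequencies, and N / (E nu)^(d+1) is a constant over nu.
    Both errors are multiples of at most N^2 / L^2 <= 1 / (C0 nu), the first because nu^2 <= N when
    d >= 2; this is the source of the exponent 1 + 1/(2d). *)
Lemma main_term_dominates d (N nu L C0 c1 CL A3 E : R) : (2 <= d)%N -> 1 <= nu -> N = nu ^+ d ->
  0 < c1 -> 0 <= CL -> 0 <= A3 -> 0 < E -> 1 <= C0 ->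
  8 * (CL * E ^+ 2 / 4 + 8 * A3) <= C0 * (c1 / E ^+ d.+1) ->
  C0 * (N * Num.sqrt nu) <= L ->
  c1 / E ^+ d.+1 / 8 / nu <=
  N / 4 * (c1 / (E * nu) ^+ d.+1 - CL * (E * nu / L) ^+ 2) - 8 * A3 * N ^+ 2 / L ^+ 2.
Proof.
move=> d2 nu1 NE c10 CL0 A30 E0 C01 hC hL.
have nu0 : 0 < nu by lra.
have N0 : 0 < N by rewrite NE exprn_gt0.
have N1 : nu ^+ 2 <= N by rewrite NE; apply: ler_weXn2l.
have C00 : 0 < C0 by lra.
have L0 : 0 < L by apply: lt_le_trans hL; rewrite !mulr_gt0// sqrtr_gt0.
have L2 : C0 * (N ^+ 2 * nu) <= L ^+ 2.
  apply: le_trans (_ : (C0 * (N * Num.sqrt nu)) ^+ 2 <= _).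
    rewrite !exprMn sqr_sqrtr ?(ltW nu0)//.
    apply: ler_wpM2r; first by rewrite mulr_ge0 ?(ltW nu0)// sqr_ge0.
    by rewrite expr2 ler_peMl// ltW.
  by rewrite lerXn2r ?nnegrE ?(ltW L0)// !mulr_ge0 ?(ltW C00) ?(ltW N0) ?sqrtr_ge0.
have t3 : N ^+ 2 / L ^+ 2 <= (C0 * nu)^-1.
  rewrite ler_pdivrMr ?exprn_gt0// mulrC ler_pdivlMr ?mulr_gt0//.
  by apply: le_trans L2; rewrite le_eqVlt; apply/orP; left; apply/eqP; ring.
have t2 : N * (nu / L) ^+ 2 <= (C0 * nu)^-1.
  apply: le_trans t3; rewrite expr_div_n mulrA ler_wpM2r ?invr_ge0 ?sqr_ge0//.
  by rewrite [N ^+ 2]expr2 ler_wpM2l// ltW.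
have t1 : N * (c1 / (E * nu) ^+ d.+1) = c1 / E ^+ d.+1 / nu.
  rewrite exprMn [nu ^+ _]exprSr -NE; field.
  by rewrite !gt_eqF// exprn_gt0.
set c2 := c1 / E ^+ d.+1 in hC t1 *.
have -> : N / 4 * (c1 / (E * nu) ^+ d.+1 - CL * (E * nu / L) ^+ 2) - 8 * A3 * N ^+ 2 / L ^+ 2 =
   c2 / nu / 4 - (CL * E ^+ 2 / 4) * (N * (nu / L) ^+ 2) - 8 * A3 * (N ^+ 2 / L ^+ 2).
  by rewrite -t1; field; rewrite !gt_eqF// exprn_gt0// mulr_gt0.
have q : 0 <= CL * E ^+ 2 / 4 by rewrite divr_ge0// mulr_ge0// sqr_ge0.
have u2 := ler_wpM2l q t2; have u3 := ler_wpM2l (mulr_ge0 (ler0n R 8) A30) t3.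
have : 8 * (CL * E ^+ 2 / 4 + 8 * A3) * (C0 * nu)^-1 <= c2 / nu.
  rewrite ler_pdivrMr ?mulr_gt0// (_ : c2 / nu * (C0 * nu) = C0 * c2)//.
  by field; rewrite gt_eqF.
move: u2 u3; set z := (C0 * nu)^-1; rewrite [c2 / 8 / nu](_ : _ = c2 / nu / 8); last by ring.
lra.
Qed.

(** The weight of the radius 2L is at least that of L, so both main terms can carry the smaller one;
    1 + (2^d)^2 collects the two annuli. *)
Lemma fourier_combine d (S n g A0 L G1 G2 a1 a2 w1 w2 : R) :
  0 <= S -> 0 <= L -> 0 <= a1 -> 0 <= a2 -> a1 <= A0 * L ^+ d -> a2 <= A0 * (2 * L) ^+ d ->
  g <= G1 ^+ 2 + G2 ^+ 2 ->
  S / 2 * (L ^+ d.+1 * G1) ^+ 2 - 8 * n ^+ 2 * a1 ^+ 2 <= w1 ->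
  S / 2 * ((2 * L) ^+ d.+1 * G2) ^+ 2 - 8 * n ^+ 2 * a2 ^+ 2 <= w2 ->
  S / 2 * (L ^+ d.+1 * L ^+ d.+1 * g) -
    8 * n ^+ 2 * (A0 ^+ 2 * (1 + (2 ^+ d) ^+ 2) * (L ^+ d * L ^+ d)) <= w1 + w2.
Proof.
move=> S0 L0 a10 a20 a1l a2l gl w1l w2l.
apply: le_trans (lerD w1l w2l); rewrite addrACA -opprD -mulrDr -[X in _ <= _ - X]mulrDr.
have h1 : L ^+ d.+1 * L ^+ d.+1 * g <= (L ^+ d.+1 * G1) ^+ 2 + ((2 * L) ^+ d.+1 * G2) ^+ 2.
  apply: le_trans (_ : (L ^+ d.+1) ^+ 2 * (G1 ^+ 2 + G2 ^+ 2) <= _).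
    by rewrite -expr2 ler_wpM2l// sqr_ge0.
  rewrite mulrDr -!exprMn lerD2l [(2 * L) ^+ _]exprMn -mulrA [leRHS]exprMn.
  by apply: ler_peMl; rewrite ?sqr_ge0// exprn_ege1// exprn_ege1// ler1n.
have h2 : a1 ^+ 2 + a2 ^+ 2 <= A0 ^+ 2 * (1 + (2 ^+ d) ^+ 2) * (L ^+ d * L ^+ d).
  rewrite (_ : A0 ^+ 2 * _ * _ = (A0 * L ^+ d) ^+ 2 + (A0 * (2 * L) ^+ d) ^+ 2).
    by apply: lerD; rewrite lerXn2r// nnegrE//; [exact: le_trans a1l|exact: le_trans a2l].
  by rewrite [(2 * L) ^+ _]exprMn; ring.
apply: lerB; apply: ler_wpM2l => //; first by rewrite divr_ge0.
exact: mulr_ge0 (ler0n R 8) (sqr_ge0 n).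
Qed.

(** [S] is the squared exponential sum of a pair, with total at least n |P|^2. Near pairs number at
    most q |P| <= |P|^2 / (4 n) and each has S <= 2 n^2, so discarding them loses at most half of
    that total. *)
Lemma pair_sum (I : finType) (P : pred I) (near : rel I) (S w : I -> I -> R) (n a b q : R) :
  0 <= n -> 0 <= a -> 0 <= b -> 4 * n * q <= #|P|%:R ->
  n * #|P|%:R ^+ 2 <= \sum_(l | P l) \sum_(k | P k) S k l ->
  (forall k l, S k l <= 2 * n ^+ 2) -> (forall k l, 0 <= w k l) ->
  (forall k l, P k -> P l -> ~~ near k l -> S k l / 2 * a - b <= w k l) ->
  (forall l, #|[pred k | near k l]|%:R <= q) ->
  #|P|%:R * (#|P|%:R * (n / 4 * a - b)) <= \sum_(l | P l) \sum_(k | P k) w k l.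
Proof.
move=> n0 a0 b0 hq hT hS hw hnear hcard; set x : R := #|P|%:R in hq hT *.
(* A minorant valid for all pairs: for a near pair, subtracting n^2 a makes it nonpositive. *)
apply: le_trans (_ : \sum_(l | P l) \sum_(k | P k)
    (S k l * (a / 2) - (if near k l then 1 else 0) * (n ^+ 2 * a) - b) <= _); last first.
  apply: ler_sum => l Pl; apply: ler_sum => k Pk; have := hnear k l Pk Pl.
  case: (near k l) => /= h.
    apply: le_trans (hw k l).
    have : S k l * (a / 2) <= 2 * n ^+ 2 * (a / 2) by rewrite ler_wpM2r// divr_ge0.
    by rewrite (_ : 2 * n ^+ 2 * (a / 2) = n ^+ 2 * a); [lra|field].
  by apply: le_trans (h isT); rewrite le_eqVlt; apply/orP; left; apply/eqP; field.
have nearb : \sum_(l | P l) \sum_(k | P k) (if near k l then 1 else 0) <= x * q.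
  rewrite /x mulr_natl -sumr_const; apply: ler_sum => l _; apply: le_trans (hcard l).
  rewrite -sumr_const big_mkcond [leRHS]big_mkcond; apply: ler_sum => k _.
  by rewrite inE; case: (P k); case: (near k l).
under eq_bigr do rewrite !sumrB -!mulr_suml sumr_const -/x.
rewrite !sumrB -!mulr_suml sumr_const -mulrnA -[b *+ _]mulr_natr natrM -/x.
have e1 := ler_wpM2r (divr_ge0 a0 (ler0n R 2)) hT.
have na0 : 0 <= n ^+ 2 * a by rewrite mulr_ge0// sqr_ge0.
have e2 := ler_wpM2r na0 nearb.
have x0 : 0 <= x by rewrite ler0n.
have e3 : x * q * (n ^+ 2 * a) <= n * x ^+ 2 * (a / 4).
  rewrite (_ : x * q * _ = (4 * n * q) * (x * n * a / 4)); last by field.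
  rewrite (_ : n * x ^+ 2 * _ = x * (x * n * a / 4)); last by field.
  by rewrite ler_wpM2r// divr_ge0// !mulr_ge0.
rewrite (_ : x * (x * _) = n * x ^+ 2 * (a / 2) - n * x ^+ 2 * (a / 4) - b * (x * x)); last by field.
lra.
Qed.

(** [x] is the number of frequencies in the box. One factor [x] cancels against the x values of l
    over which Bessel's inequality is summed; the other is at least n / r^(d+1), and L = M r
    converts powers of [L] into the normalisation of the grid. *)
Lemma mean_square_of_box d (n nu x r M L A3 g c W : R) : 0 < nu -> 0 < M -> 0 < r -> 0 < x -> 0 <= c ->
  L = M * r -> n <= x * r ^+ d.+1 ->
  c / nu <= n / 4 * g - 8 * A3 * n ^+ 2 / L ^+ 2 ->
  x * (x * (n / 4 * (L ^+ d.+1 * L ^+ d.+1 * g) - 8 * n ^+ 2 * (A3 * (L ^+ d * L ^+ d)))) <=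
    x * (M ^+ d.+1 * W) ->
  c * (r ^+ d.+1 * (n / nu)) <= W / M ^+ d.+1.
Proof.
move=> nu0 M0 r0 x0 c0 LE nx cl; rewrite ler_pM2l// => h.
have L0 : 0 < L by rewrite LE mulr_gt0.
have Md : 0 < M ^+ d.+1 by rewrite exprn_gt0.
have rd : 0 < r ^+ d.+1 by rewrite exprn_gt0.
rewrite ler_pdivlMr// -(ler_pM2l Md); apply: le_trans h.
apply: le_trans (_ : x * (L ^+ d.+1 * L ^+ d.+1) * (c / nu) <= _); last first.
  apply: le_trans (ler_wpM2l _ cl) _; first by rewrite !mulr_ge0 ?exprn_ge0// ltW.
  by rewrite [L ^+ d.+1]exprS le_eqVlt; apply/orP; left; apply/eqP; field; rewrite gt_eqF.
rewrite LE exprMn.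
have k0 : 0 <= M ^+ d.+1 * M ^+ d.+1 * r ^+ d.+1 * (c / nu).
  exact: mulr_ge0 (mulr_ge0 (mulr_ge0 (ltW Md) (ltW Md)) (ltW rd)) (divr_ge0 c0 (ltW nu0)).
have := ler_wpM2r k0 nx.
move: (M ^+ _) (r ^+ _) => a b; congr (_ <= _); field; exact: lt0r_neq0.
Qed.

End CasselsArgument.

(** * The mean square over the grid *)

Section MeanSquare.
Context {R : realType}.
Implicit Types (d m : nat).

Lemma inbox_dif d n X (k l : {ffun 'I_d -> 'I_n}) i : inbox X k -> inbox X l ->
  `|fz k i - fz l i| <= X%:Z.
Proof. by move=> /forallP /(_ i) bk /forallP /(_ i) bl; rewrite /fz; lia. Qed.

Lemma inbox_ndvd d n X (k l : {ffun 'I_d -> 'I_n}) i : (X <= n)%N -> inbox X k -> inbox X l ->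
  fz k i - fz l i != 0 -> ~~ (n%:Z %| fz k i - fz l i)%Z.
Proof.
move=> Xn /forallP /(_ i) bk /forallP /(_ i) bl; rewrite /fz => h; apply/negP => /dvdzP[t ht].
move: h; rewrite ht; have -> : t = 0 by nia.
by rewrite mul0r.
Qed.

Lemma nrm_ge_coord d (eta : 'I_d -> R) i : `|eta i| <= nrm eta.
Proof.
rewrite -(@ler_pXn2r _ 2) ?nnegrE ?nrm_ge0// /nrm sqr_sqrtr ?sumr_ge0//; last first.
  by move=> j _; exact: sqr_ge0.
rewrite real_normK ?num_real// (bigD1 i)//= lerDl sumr_ge0// => j _; exact: sqr_ge0.
Qed.

Lemma nrm_le_coord d (eta : 'I_d -> R) b : 0 <= b -> (forall i, `|eta i| <= b) ->
  nrm eta <= d%:R * b.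
Proof.
move=> b0 h; have db0 : 0 <= d%:R * b by rewrite mulr_ge0.
rewrite -(@ler_pXn2r _ 2) ?nnegrE ?nrm_ge0// /nrm sqr_sqrtr ?sumr_ge0//; last first.
  by move=> j _; exact: sqr_ge0.
apply: le_trans (_ : \sum_(i < d) b ^+ 2 <= _).
  apply: ler_sum => i _; rewrite -[leLHS]real_normK ?num_real// lerXn2r// nnegrE//.
rewrite sumr_const card_ord -[leLHS]mulr_natl [leRHS]exprMn ler_wpM2r ?sqr_ge0//.
by case: d {eta h db0} => [|d]; rewrite ?expr0n//= expr2 ler_peMl// ler1n.
Qed.

Lemma mean_square_lower d : (2 <= d)%N -> (d %% 4 != 1)%N ->
  exists C0 c : R, [/\ 0 < C0, 0 < c &
  forall (r nu : R) (N m : nat) (P : 'I_N -> 'I_d -> R) (V1 V2 : R),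
  0 < r -> r < 1 / 4 -> (0 < N)%N -> (0 < m)%N -> 1 <= nu -> N%:R = nu ^+ d ->
  C0 * (N%:R * Num.sqrt nu) <= (m.*2)%:R * r ->
  c * (r ^+ d * (N%:R / nu)) <=
  (\sum_(f : {ffun 'I_d -> 'I_m.*2}) disc P V1 r f ^+ 2 +
   \sum_(f : {ffun 'I_d -> 'I_m.*2}) disc P V2 (2 * r) f ^+ 2) / (m.*2)%:R ^+ d].
Proof.
move=> d2 d4; have [c1 [K [CL [c10 K1 CL0 low]]]] := @lattice_lower R d d2 d4.
case: d d2 d4 low => // d' d2 d4 low; set d := d'.+1 in d2 d4 low *.
have [A0 A00 ann] := @annulus_card R d' (1 + d%:R) ltac:(by rewrite addr_ge0).
pose A3 := A0 ^+ 2 * (1 + (2 ^+ d') ^+ 2).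
have A30 : 0 <= A3 by rewrite mulr_ge0 ?addr_ge0 ?sqr_ge0.
(* The box has side X >= C1 nu / r, and 12 = 4 * 3 makes X^d at least 4 N (3 K / r)^d, the smallness
   of the near pairs demanded by [pair_sum]. *)
pose C1 := 12 * K.
pose D : R := 2 * pi * d%:R.
have pi0 := @pi_gt0 R.
have tpi : 1 <= 2 * pi :> R by have := @pi_ge2 R; lra.
have D0 : 0 < D by rewrite !mulr_gt0// ltr0n.
have C10 : 0 < C1 by rewrite mulr_gt0//; lra.
(* Coordinates of frequency differences are at most X <= 2 C1 nu / r, so eta = 2 pi r h has norm at
   most d (2 pi) (2 C1 nu) = E nu. *)
pose E := 2 * D * C1.
have E0 : 0 < E := mulr_gt0 (mulr_gt0 (ltr0n R 2) D0) C10.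
pose c2 := c1 / E ^+ d.+1.
have c20 : 0 < c2 by rewrite divr_gt0// exprn_gt0.
pose W0 := 8 * (CL * E ^+ 2 / 4 + 8 * A3).
have W00 : 0 <= W0.
  rewrite mulr_ge0// addr_ge0 ?(mulr_ge0 (ler0n R 8))//.
  by rewrite divr_ge0// (mulr_ge0 (ltW CL0))// sqr_ge0.
(* The three summands serve L >= 1, the inclusion X <= 2m of the box, and the domination of the
   errors. *)
pose C0 := 1 + 2 * C1 + W0 / c2.
have W0c : 0 <= W0 / c2 by rewrite divr_ge0// ltW.
have C01 : 1 <= C0 by rewrite /C0; lra.
have C02 : 2 * C1 <= C0 by rewrite /C0; lra.
have C0W : W0 <= C0 * c2.
  by rewrite -ler_pdivrMr// /C0; lra.
exists C0, (c2 / 8); split; [lra|by rewrite divr_gt0|].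
move=> r nu N m P V1 V2 r0 r4 N0 m0 nu1 NE hC0.
have M0 : 0 < (m.*2)%:R :> R by rewrite ltr0n double_gt0.
have nu0 : 0 < nu by lra.
have NR0 : 0 < N%:R :> R by rewrite ltr0n.
pose L := (m.*2)%:R * r.
have nuN : nu <= N%:R by rewrite NE -[leLHS]expr1; apply: ler_weXn2l.
have snu : 1 <= Num.sqrt nu by rewrite -[1]sqrtr1 ler_sqrt// ltW.
have nusN : nu <= N%:R * Num.sqrt nu by apply: le_trans nuN _; rewrite ler_peMr// ltW.
have L1 : 1 <= L.
  apply: le_trans hC0; apply: le_trans (_ : 1 * 1 <= _); first by rewrite mulr1.
  by apply: ler_pM => //; apply: le_trans nusN.
have L0 : 0 < L by lra.
have L2 : 2 * L <= m%:R.
  rewrite /L -muln2 natrM; have : m%:R * r <= m%:R * (1 / 4) by rewrite ler_wpM2l// ltW.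
  lra.
(* Beyond this distance in some coordinate, the norm of eta is at least 2 pi r B = 2 pi K, hence at
   least [K], and [lattice_lower] applies. *)
pose B := K / r.
have B1 : 1 <= B by rewrite ler_pdivlMr//; lra.
have [X X1 X2] : exists2 X : nat, C1 * nu / r <= X%:R & X%:R <= 2 * C1 * nu / r.
  pose y := C1 * nu / r.
  have y1 : 1 <= y.
    rewrite /y ler_pdivlMr// mul1r; apply: le_trans (_ : C1 * 1 <= _); first by rewrite /C1; lra.
    by rewrite ler_wpM2l// ltW.
  exists (Num.truncn y).+1; first by rewrite ltW// truncnS_gt.
  have : (Num.truncn y)%:R <= y by rewrite truncn_le//; lra.
  by rewrite -natr1 (_ : 2 * C1 * nu / r = 2 * y); [lra|rewrite /y; ring].
have XM : (X <= m.*2)%N.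
  rewrite -(ler_nat R); apply: le_trans X2 _; rewrite ler_pdivrMr//.
  apply: le_trans hC0; apply: ler_pM nusN => //; last exact: ltW.
  by rewrite (mulr_ge0 (ler0n R 2))// ltW.
have X0 : (0 < X)%N.
  by rewrite -(ltr_nat R); apply: lt_le_trans X1; rewrite divr_gt0// mulr_gt0.
pose Q n i : int := Num.floor ((m.*2)%:R * P n i).
pose S2 (h : 'I_d -> int) : R := (\sum_n cos (ang m h (Q n))) ^+ 2 + (\sum_n sin (ang m h (Q n))) ^+ 2.
have S20 h : 0 <= S2 h by rewrite addr_ge0 ?sqr_ge0.
have S2N h : S2 h <= 2 * N%:R ^+ 2.
  have b (g : R -> R) : (forall x, `|g x| <= 1) -> (\sum_n g (ang m h (Q n))) ^+ 2 <= N%:R ^+ 2.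
    move=> g1; rewrite -[leLHS]real_normK ?num_real// lerXn2r ?nnegrE//.
    apply: le_trans (ler_norm_sum _ _ _) _; rewrite -[N in leRHS]card_ord -sumr_const.
    by apply: ler_sum => n _; exact: g1.
  have := b _ (@cos_max R); have := b _ (@sin_max R); rewrite /S2; lra.
pose dif (k l : {ffun 'I_d -> 'I_m.*2}) : 'I_d -> int := fun i => fz k i - fz l i.
pose near (k l : {ffun 'I_d -> 'I_m.*2}) := [forall i, `|(k i)%:R - (l i)%:R| < B].
pose bx : pred {ffun 'I_d -> 'I_m.*2} := @inbox d m.*2 X.
pose nsq rho V (h : 'I_d -> int) : R :=
  (\sum_(f : {ffun 'I_d -> 'I_m.*2}) disc P V rho f * cos (ang m h (fun i => cz (f i)))) ^+ 2 +
  (\sum_(f : {ffun 'I_d -> 'I_m.*2}) disc P V rho f * sin (ang m h (fun i => cz (f i)))) ^+ 2.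
have nsq0 rho V h : 0 <= nsq rho V h by rewrite addr_ge0 ?sqr_ge0.
pose g := c1 / (E * nu) ^+ d.+1 - CL * (E * nu / L) ^+ 2.
have ar : c2 / 8 / nu <= N%:R / 4 * g - 8 * A3 * N%:R ^+ 2 / L ^+ 2.
  by apply: main_term_dominates C0W hC0 => //; exact: ltW.
have g0 : 0 <= g.
  rewrite -(pmulr_rge0 _ (divr_gt0 NR0 (ltr0n R 4))).
  have p1 : 0 <= c2 / 8 / nu := divr_ge0 (divr_ge0 (ltW c20) (ler0n R 8)) (ltW nu0).
  have p2 : 0 <= 8 * A3 * N%:R ^+ 2 / L ^+ 2.
    exact: divr_ge0 (mulr_ge0 (mulr_ge0 (ler0n R 8) A30) (sqr_ge0 _)) (sqr_ge0 _).
  move: ar p1 p2; move: (_ / L ^+ 2) (_ / nu) (_ * g) => *.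
  lra.
have high k l : bx k -> bx l -> ~~ near k l ->
   S2 (dif k l) / 2 * (L ^+ d * L ^+ d * g) - 8 * N%:R ^+ 2 * (A3 * (L ^+ d' * L ^+ d')) <=
   nsq r V1 (dif k l) + nsq (2 * r) V2 (dif k l).
  move=> bk bl; rewrite negb_forall => /existsP[i0]; rewrite -leNgt => hi0.
  have hE i : (dif k l i)%:~R = (k i)%:R - (l i)%:R :> R by rewrite /dif /fz intrB.
  rewrite -hE in hi0.
  have hX i : `|(dif k l i)%:~R : R| <= X%:R.
    by rewrite -intr_norm -[X%:R]/(X%:Z%:~R) ler_int inbox_dif.
  have hM : exists i, ~~ ((m.*2)%:Z %| dif k l i)%Z.
    exists i0; apply: inbox_ndvd XM bk bl _; rewrite -/(dif k l i0) -(intr_eq0 R) -normr_gt0.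
    exact: lt_le_trans (lt_le_trans ltr01 B1) hi0.
  pose eta i := 2 * pi * r * (dif k l i)%:~R.
  have tpr : 0 < 2 * pi * r by rewrite !mulr_gt0.
  have eta1 : K <= nrm eta.
    apply: le_trans (nrm_ge_coord eta i0).
    rewrite /eta normrM (gtr0_norm tpr).
    apply: le_trans (_ : 2 * pi * r * B <= _); last by rewrite ler_wpM2l// ltW.
    rewrite (_ : _ * B = 2 * pi * K); last by rewrite /B; field; rewrite gt_eqF.
    apply: ler_peMl; first exact: le_trans ler01 K1.
    exact: tpi.
  have eta2 : nrm eta <= E * nu.
    apply: le_trans (_ : d%:R * (2 * pi * r * (2 * C1 * nu / r)) <= _); last first.
      by rewrite /E /D le_eqVlt; apply/orP; left; apply/eqP; field; rewrite gt_eqF.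
    apply: nrm_le_coord => [|i].
      exact: mulr_ge0 (ltW tpr) (le_trans (ler0n _ X) X2).
    by rewrite /eta normrM (gtr0_norm tpr) ler_wpM2l ?(ltW tpr)// (le_trans (hX i)).
  have nrm0 : 0 < nrm eta := lt_le_trans (lt_le_trans ltr01 K1) eta1.
  have E1 : 0 < E * nu by rewrite mulr_gt0.
  have lw := low m eta L L1 L2 eta1.
  have {}lw : g <= cos_sum m eta L (L ^+ 2) ^+ 2 +
      cos_sum m (fun i => 2 * eta i) (2 * L) ((2 * L) ^+ 2) ^+ 2.
    apply: le_trans lw; apply: lerB.
      by rewrite ler_pM2l// lef_pV2 ?posrE ?exprn_gt0// lerXn2r// nnegrE ltW.
    rewrite ler_wpM2l ?(ltW CL0)// lerXn2r ?nnegrE ?divr_ge0 ?(ltW nrm0) ?(ltW L0) ?(ltW E1)//.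
    by rewrite ler_wpM2r// invr_ge0 ltW.
  have ML : (m.*2)%:R * (2 * r) = 2 * L by rewrite /L; ring.
  have f1 := fourier_lower P V1 m0 r0 hM; have f2 := fourier_lower P V2 m0 (mulr_gt0 (ltr0n R 2) r0) hM.
  rewrite ball_sum_cos_sum// -/(nsq _ _ _) -/L -/(S2 _) in f1.
  rewrite ball_sum_cos_sum ?mulr_gt0// -/(nsq _ _ _) ML -/(S2 _) in f2.
  rewrite (_ : (fun i => 2 * pi * (2 * r) * (dif k l i)%:~R) = (fun i => 2 * eta i)) in f2; last first.
    by apply/funext => i; rewrite /eta; ring.
  have L21 : 1 <= 2 * L by rewrite (le_trans L1)// ler_peMl ?ler1n// ltW.
  have a1 := ann m L L1; have a2 := ann m (2 * L) L21.
  move: f1 f2 a1 a2 lw.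
  set G1 := cos_sum _ _ _ _; set G2 := cos_sum _ _ _ _.
  have A0' (x : R) : 0 <= \sum_(f : {ffun 'I_d -> 'I_m.*2} |
      x - (1 + d%:R) <= Num.sqrt (sqn f) < x + (1 + d%:R)) (1 : R).
    by apply: sumr_ge0.
  have := A0' L; have := A0' (2 * L); rewrite -/eta -/G1.
  set a1 := \sum_(_ | _) _; set a2 := \sum_(_ | _) _ => p1 p2 f1 f2 q1 q2 lw.
  exact: (fourier_combine (S20 _) (ltW L0) p2 p1 q1 q2 lw f1 f2).
have cardX : #|bx| = (X ^ d)%N by apply: card_inbox.
have cas := @cassels R d m N bx Q.
have bes1 (V rho : R) : \sum_(l | bx l) \sum_(k | bx k) nsq rho V (dif k l) <=
   (X ^ d)%:R * ((m.*2)%:R ^+ d * \sum_(f : {ffun 'I_d -> 'I_m.*2}) disc P V rho f ^+ 2).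
  rewrite -cardX mulr_natl -sumr_const; apply: ler_sum => l _.
  exact: bessel.
have cardX0 : (0 < #|bx|)%N by rewrite cardX expn_gt0 X0.
have cl (l : {ffun 'I_d -> 'I_m.*2}) : #|[pred k | near k l]|%:R <= (3 * B) ^+ d.
  exact: (@card_near R d m.*2 (fun i => l i : nat) B B1).
have hq : 4 * N%:R * (3 * B) ^+ d <= #|bx|%:R.
  rewrite cardX natrX.
  apply: le_trans (_ : (4 * nu * (3 * B)) ^+ d <= _).
    rewrite [leRHS]exprMn [(4 * nu) ^+ d]exprMn -NE ler_wpM2r ?exprn_ge0//; first by lra.
    by rewrite ler_wpM2r// -[leLHS]expr1; apply: ler_weXn2l => //; rewrite ler1n.
  have B0 : 0 <= 4 * nu * (3 * B).
    exact: mulr_ge0 (mulr_ge0 (ler0n R 4) (ltW nu0)) (mulr_ge0 (ler0n R 3) (le_trans ler01 B1)).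
  rewrite lerXn2r ?nnegrE//.
  by apply: le_trans X1; rewrite /C1 /B le_eqVlt; apply/orP; left; apply/eqP; field; rewrite gt_eqF.
have a0 : 0 <= L ^+ d * L ^+ d * g.
  exact: mulr_ge0 (mulr_ge0 (exprn_ge0 _ (ltW L0)) (exprn_ge0 _ (ltW L0))) g0.
have b0 : 0 <= 8 * N%:R ^+ 2 * (A3 * (L ^+ d' * L ^+ d')).
  apply: mulr_ge0 (mulr_ge0 (ler0n R 8) (sqr_ge0 _)) (mulr_ge0 A30 _).
  exact: mulr_ge0 (exprn_ge0 _ (ltW L0)) (exprn_ge0 _ (ltW L0)).
have cas' : N%:R * #|bx|%:R ^+ 2 <= \sum_(l | bx l) \sum_(k | bx k) S2 (dif k l).
  by rewrite exchange_big; exact: cas.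
have nsum := @pair_sum R _ bx near (fun k l => S2 (dif k l))
  (fun k l => nsq r V1 (dif k l) + nsq (2 * r) V2 (dif k l)) N%:R _ _ _ (ltW NR0) a0 b0 hq cas'
  (fun k l => S2N _) (fun k l => addr_ge0 (nsq0 _ _ _) (nsq0 _ _ _)) high cl.
apply: (@mean_square_of_box R d' N%:R nu #|bx|%:R r (m.*2)%:R L A3 g) => //.
- by rewrite ltr0n.
- exact: divr_ge0 (ltW c20) (ler0n R 8).
- rewrite cardX natrX -exprMn NE lerXn2r// ?nnegrE ?(ltW nu0)//; first by rewrite mulr_ge0// ltW.
  rewrite -ler_pdivrMr//; apply: le_trans X1; rewrite ler_wpM2r ?invr_ge0 ?(ltW r0)//.
  by rewrite ler_peMl ?(ltW nu0)// /C1; lra.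
apply: le_trans nsum _; under eq_bigr do rewrite big_split.
rewrite big_split/= cardX [X in _ <= _ * X]mulrDr [leRHS]mulrDr.
by apply: lerD; exact: bes1.
Qed.

End MeanSquare.

(** * The torus *)

Section Grid.
Context {R : realType}.
Implicit Types (d m : nat).

Lemma to_torusD d (x y : 'rV[R]_d) : to_torus (x + y) = to_torus x + to_torus y.
Proof. exact: (raddfD (\pi_(Quotient.quot (Zlattice_zmod R d))%qT)). Qed.

Lemma to_torus_eqP d (x y : 'rV[R]_d) : reflect (to_torus x = to_torus y) (x - y \is a mxOver Num.int).
Proof.
have -> : (x - y \is a mxOver Num.int) = ((x - y) \in Zlattice_zmod R d) by [].
rewrite Quotient.idealrBE; exact: eqP.
Qed.

Lemma to_torus_surj d (p : torus R d) : exists x, to_torus x = p.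
Proof. by exists (repr p); exact: reprK. Qed.

Lemma indic_tball d m (P : 'rV[R]_d) (rho : R) (j : 'rV[int]_d) : 0 < rho ->
  \1_[set grid_pt R (m.*2)%:Z j + y | y in tball d rho] (to_torus P) =
  (hits m (fun i => P ord0 i) rho (fun i => j ord0 i))%:R :> R.
Proof.
move=> rho0; rewrite indicE; congr ((nat_of_bool _)%:R); rewrite /hits.
have ballP (y : 'rV[R]_d) : (eball d rho y : Prop) <-> \sum_i y ord0 i ^+ 2 < rho ^+ 2.
  have s0 : 0 <= \sum_i y ord0 i ^+ 2 by apply: sumr_ge0 => i _; exact: sqr_ge0.
  by rewrite /eball /= /enorm -[in X in _ <-> X](sqr_sqrtr s0) ltr_pXn2r// nnegrE ?sqrtr_ge0// ltW.
apply/idP/asboolP.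
  rewrite inE => -[_ [y /ballP hy <-]]; rewrite /grid_pt -to_torusD => /to_torus_eqP/mxOverP hz.
  (* Equality in the torus makes this difference integral, so the floor recovers it exactly. *)
  exists (fun i => - Num.floor ((\row_i ((j ord0 i)%:~R / (m.*2)%:Z%:~R) + y - P) ord0 i : R)).
  move: hy; congr (_ < _); apply: eq_bigr => i _; congr (_ ^+ 2).
  rewrite mulrNz floorK; last exact: hz.
  by rewrite !mxE; ring.
move=> [z hz]; rewrite inE.
pose x : 'rV[R]_d := \row_i ((j ord0 i)%:~R / (m.*2)%:Z%:~R).
pose y : 'rV[R]_d := P - x - \row_i (z i)%:~R.
exists (to_torus y).
  exists y => //; apply/ballP; move: hz; congr (_ < _); apply: eq_bigr => i _.
  by rewrite !mxE.
rewrite /grid_pt -to_torusD; apply/to_torus_eqP/mxOverP => a b.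
by rewrite !mxE (_ : _ - _ = - (z b)%:~R) ?rpredN ?intr_int//; rewrite !ord1; ring.
Qed.

Lemma JJP m (j : int) : JJ (m.*2)%:Z j <-> - m%:Z <= j < m%:Z.
Proof.
rewrite /JJ /= (_ : (m.*2)%:Z%:Q / 2 = m%:Z%:Q); last by rewrite -muln2 PoszM intrM mulfK.
by rewrite -rmorphN ler_int ltr_int.
Qed.

Lemma JJ_cz m (j : int) : JJ (m.*2)%:Z j -> exists k : 'I_m.*2, cz k = j.
Proof.
move=> /JJP hj; have h : (`|(j + m%:Z)%R|%N < m.*2)%N by lia.
by exists (Ordinal h); rewrite /cz /=; lia.
Qed.

Lemma card_JJ m : #|` fset_set (JJ (m.*2)%:Z)|%fset = m.*2.
Proof.
apply: card_fset_set.
rewrite (_ : JJ _ = [set n%:Z - m%:Z | n in `I_(m.*2)]); first by apply: inj_card_eq => a b _ _; lia.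
apply/seteqP; split=> j.
  by move=> /JJP hj; exists `|(j + m%:Z)%R|%N => /=; lia.
by move=> [n /= hn <-]; apply/JJP; lia.
Qed.

Lemma sum_JJpow d m (F : 'rV[int]_d -> R) :
  \sum_(j \in JJpow d (m.*2)%:Z) F j = \sum_(f : {ffun 'I_d -> 'I_m.*2}) F (\row_i cz (f i)).
Proof.
rewrite (@reindex_fsbig _ _ _ _ _ (fun f : {ffun 'I_d -> 'I_m.*2} => \row_i cz (f i)) setT).
  rewrite (fsbigE (index_enum _)) ?index_enum_uniq//; first by apply: eq_bigl => f; rewrite in_setT.
  by move=> f _; rewrite mem_index_enum.
split.
- by move=> f _ i /=; rewrite mxE; apply/JJP; rewrite /cz; case: (f i) => n /= hn; lia.
- move=> f g _ _ /rowP fg; apply/ffunP => i; have := fg i; rewrite !mxE /cz => /addIr h.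
  by apply/ord_inj; case: h.
move=> j hj.
have [f fE] := choice (fun i => JJ_cz (hj i)).
by exists [ffun i => f i] => //; apply/rowP => i; rewrite mxE ffunE.
Qed.

Lemma ball_discrepancy_disc d m N (P : 'I_N -> 'rV[R]_d) (rho : R) (f : {ffun 'I_d -> 'I_m.*2}) :
  0 < rho ->
  ball_discrepancy (grid_pt R (m.*2)%:Z (\row_i cz (f i))) rho (fun n => to_torus (P n)) =
  disc (fun n i => P n ord0 i) (N%:R * fine (lebesgue_rV (eball d rho))) rho f.
Proof.
move=> rho0; rewrite /ball_discrepancy /disc; congr (_ - _); apply: eq_bigr => n _.
rewrite indic_tball//; congr ((nat_of_bool (hits _ _ _ _))%:R); apply/funext => i.
by rewrite mxE.
Qed.

End Grid.

Lemma even_pos_int (M : int) : 0 < M -> (2 %| M)%Z ->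
  exists2 m : nat, (0 < m)%N & M = (m.*2)%:Z.
Proof. by move=> M0 /dvdzP[q hq]; exists `|q|%N; lia. Qed.

Theorem theorem3 (R : realType) (d : nat) (hd : (1 <= d)%N)
    (hd4 : d != 1 %[mod 4]) :
  exists C c : R, 0 < C /\ 0 < c /\
    forall (r : R), 0 < r -> r < 1 / 4 ->
    forall (N : nat), (0 < N)%N ->
    forall (M : int), (2 %| M)%Z ->
      C * N%:R `^ (1 + 1 / (2 * d%:R)) * r^-1 <= M%:~R ->
    forall p : 'I_N -> torus R d,
      c * r `^ (d%:R / 2) * N%:R `^ (1 / 2 - 1 / (2 * d%:R)) <=
      Num.sqrt (1 / (#|` fset_set (JJ M)|%fset%:R ^+ d) *
        \sum_(1 <= k < 3) \sum_(j \in JJpow d M)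
          `|ball_discrepancy (grid_pt R M j) (k%:R * r) p| ^+ 2).
Proof.
have d4 : (d %% 4 != 1)%N by rewrite -[X in _ != X](modn_small (d := 4)).
have d2 : (2 <= d)%N by case: d hd d4 {hd4} => [|[|]].
have [C [c [C0 c0 H]]] := @mean_square_lower R d d2 d4; exists C, (Num.sqrt c); split=> //.
split=> [|r r0 r4 N N0 M M2 hM p]; first by rewrite sqrtr_gt0.
have NR0 : 0 < N%:R :> R by rewrite ltr0n.
have dR0 : d%:R != 0 :> R by rewrite pnatr_eq0 -lt0n.
pose nu : R := N%:R `^ d%:R^-1.
have nu0 : 0 < nu by rewrite powR_gt0.
have nuN : N%:R = nu ^+ d by rewrite -powR_mulrn ?(ltW nu0)// -powRrM mulVf// powRr1// ltW.
have nu1 : 1 <= nu.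
  by rewrite -(@ler_pXn2r _ d) ?nnegrE ?(ltW nu0)// -nuN expr1n ler1n.
have powE : N%:R `^ (1 + 1 / (2 * d%:R)) = N%:R * Num.sqrt nu :> R.
  rewrite powRD ?(gt_eqF NR0) ?implybT// powRr1 ?(ltW NR0)// -powR12_sqrt ?(ltW nu0)// -powRrM.
  by congr (_ * _ `^ _); rewrite div1r invfM mulrC.
have hM' : C * (N%:R * Num.sqrt nu) <= M%:~R * r by rewrite -ler_pdivrMr// -powE.
have Mr0 : 0 < M%:~R * r.
  by apply: lt_le_trans hM'; rewrite mulr_gt0// mulr_gt0// sqrtr_gt0.
(* The lower bound on [M] forces it to be positive. *)
have [m m0 Mm] : exists2 m : nat, (0 < m)%N & M = (m.*2)%:Z.
  have M0 : 0 < M by rewrite -(ltr0z R) -(pmulr_lgt0 _ r0).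
  exact: even_pos_int.
subst M.
have [P hP] := choice (fun n => to_torus_surj (p n)).
have {hP} -> : p = fun n => to_torus (P n) by apply/funext => n; rewrite hP.
rewrite card_JJ big_nat_recl//= big_nat1.
have sumE k : 0 < k -> \sum_(j \in JJpow d (m.*2)%:Z)
    `|ball_discrepancy (grid_pt R (m.*2)%:Z j) (k * r) (fun n => to_torus (P n))| ^+ 2 =
    \sum_(f : {ffun 'I_d -> 'I_m.*2}) disc (fun n i => P n ord0 i)
      (N%:R * fine (lebesgue_rV (eball d (k * r)))) (k * r) f ^+ 2.
  move=> k0; rewrite sum_JJpow; apply: eq_bigr => f _.
  by rewrite real_normK ?num_real// ball_discrepancy_disc// mulr_gt0.
rewrite sumE// sumE// [1 * r]mul1r.
have := H r nu N m (fun n i => P n ord0 i) (N%:R * fine (lebesgue_rV (eball d r)))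
  (N%:R * fine (lebesgue_rV (eball d (2 * r)))) r0 r4 N0 m0 nu1 nuN hM'.
rewrite [1 / _ ^+ d]div1r [X in _ <= Num.sqrt X]mulrC.
set Y := (X in _ <= Num.sqrt X) => h.
have sqE (y e : R) : (y `^ e) ^+ 2 = y `^ (e * 2).
  by rewrite powRrM -(powR_mulrn 2 (powR_ge0 y e)).
set x := _ * _ `^ _.
have x0 : 0 <= x by rewrite /x !mulr_ge0 ?powR_ge0 ?sqrtr_ge0.
(* Squares are compared: the square of the left-hand side is c r^d N^(1 - 1/d) = c r^d N / nu. *)
rewrite -[x]ger0_norm// -sqrtr_sqr; apply: ler_wsqrtr; apply: le_trans h.
rewrite /x !exprMn sqr_sqrtr ?(ltW c0)// !sqE.
rewrite divfK ?pnatr_eq0// powR_mulrn ?(ltW r0)//.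
rewrite (_ : (1 / 2 - 1 / (2 * d%:R)) * 2 = 1 - d%:R^-1); last by field.
rewrite -mulrA le_eqVlt; apply/orP; left; apply/eqP; congr (_ * (_ * _)).
apply: (mulIf (lt0r_neq0 nu0)); rewrite divfK ?(lt0r_neq0 nu0)// -powRD ?(gt_eqF NR0) ?implybT//.
by rewrite subrK powRr1// ltW.
Qed.
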